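(* Let $\mathcal{T}$ be a regular triangulation of $\Omega$, let $f\in P_0(\mathcal{T})$ be piecewise constant and let $\varphi_{\mathrm{RT}}\in\mathrm{RT}_0(\mathcal{T})$ satisfy $-\operatorname{div}\varphi_{\mathrm{RT}}=f$. Let $(p_h,\alpha_h)\in P_0(\mathcal{T};\mathbb{R}^2)\times(P_1(\mathcal{T})\cap Y)$ be the solution of $$(p_h,q_h)_{L^2(\Omega)}+(q_h,\operatorname{Curl}\alpha_h)_{L^2(\Omega)}=(\varphi_{\mathrm{RT}},q_h)_{L^2(\Omega)}\quad\text{for all }q_h\in P_0(\mathcal{T};\mathbb{R}^2),$$ $$(p_h,\operatorname{Curl}\beta_h)_{L^2(\Omega)}=0\quad\text{for all }\beta_h\in P_1(\mathcal{T})\cap Y,$$ and let $u_{\mathrm{CR}}\in\mathrm{CR}^1_0(\mathcal{T})$ be the solution of $$(\nabla_{\mathrm{NC}}u_{\mathrm{CR}},\nabla_{\mathrm{NC}}v_{\mathrm{CR}})_{L^2(\Omega)}=(f,v_{\mathrm{CR}})_{L^2(\Omega)}\quad\text{for all }v_{\mathrm{CR}}\in\mathrm{CR}^1_0(\mathcal{T}).$$ Then $p_h=\nabla_{\mathrm{NC}}u_{\mathrm{CR}}$.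
   Context: $\Omega\subseteq\mathbb{R}^2$ is a simply connected, bounded, polygonal Lipschitz domain. $L^2_0(\Omega)$ is the set of $L^2(\Omega)$ functions with vanishing integral mean and $Y:=H^1(\Omega)\cap L^2_0(\Omega)$. For scalar $\beta$, $\operatorname{Curl}\beta:=(\partial\beta/\partial x_2,-\partial\beta/\partial x_1)$. A regular triangulation $\mathcal{T}$ of $\Omega$ is a finite set of closed triangles with $\overline\Omega=\bigcup\mathcal{T}$ such that any two distinct triangles are either disjoint or share exactly one common edge or one vertex. $P_k(\mathcal{T})$ (resp. $P_k(\mathcal{T};\mathbb{R}^2)$) is the space of functions (resp. vector fields) which are, on each $T\in\mathcal{T}$, (componentwise) polynomials of total degree $\le k$. $\mathrm{CR}^1_0(\mathcal{T})$ is the Crouzeix–Raviart space of all $v_{\mathrm{CR}}\in P_1(\mathcal{T})$ which are continuous at midpoints of interior edges and vanish at midpoints of boundary edges. $\nabla_{\mathrm{NC}}$ denotes the piecewise gradient, $(\nabla_{\mathrm{NC}}v)|_T:=\nabla(v|_T)$ for all $T\in\mathcal{T}$. $H(\operatorname{div},\Omega)$ is the space of $L^2$ vector fields with weak divergence in $L^2(\Omega)$, and $\mathrm{RT}_0(\mathcal{T})$ is the space of all $q_{\mathrm{RT}}\in H(\operatorname{div},\Omega)$ such that for every $T\in\mathcal{T}$ there are $a_T\in\mathbb{R}^2$, $b_T\in\mathbb{R}$ with $q_{\mathrm{RT}}(x)=a_T+b_Tx$ for $x\in T$. *)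

(* Defs.v *)
From HB Require Import structures.
From mathcomp Require Import all_boot all_order all_algebra.
From mathcomp Require Import all_classical all_reals all_analysis.

Set Implicit Arguments.
Unset Strict Implicit.
Unset Printing Implicit Defensive.

Import Order.TTheory GRing.Theory Num.Theory.
Import numFieldNormedType.Exports.

Local Open Scope classical_set_scope.
Local Open Scope ring_scope.

Definition boundary {T : topologicalType} (A : set T) : set T :=
  closure A `\` A°.

Section Plane.
Context {R : realType}.

Local Notation plane := (R * R)%type.

Definition e1 : plane := (1, 0).
Definition e2 : plane := (0, 1).

Definition dot (x y : plane) : R := x.1 * y.1 + x.2 * y.2.

(* The plane with its Borel sigma-algebra *)
Local Notation mplane := (measurableTypeR R * measurableTypeR R)%type.

Definition lebesgue2 : {measure set mplane -> \bar R} :=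
  (@lebesgue_measure R \x @lebesgue_measure R)%E.

Definition segment (a b : plane) : set plane :=
  [set x | exists t : R, 0 <= t <= 1 /\ x = (1 - t) *: a + t *: b].

Definition midpoint (a b : plane) : plane := 2^-1 *: (a + b).

Definition noncollinear (a b c : plane) : Prop :=
  (b.1 - a.1) * (c.2 - a.2) - (b.2 - a.2) * (c.1 - a.1) != 0.

Definition conv3 (a b c : plane) : set plane :=
  [set x | exists r s t : R, [/\ 0 <= r, 0 <= s, 0 <= t, r + s + t = 1
    & x = r *: a + s *: b + t *: c]].

(* A triangle is represented by its underlying point set.  The points [a], [b]
   and [c] below are the extreme points of [T], so the set determines them up
   to order. *)
Definition triangle_with (T : set plane) (a b c : plane) : Prop :=
  noncollinear a b c /\ T = conv3 a b c.

Definition is_triangle (T : set plane) : Prop :=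
  exists a b c, triangle_with T a b c.

Definition is_vertex (T : set plane) (a : plane) : Prop :=
  exists b c, triangle_with T a b c.

Definition is_edge (T : set plane) (a b : plane) : Prop :=
  exists c, triangle_with T a b c.

Definition path_in (A : set plane) (g : R -> plane) : Prop :=
  {within `[0, 1], continuous g} /\ (forall t : R, 0 <= t <= 1 -> A (g t)).

Definition simply_connected (A : set plane) : Prop :=
  (forall x y, A x -> A y -> exists g, [/\ path_in A g, g 0 = x & g 1 = y]) /\
  (forall g : R -> plane, path_in A g -> g 0 = g 1 ->
    exists H : R * R -> plane,
      [/\ {within `[0, 1] `*` `[0, 1], continuous H},
          forall t s : R, 0 <= t <= 1 -> 0 <= s <= 1 -> A (H (t, s)),
          forall t : R, 0 <= t <= 1 -> H (t, 0) = g t,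
          forall t : R, 0 <= t <= 1 -> H (t, 1) = g 0
        & forall s : R, 0 <= s <= 1 -> H (0, s) = g 0 /\ H (1, s) = g 0]).

(* Near each boundary point, in the coordinates relative to some orthonormal
   basis [(c, s), (- s, c)], the set is the strict subgraph of a Lipschitz
   function. *)
Definition lipschitz_boundary (Omega : set plane) : Prop :=
  forall z, boundary Omega z ->
  exists (c s r k : R) (g : R -> R),
    [/\ c ^+ 2 + s ^+ 2 = 1, 0 < r, k.-lipschitz g
      & forall y, ball z r y ->
          (Omega y <-> dot (- s, c) y < g (dot (c, s) y))].

Definition polygonal (Omega : set plane) : Prop :=
  exists S : seq (plane * plane),
    boundary Omega = \bigcup_(e in [set` S]) segment e.1 e.2.

Definition polygonal_lipschitz_domain (Omega : set plane) : Prop :=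
  [/\ open Omega, connected Omega, Omega !=set0, bounded_set Omega
    & polygonal Omega /\ lipschitz_boundary Omega].

Definition regular_triangulation (Omega : set plane) (Tr : set (set plane)) :
    Prop :=
  [/\ finite_set Tr,
      forall T, Tr T -> is_triangle T,
      closure Omega = \bigcup_(T in Tr) T
    & forall T1 T2, Tr T1 -> Tr T2 -> T1 <> T2 ->
      [\/ T1 `&` T2 = set0,
          exists a b, [/\ is_edge T1 a b, is_edge T2 a b
                        & T1 `&` T2 = segment a b]
        | exists a, [/\ is_vertex T1 a, is_vertex T2 a
                      & T1 `&` T2 = [set a]]]].

(* Elements of L^2 are represented by functions on the whole plane that are
   Borel measurable on [Omega]; values outside [Omega] are irrelevant. *)
Definition L2 (Omega : set plane) (u : plane -> R) : Prop :=
  measurable_fun (Omega : set mplane) u /\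
  lebesgue2.-integrable Omega (fun x => (u x ^+ 2)%:E).

Definition L2v (Omega : set plane) (q : plane -> plane) : Prop :=
  L2 Omega (fst \o q) /\ L2 Omega (snd \o q).

Definition inner (Omega : set plane) (u v : plane -> R) : R :=
  \int[lebesgue2]_(x in Omega) (u x * v x).

Definition innerv (Omega : set plane) (p q : plane -> plane) : R :=
  \int[lebesgue2]_(x in Omega) dot (p x) (q x).

Fixpoint Ck (k : nat) (phi : plane -> R) : Prop :=
  continuous phi /\
  if k is k'.+1 then
    forall e, e = e1 \/ e = e2 ->
      (forall x, derivable phi x e) /\ Ck k' (fun x => 'D_e phi x)
  else True.

Definition test_function (Omega : set plane) (phi : plane -> R) : Prop :=
  (forall k, Ck k phi) /\
  exists K, [/\ compact K, K `<=` Omega & forall x, ~ K x -> phi x = 0].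

Definition is_weak_partial (Omega : set plane) (e : plane) (u g : plane -> R) :
    Prop :=
  forall phi, test_function Omega phi ->
    inner Omega u (fun x => 'D_e phi x) = - inner Omega g phi.

Definition is_weak_div (Omega : set plane) (q : plane -> plane) (d : plane -> R) :
    Prop :=
  forall phi, test_function Omega phi ->
    innerv Omega q (fun x => ('D_e1 phi x, 'D_e2 phi x)) = - inner Omega d phi.

Definition weak_partials (Omega : set plane) (e : plane) (u : plane -> R) :
    set (plane -> R) :=
  [set g | L2 Omega g /\ is_weak_partial Omega e u g].

(* A representative of the weak derivative, unique up to null sets *)
Definition weak_partial (Omega : set plane) (e : plane) (u : plane -> R) :
    plane -> R :=
  xget (fun=> 0) (weak_partials Omega e u).

Definition H1 (Omega : set plane) (u : plane -> R) : Prop :=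
  [/\ L2 Omega u, weak_partials Omega e1 u !=set0 & weak_partials Omega e2 u !=set0].

Definition Hdiv (Omega : set plane) (q : plane -> plane) : Prop :=
  L2v Omega q /\ exists d, L2 Omega d /\ is_weak_div Omega q d.

Definition L20 (Omega : set plane) (u : plane -> R) : Prop :=
  L2 Omega u /\ \int[lebesgue2]_(x in Omega) u x = 0.

Definition Y (Omega : set plane) (u : plane -> R) : Prop := H1 Omega u /\ L20 Omega u.

Definition Curl (Omega : set plane) (b : plane -> R) : plane -> plane :=
  fun x => (weak_partial Omega e2 b x, - weak_partial Omega e1 b x).

Definition poly2 (k : nat) (p : plane -> R) : Prop :=
  exists c : nat -> nat -> R, forall x,
    p x = \sum_(i < k.+1) \sum_(j < k.+1 | (i + j <= k)%N)
            c i j * x.1 ^+ i * x.2 ^+ j.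

(* Piecewise polynomials may jump across edges: they are only prescribed in
   the interior of each triangle, i.e. up to a null set. *)
Definition Pk (Omega : set plane) (Tr : set (set plane)) (k : nat)
    (u : plane -> R) : Prop :=
  measurable_fun (Omega : set mplane) u /\
  forall T, Tr T -> exists2 p, poly2 k p & forall x, T° x -> u x = p x.

Definition Pkv (Omega : set plane) (Tr : set (set plane)) (k : nat)
    (q : plane -> plane) : Prop :=
  Pk Omega Tr k (fst \o q) /\ Pk Omega Tr k (snd \o q).

Definition RT0 (Omega : set plane) (Tr : set (set plane)) (q : plane -> plane) :
    Prop :=
  Hdiv Omega q /\
  forall T, Tr T -> exists (a : plane) (b : R),
    forall x, T° x -> q x = a + b *: x.

(* [l] is the value at [m] of the continuous extension of [u] from the
   interior of [T] *)
Definition trace_at (T : set plane) (u : plane -> R) (m : plane) (l : R) :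
    Prop :=
  u @ within T° (nbhs m) --> l.

(* A boundary edge is an edge contained in the boundary of [Omega], any other
   edge is interior.  Continuity at a midpoint is the agreement of the traces
   from the adjacent triangles, since values on edges are immaterial. *)
Definition CR10 (Omega : set plane) (Tr : set (set plane)) (v : plane -> R) :
    Prop :=
  [/\ Pk Omega Tr 1 v,
      forall T1 T2 a b, Tr T1 -> Tr T2 -> is_edge T1 a b -> is_edge T2 a b ->
        ~ (segment a b `<=` boundary Omega) ->
        exists l, trace_at T1 v (midpoint a b) l /\
                  trace_at T2 v (midpoint a b) l
    & forall T a b, Tr T -> is_edge T a b -> segment a b `<=` boundary Omega ->
        trace_at T v (midpoint a b) 0].

(* The gradient is classical inside the triangles, and set to [0] on the
   null set of their boundaries. *)
Definition gradNC (Tr : set (set plane)) (v : plane -> R) : plane -> plane :=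
  fun x => if `[< exists2 T, Tr T & T° x >] then ('D_e1 v x, 'D_e2 v x)
           else (0, 0).

End Plane.

(* Main.v *)
(* Both p_h and grad_NC u_CR are piecewise constant; let r be their difference.

   A piecewise field a + b x with piecewise constant weak divergence has continuous
   normal components across the interior edges, so the midpoint rule shows that
   its pairing with the piecewise gradient and the values of a Crouzeix-Raviart
   function v vanishes.  Applied to phi_RT and to Curl alpha_h this turns the mixed
   equation tested with grad_NC v into the Crouzeix-Raviart equation, whence r is
   orthogonal to every grad_NC v.  For v concentrated on one edge this says that
   the normal component of r is continuous across that edge.  Hence the rotated
   field has continuous tangential components and, Omega being simply connected, is
   the gradient of a continuous piecewise affine beta, that is, r = Curl beta.  The
   second mixed equation gives (p_h, r) = 0, while (grad_NC u_CR, r) = 0 by the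
   orthogonality; so (r, r) = 0.

   The weak derivatives of beta are obtained without traces or a divergence theorem
   on triangles: for a test function phi, beta phi is Lipschitz, and the integrals of
   its difference quotients vanish by translation invariance. *)

Require Import Defs.
From mathcomp Require Import all_boot all_order all_algebra.
From mathcomp Require Import all_classical all_reals all_analysis.
From mathcomp Require Import measurable_realfun ring lra.
Set Implicit Arguments.
Unset Strict Implicit.
Unset Printing Implicit Defensive.
Import Order.TTheory GRing.Theory Num.Theory.
Import numFieldNormedType.Exports.
Local Open Scope classical_set_scope.
Local Open Scope ring_scope.

(** * Lebesgue measure on the plane *)

Section PlaneMeasure.
Context {R : realType}.
Local Notation plane := (R * R)%type.
Local Notation mplane := (measurableTypeR R * measurableTypeR R)%type.
Local Notation mu := (@lebesgue2 R).

(** Functions are prescribed only inside the open triangles, and the weak derivatives behind [Curl]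
    are chosen representatives, so nothing may be evaluated on an edge. All information comes from
    testing: bumps inside one triangle, converging to its indicator, reveal local values, and a bump
    across one edge reveals the jump of the flux there. In barycentric coordinates the second
    computation reduces to one-variable derivatives, because the normal component of [a + b x] is
    constant along a line.

    Combinatorially an edge is interior when two triangles share it. That this agrees with not lying
    in the boundary of [Omega] rests on the Lipschitz condition, by which interior points of the
    closure belong to [Omega]; a slit domain would break it.

    Simple connectedness is a statement about homotopies of loops, so the potential is built as in
    covering theory: increments on single triangles are lifted along paths and over homotopy
    squares, and uniqueness of lifts makes the result independent of the path. The lifts start
    locally because finitely many closed triangles leave a neighbourhood of each point to those that
    contain it. *)

Lemma open_measurable_plane (A : set plane) : open A -> measurable (A : set mplane).
Proof.
move=> oA.
pose box (p : rat * rat * (rat * rat)) : set mplane :=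
  `]ratr p.1.1, ratr p.1.2[ `*` `]ratr p.2.1, ratr p.2.2[.
(* The rational open boxes inside [A] cover it, and there are countably many of them. *)
have -> : (A : set mplane) = \bigcup_(p in [set p | box p `<=` A]) box p.
  apply/seteqP; split => [[x y] Axy|x [p /= pA] /pA//].
  have /nbhs_ballP[e /= e0 eA] : nbhs (x, y) A by exact: open_nbhs_nbhs.
  have rq (z : R) : exists p q : rat, [/\ ratr p < z, z < ratr q, z - e < ratr p & ratr q < z + e].
    have [|p /itvP ph] := @rat_in_itvoo R (z - e) z; first by rewrite ltrBlDr ltrDl.
    have [|q /itvP qh] := @rat_in_itvoo R z (z + e); first by rewrite ltrDl.
    by exists p, q; rewrite !ph !qh.
  have [p1 [q1 [? ? h1 h2]]] := rq x; have [p2 [q2 [? ? h3 h4]]] := rq y.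
  exists ((p1, q1), (p2, q2)) => [/= [u v] /= [uh vh]|]; last first.
    by split; rewrite /= in_itv /=; apply/andP.
  move: uh vh; rewrite /= !in_itv /= => /andP[? ?] /andP[? ?].
  apply: eA; split; rewrite /ball /= ltr_distlC; apply/andP; split.
  - exact: lt_trans h1 _.
  - exact: lt_trans h2.
  - exact: lt_trans h3 _.
  - exact: lt_trans h4.
rewrite bigcup_mkcond; apply: countable_bigcupT_measurable => // p.
case: ifPn => // _; exact: measurableX.
Qed.

Lemma continuous_measurable_plane (f : plane -> R) :
  continuous f -> measurable_fun setT (f : mplane -> R).
Proof.
move=> cf; apply: (measurability _ (RGenOpens.measurableE R)) => _ [_ [a [b ->] <-]].
rewrite setTI; apply: open_measurable_plane; exact: open_comp.
Qed.

(** Stated through preimages, so for an affine map [k] is the inverse of the modulus of the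
    determinant; constants then multiply under composition, and integrals of [F \o phi] follow by
    pushforward. *)
Definition scales_measure (phi : mplane -> mplane) (k : R) :=
  [/\ measurable_fun setT phi, 0 < k &
  forall A, measurable A -> mu (phi @^-1` A) = (k%:E * mu A)%E].

Lemma scales_measure_comp phi psi k l :
  scales_measure phi k -> scales_measure psi l -> scales_measure (phi \o psi) (k * l).
Proof.
move=> [mphi k0 hphi] [mpsi l0 hpsi]; split; rewrite ?mulr_gt0//.
  exact: measurableT_comp.
move=> A mA; rewrite comp_preimage hpsi ?hphi ?muleA -?EFinM 1?(mulrC l)//.
by rewrite -[X in measurable X]setTI; exact: mphi.
Qed.

Lemma continuous_affine (a b c : R) :
  continuous (fun p : plane => a * p.1 + b * p.2 + c).
Proof.
move=> p; apply: cvgD; last exact: cvg_cst.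
by apply: cvgD; apply: cvgM; [exact: cvg_cst|exact: cvg_fst|exact: cvg_cst|exact: cvg_snd].
Qed.

(** Bundles the rescaled pushforward as a measure, the form to which the uniqueness theorems on
    intervals and rectangles apply. *)
Lemma scaled_pushforward d (T : measurableType d) (m : {measure set T -> \bar R})
    (psi : T -> T) (k : R) : measurable_fun setT psi -> 0 <= k ->
  {m' : {measure set T -> \bar R} | forall A, m' A = (k%:E * m (psi @^-1` A))%E}.
Proof.
move=> mpsi k0.
by unshelve eexists (mscale (NngNum k0) (pushforward m psi)).
Qed.

(** Up to the factor both sides are measures in [A], so half-open intervals decide. For [a < 0] the
    preimage is open at the other end, which does not change its length. *)
Lemma lebesgue_measure_affine (a b : R) (A : set R) : a != 0 -> measurable A ->
  lebesgue_measure ((fun x => a * x + b) @^-1` A) =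
  (`|a|^-1%:E * lebesgue_measure A)%E.
Proof.
move=> a0 mA.
pose psi := (fun x : measurableTypeR R => a * x + b : measurableTypeR R).
have mpsi : measurable_fun setT psi.
  by apply: measurable_funD => //; exact: measurable_funM.
suff h : (`|a|%:E * lebesgue_measure (psi @^-1` A) = lebesgue_measure A)%E.
  by rewrite -h muleA -EFinM mulVf ?mul1e ?normr_eq0.
apply/esym.
have [m mE] := scaled_pushforward (@lebesgue_measure R) mpsi (normr_ge0 a).
have an : ~~ (0 < a) -> a < 0 by rewrite -leNgt le_eqVlt (negPf a0).
have pre (u v : R) : psi @^-1` `]u, v] =
  if 0 < a then `](u - b) / a, (v - b) / a]%classic else `[(v - b) / a, (u - b) / a[%classic.
  apply/seteqP; split => x; rewrite /psi /=; case: ifPn => [a_gt|]; rewrite /= ?in_itv /=.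
  - by rewrite ltr_pdivrMr// ler_pdivlMr// ltrBlDr lerBrDr mulrC.
  - move=> /an al.
    by rewrite ltr_ndivlMr// ler_ndivrMr// lerBrDr ltrBlDr mulrC andbC.
  - by rewrite ltr_pdivrMr// ler_pdivlMr// ltrBlDr lerBrDr mulrC.
  - move=> /an al.
    by rewrite ltr_ndivlMr// ler_ndivrMr// lerBrDr ltrBlDr mulrC andbC.
rewrite -mE; apply: lebesgue_measure_unique => // _ [[u v]] _ <-.
rewrite [RHS]mE pre.
rewrite lebesgue_measure_itv /= lte_fin.
case: (boolP (0 < a)) => [a_gt|].
  rewrite (lebesgue_measure_itv `](u - b) / a, (v - b) / a]) /= lte_fin.
  rewrite ltr_pM2r ?invr_gt0// ltrD2r; case: ifPn => _; rewrite ?mule0//.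
  rewrite -!EFinD -EFinM; congr _%:E.
  by rewrite gtr0_norm//; field.
move=> /an al.
rewrite (lebesgue_measure_itv `[(v - b) / a, (u - b) / a[) /= lte_fin.
rewrite ltr_nM2r ?invr_lt0// ltrD2r; case: ifPn => _; rewrite ?mule0//.
rewrite -!EFinD -EFinM; congr _%:E.
by rewrite ltr0_norm//; field.
Qed.

(** Uniqueness on rectangles allows integrating over sections in the other order, the one in which
    the maps of [scales_measure_upper] act affinely on each section. *)
Lemma lebesgue2_ysection (X : set mplane) : measurable X ->
  mu X = (\int[lebesgue_measure]_y lebesgue_measure (ysection X y))%E.
Proof.
move=> mX; apply: (product_measure_unique (m' := (lebesgue_measure \x^ lebesgue_measure)%E)) => //.
by move=> A B mA mB; exact: (product_measure2E _ _ mA mB).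
Qed.

Lemma scales_measure_swap : scales_measure (fun p => (p.2, p.1)) 1.
Proof.
have msw : measurable_fun setT (fun p : mplane => (p.2, p.1) : mplane).
  by apply/measurable_fun_pairP; split; [exact: measurable_snd|exact: measurable_fst].
split => // A mA; rewrite mul1e; apply/esym.
have [m mE] := scaled_pushforward mu msw ler01.
rewrite -[RHS]mul1e -[RHS]mE; apply: product_measure_unique => // B C mB mC.
rewrite mE mul1e.
have -> : (fun p : mplane => (p.2, p.1) : mplane) @^-1` (B `*` C) = C `*` B.
  by apply/seteqP; split => -[x y] [/= ? ?]; split.
by rewrite [LHS]product_measure1E// muleC.
Qed.

(** For a fixed second coordinate the map is affine of slope [a] in the first, the shear [b] only
    translating it; integrating over sections leaves a one-dimensional scaling by [c]. *)
Lemma scales_measure_upper (a b e c f : R) : a != 0 -> c != 0 ->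
  scales_measure (fun p => (a * p.1 + b * p.2 + e, c * p.2 + f)) (`|a * c|^-1).
Proof.
move=> a0 c0; pose phi (p : mplane) : mplane := (a * p.1 + b * p.2 + e, c * p.2 + f).
have mphi : measurable_fun setT phi.
  apply/measurable_fun_pairP; split;
    apply: continuous_measurable_plane; first exact: continuous_affine.
  have -> : snd \o phi = fun p : plane => 0 * p.1 + c * p.2 + f; last exact: continuous_affine.
  by apply/funext => p /=; rewrite mul0r add0r.
split => //; first by rewrite invr_gt0 normr_gt0 mulf_neq0.
have ac0 : `|a * c| != 0 by rewrite normr_eq0 mulf_neq0.
move=> A mA.
suff h : (`|a * c|%:E * mu (phi @^-1` A) = mu A)%E.
  by rewrite -h muleA -EFinM mulVf ?mul1e.
have [m mE] := scaled_pushforward mu mphi (normr_ge0 (a * c)).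
rewrite -mE; apply/esym; apply: product_measure_unique => // B C mB mC.
rewrite mE lebesgue2_ysection; last first.
  by rewrite -[X in measurable X]setTI; apply: mphi => //; exact: measurableX.
pose C' := (fun y => c * y + f) @^-1` C.
have mC' : measurable (C' : set (measurableTypeR R)).
  rewrite -[X in measurable X]setTI.
  have : measurable_fun setT (fun y : measurableTypeR R => c * y + f : measurableTypeR R).
    by apply: measurable_funD => //; exact: measurable_funM.
  exact.
transitivity (`|a * c|%:E * \int[lebesgue_measure]_(y in C') ((`|a|^-1)%:E * lebesgue_measure B))%E.
  congr (_ * _)%E; rewrite [RHS]integral_mkcond; apply: eq_integral => y _.
  rewrite patchE; case: ifPn => [/set_mem|/negP/(contra_not (@mem_set _ _ _))] Cy.
    rewrite -(@lebesgue_measure_affine a (b * y + e))//; congr (lebesgue_measure _).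
    by apply/seteqP; split => x; rewrite /ysection /= inE /phi /= addrA => // -[].
  rewrite (_ : ysection _ _ = set0) ?measure0//; apply/seteqP; split => // x.
  by rewrite /ysection /= inE /phi /= => -[] _ /Cy.
rewrite integral_cst// [X in (_ * (_ * X))%E](lebesgue_measure_affine f c0)//.
have gen (x y : \bar R) : (`|a * c|%:E * (`|a|^-1%:E * x * (`|c|^-1%:E * y)) = x * y)%E.
  rewrite -(muleA _ x) (muleCA x) !muleA -!EFinM normrM.
  by rewrite (_ : `|a| * `|c| / `|a| / `|c| = 1) ?mul1e//; field; rewrite !normr_eq0 a0 c0.
exact: gen.
Qed.

Lemma scales_measure_eq phi psi k l : phi =1 psi -> k = l ->
  scales_measure phi k -> scales_measure psi l.
Proof. by move=> /funext -> ->. Qed.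

(** LU factorisation: with pivot [u.1] the matrix is a lower times an upper triangular one, and the
    lower one is an upper one conjugated by the swap. If the pivot vanishes, exchanging the columns
    makes [v.1] the pivot. *)
Lemma scales_measure_linear (a u v : plane) : u.1 * v.2 - u.2 * v.1 != 0 ->
  scales_measure (fun p => (a.1 + p.1 * u.1 + p.2 * v.1, a.2 + p.1 * u.2 + p.2 * v.2))
    (`|u.1 * v.2 - u.2 * v.1|^-1).
Proof.
have gen (c d w : plane) : d.1 != 0 -> d.1 * w.2 - d.2 * w.1 != 0 ->
  scales_measure (fun p => (c.1 + p.1 * d.1 + p.2 * w.1, c.2 + p.1 * d.2 + p.2 * w.2))
    (`|d.1 * w.2 - d.2 * w.1|^-1).
  move=> d0 D0.
  have k0 : (d.1 * w.2 - d.2 * w.1) / d.1 != 0 by rewrite mulf_neq0 ?invr_eq0.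
  have h1 := scales_measure_upper w.1 c.1 0 d0 (oner_neq0 R).
  have h2 := scales_measure_upper (d.2 / d.1) (c.2 - d.2 / d.1 * c.1) 0 k0 (oner_neq0 R).
  apply: scales_measure_eq (scales_measure_comp scales_measure_swap
    (scales_measure_comp h2 (scales_measure_comp scales_measure_swap h1))) => /=.
    by move=> p /=; congr pair; field.
  rewrite !mul1r !mulr1 normrM normfV; field.
  by rewrite !normr_eq0 d0 D0.
move=> D0; have [u0|u0] := eqVneq u.1 0; last exact: gen.
have v0 : v.1 != 0 by apply: contraNneq D0 => v0; rewrite u0 v0 mul0r mulr0 subrr.
have D0' : v.1 * u.2 - v.2 * u.1 != 0 by rewrite -oppr_eq0 opprB mulrC [v.1 * _]mulrC.
apply: scales_measure_eq (scales_measure_comp (gen a v u v0 D0') scales_measure_swap) => /=.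
  by move=> p /=; congr pair; rewrite -!addrA [X in _ + X]addrC.
by rewrite mulr1 -normrN; congr (`| _ |^-1); ring.
Qed.

Lemma scales_integral_ge0 phi k (F : mplane -> \bar R) : scales_measure phi k ->
  measurable_fun setT F -> (forall x, 0 <= F x)%E ->
  (\int[mu]_x F (phi x) = k%:E * \int[mu]_x F x)%E.
Proof.
move=> [mphi k0 hphi] mF F0.
rewrite -[LHS](ge0_integral_pushforward mphi mu (D := setT))//.
pose m := mscale (NngNum (ltW k0)) mu.
transitivity (\int[m]_x F x)%E; last by rewrite ge0_integral_mscale.
by apply: eq_measure_integral => A mA _; rewrite [LHS]hphi.
Qed.

Lemma scales_integral phi k (F : mplane -> R) : scales_measure phi k ->
  mu.-integrable setT (EFin \o F) ->
  mu.-integrable setT (EFin \o (F \o phi)) /\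
  \int[mu]_x F (phi x) = k * \int[mu]_x F x.
Proof.
move=> hs iF; have mF := measurable_int _ iF.
have [mphi k0 _] := hs.
have iFp : mu.-integrable setT (EFin \o (F \o phi)).
  apply/integrableP; split; first exact: (measurableT_comp mF mphi).
  have /= -> := scales_integral_ge0 hs (measurableT_comp (@abse_measurable R setT) mF) (fun x => abse_ge0 _).
  by apply: lte_mul_pinfty; rewrite ?lee_fin ?ltW//; case/integrableP : iF.
split => //.
rewrite /Rintegral integralE [in RHS]integralE.
rewrite (_ : (fun x => (F (phi x))%:E)^\+%E = (EFin \o F)^\+%E \o phi);
  last by apply/funext => x; rewrite /= !funeposE.
rewrite (_ : (fun x => (F (phi x))%:E)^\-%E = (EFin \o F)^\-%E \o phi);
  last by apply/funext => x; rewrite /= !funenegE.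
rewrite (scales_integral_ge0 hs (measurable_funepos mF))//.
rewrite (scales_integral_ge0 hs (measurable_funeneg mF))//.
have fp := integrable_pos_fin_num measurableT iF; have fn := integrable_neg_fin_num measurableT iF.
by rewrite -(fineK fp) -(fineK fn) -!EFinM -!EFinB /= mulrBr.
Qed.

End PlaneMeasure.

(** * Bounded functions with bounded support *)

Section BoundedSupport.
Context {R : realType}.
Local Notation plane := (R * R)%type.
Local Notation mplane := (measurableTypeR R * measurableTypeR R)%type.
Local Notation mu := (@lebesgue2 R).

Definition box (M : R) : set plane := [set x | `|x.1| <= M /\ `|x.2| <= M].

Definition loc_bounded (F : plane -> R) :=
  measurable_fun setT (F : mplane -> R) /\
  forall M, exists C : R, forall x, box M x -> `|F x| <= C.

(** The common class of all integrands on the whole plane: stable under sums, translations and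
    locally bounded factors, with integrable members, so that linearity of the integral costs no
    side conditions. *)
Definition bounded_supp (F : plane -> R) :=
  loc_bounded F /\ exists M, forall x, ~ box M x -> F x = 0.

Lemma box_prod M : box M = `[- M, M] `*` `[- M, M].
Proof.
by apply/seteqP; split => -[x y]; rewrite /box /= !in_itv /= !ler_norml.
Qed.

Lemma box_measurable M : measurable (box M : set mplane).
Proof. by rewrite box_prod; exact: measurableX. Qed.

Lemma box_compact M : compact (box M).
Proof.
by rewrite box_prod; apply: compact_setX; exact: segment_compact.
Qed.

Lemma box_finite M : (mu (box M : set mplane) < +oo)%E.
Proof.
rewrite box_prod [X in (X < _)%E]product_measure1E//= lte_mul_pinfty// ?ge0_fin_numE//.
all: by rewrite lebesgue_measure_itv /=; case: ifP; rewrite // -EFinB ltry.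
Qed.

Lemma loc_bounded_measurable F (D : set mplane) : loc_bounded F ->
  measurable_fun D (F : mplane -> R).
Proof. by case=> h _; exact: measurable_funS h. Qed.

Lemma loc_bounded_cont F : continuous F -> loc_bounded F.
Proof.
move=> cF; split; first exact: continuous_measurable_plane.
move=> M; have [|C [_ /(_ (C + 1)) h]] := @compact_bounded _ _ (F @` box M).
  apply: continuous_compact; [exact: continuous_subspaceT|exact: box_compact].
by exists (C + 1) => x bx; apply: h; [rewrite ltrDl|exists x].
Qed.

Lemma loc_bounded_cst (c : R) : loc_bounded (fun=> c).
Proof. by apply: loc_bounded_cont => x; exact: cvg_cst. Qed.

Lemma loc_boundedD F G : loc_bounded F -> loc_bounded G ->
  loc_bounded (fun x => F x + G x).
Proof.
move=> [mF hF] [mG hG]; split; first exact: measurable_funD.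
move=> M; have [C hC] := hF M; have [C' hC'] := hG M; exists (C + C') => x bx.
by rewrite (le_trans (ler_normD _ _))// lerD ?hC ?hC'.
Qed.

Lemma loc_boundedM F G : loc_bounded F -> loc_bounded G ->
  loc_bounded (fun x => F x * G x).
Proof.
move=> [mF hF] [mG hG]; split; first exact: measurable_funM.
move=> M; have [C hC] := hF M; have [C' hC'] := hG M; exists (C * C') => x bx.
by rewrite normrM ler_pM ?hC ?hC'.
Qed.

Lemma loc_bounded_indic (A : set plane) : measurable (A : set mplane) ->
  loc_bounded (\1_A).
Proof.
move=> mA; split; first exact: measurable_indic.
by move=> M; exists 1 => x _; rewrite indicE; case: (_ \in _); rewrite ?normr1 ?normr0.
Qed.

Lemma bounded_suppD F G : bounded_supp F -> bounded_supp G ->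
  bounded_supp (fun x => F x + G x).
Proof.
move=> [lF [M hF]] [lG [M' hG]]; split; first exact: loc_boundedD.
exists (Num.max M M') => x bx; rewrite hF ?hG ?addr0// => -[h1 h2]; apply: bx;
by split; rewrite le_max ?h1 ?h2 ?orbT.
Qed.

Lemma bounded_suppMl F G : loc_bounded F -> bounded_supp G ->
  bounded_supp (fun x => F x * G x).
Proof.
move=> lF [lG [M hG]]; split; first exact: loc_boundedM.
by exists M => x /hG ->; rewrite mulr0.
Qed.

Lemma bounded_suppN F : bounded_supp F -> bounded_supp (fun x => - F x).
Proof.
move=> hF; have := bounded_suppMl (loc_bounded_cst (-1)) hF.
by congr bounded_supp; apply/funext => x; rewrite mulN1r.
Qed.

Lemma bounded_supp_sum (I : Type) (s : seq I) (F : I -> plane -> R) :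
  (forall i, bounded_supp (F i)) -> bounded_supp (fun x => \sum_(i <- s) F i x).
Proof.
move=> hF; elim: s => [|i s ih].
  have -> : (fun x => \sum_(i <- [::]) F i x) = (fun=> 0).
    by apply/funext => x; rewrite big_nil.
  by split; [exact: loc_bounded_cst|exists 0].
have -> : (fun x => \sum_(i <- i :: s) F i x) = (fun x => F i x + \sum_(i <- s) F i x).
  by apply/funext => x; rewrite big_cons.
exact: bounded_suppD.
Qed.

Lemma bounded_supp_indic (A : set plane) M : measurable (A : set mplane) ->
  A `<=` box M -> bounded_supp (\1_A).
Proof.
move=> mA AM; split; first exact: loc_bounded_indic.
by exists M => x bx; rewrite indicE memNset// => /AM.
Qed.

Lemma bounded_supp_bound F : bounded_supp F ->
  exists C M : R, [/\ 0 <= C, 0 <= M, forall x, `|F x| <= C & forall x, ~ box M x -> F x = 0].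
Proof.
move=> [[_ lF] [M hM]]; have [C hC] := lF M; exists `|C|, `|M|; split => // x.
  have [bx|bx] := pselect (box M x); last by rewrite hM// normr0.
  by rewrite (le_trans (hC _ bx))// ler_norm.
move=> bx; apply: hM => -[h1 h2]; apply: bx; split; apply: le_trans (ler_norm _) => //.
Qed.

Lemma bounded_supp_integrable F D : bounded_supp F -> measurable (D : set mplane) ->
  mu.-integrable (D : set mplane) (EFin \o F).
Proof.
move=> hF mD; have [C [M [C0 M0 hC hM]]] := bounded_supp_bound hF.
apply: (@integrableS _ _ _ _ setT) => //.
have mF : measurable_fun setT (F : mplane -> R) by case: hF => -[].
apply: (eq_integrable measurableT (EFin \o (F \_ (box M : set mplane) : mplane -> R))).
  by move=> x _ /=; rewrite patchE; case: ifPn => // /negP bx; rewrite hM// => /mem_set.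
rewrite -restrict_EFin; apply/(integrable_mkcond _ (box_measurable M)).
apply: measurable_bounded_integrable; first exact: box_measurable.
- exact: box_finite.
- exact: measurable_funTS.
by exists C; split; [exact: num_real|move=> c Cc x _; exact: le_trans (hC x) (ltW Cc)].
Qed.

Lemma integral_planeD F G : bounded_supp F -> bounded_supp G ->
  \int[mu]_x (F x + G x) = \int[mu]_x F x + \int[mu]_x G x.
Proof. by move=> *; rewrite RintegralD//; exact: bounded_supp_integrable. Qed.

Lemma integral_planeZ c F : bounded_supp F ->
  \int[mu]_x (c * F x) = c * \int[mu]_x F x.
Proof. by move=> *; rewrite RintegralZl//; exact: bounded_supp_integrable. Qed.

Lemma integral_planeN F : bounded_supp F ->
  \int[mu]_x (- F x) = - \int[mu]_x F x.
Proof.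
move=> hF; rewrite -mulN1r -integral_planeZ//.
by apply: eq_Rintegral => x _; rewrite mulN1r.
Qed.

Lemma integral_plane0 : \int[mu]_x (0 : R) = 0.
Proof. by rewrite Rintegral_cst// mul0r. Qed.

Lemma integral_plane_sum (I : Type) (s : seq I) (F : I -> plane -> R) :
  (forall i, bounded_supp (F i)) ->
  \int[mu]_x (\sum_(i <- s) F i x) = \sum_(i <- s) \int[mu]_x F i x.
Proof.
move=> hF; elim: s => [|i s ih].
  by rewrite big_nil -[RHS]integral_plane0; apply: eq_Rintegral => x _; rewrite big_nil.
rewrite big_cons -ih -integral_planeD//; last exact: bounded_supp_sum.
by apply: eq_Rintegral => x _; rewrite big_cons.
Qed.

Lemma integral_plane_ge0 F : (forall x, 0 <= F x) -> 0 <= \int[mu]_x F x.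
Proof. by move=> F0; apply: Rintegral_ge0. Qed.

Lemma Rintegral_ae_eq (D N : set mplane) (F G : plane -> R) : measurable D ->
  measurable N -> mu N = 0%E -> measurable_fun D (F : mplane -> R) ->
  measurable_fun D (G : mplane -> R) ->
  (forall x, D x -> ~ N x -> F x = G x) ->
  \int[mu]_(x in D) F x = \int[mu]_(x in D) G x.
Proof.
move=> mD mN N0 mF mG FG; congr fine; apply: ae_eq_integral => //.
- exact/measurable_EFinP.
- exact/measurable_EFinP.
exists N; split => // x /= /not_implyP[Dx FGx].
by apply: contrapT => Nx; apply: FGx; rewrite FG.
Qed.

Lemma Rintegral_dominated (D N : set mplane) (F_ : nat -> plane -> R) (F G : plane -> R) :
  measurable D -> measurable N -> mu N = 0%E ->
  (forall n, measurable_fun D (F_ n : mplane -> R)) ->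
  measurable_fun D (F : mplane -> R) ->
  mu.-integrable D (EFin \o G) ->
  (forall n x, D x -> `|F_ n x| <= G x) ->
  (forall x, D x -> ~ N x -> F_ n x @[n --> \oo] --> F x) ->
  \int[mu]_(x in D) F_ n x @[n --> \oo] --> \int[mu]_(x in D) F x.
Proof.
move=> mD mN N0 mF_ mF iG FG cF.
have [| |iF _ h] := @dominated_convergence _ _ _ mu D mD (fun n => EFin \o F_ n)
  (EFin \o F) (EFin \o G) (fun n => (measurable_EFinP _ _).2 (mF_ n))
  ((measurable_EFinP _ _).2 mF) _ iG _; last first.
- by apply: fine_cvg; rewrite fineK; [exact: h|exact: integrable_fin_num].
- by apply: aeW => x n Dx; rewrite /= lee_fin FG.
- exists N; split => // x /= /not_implyP[Dx h].
  apply: contrapT => Nx; apply: h; apply/fine_cvgP; split; first exact: nearW.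
  exact: cF.
Qed.

Lemma integral_plane_scales phi k (F : plane -> R) : scales_measure phi k ->
  bounded_supp F -> \int[mu]_x F (phi x) = k * \int[mu]_x F x.
Proof.
by move=> hs hF; have [_ ->] := scales_integral hs (bounded_supp_integrable hF measurableT).
Qed.

Lemma translation_scales (a : plane) : scales_measure (fun p => (a + p : plane)) 1.
Proof.
have := @scales_measure_linear R a e1 e2; rewrite /= mulr0 subr0 mulr1 oner_neq0 => /(_ isT).
apply: scales_measure_eq; last by rewrite normr1 invr1.
by case: a => a1 a2 [p1 p2] /=; congr pair; rewrite /= ?mulr0 ?mulr1 ?addr0.
Qed.

Lemma bounded_supp_translate (a : plane) F : bounded_supp F ->
  bounded_supp (fun x => F (a + x)).
Proof.
move=> hF; have [C [M [C0 M0 hC hM]]] := bounded_supp_bound hF.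
have [[mF _] _] := hF.
split; first split.
- by apply: (measurableT_comp mF); have [] := translation_scales a.
- by exists C => x _.
exists (M + Num.max `|a.1| `|a.2|) => x bx; apply: hM => -[h1 h2]; apply: bx; split.
  rewrite (_ : x.1 = (a + x).1 - a.1); last by rewrite /=; ring.
  by rewrite (le_trans (ler_normB _ _))// lerD// le_max lexx.
rewrite (_ : x.2 = (a + x).2 - a.2); last by rewrite /=; ring.
by rewrite (le_trans (ler_normB _ _))// lerD// le_max lexx orbT.
Qed.

(* Translation invariance kills the integral of every difference quotient; the
   Lipschitz bound lets the derivative inherit this by dominated convergence,
   even if it only exists almost everywhere. *)
Lemma integral_derivative0 (e : plane) (psi G : plane -> R) (C : R) (N : set mplane) :
  bounded_supp psi -> bounded_supp G -> measurable N -> mu N = 0%E ->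
  (forall h x, 0 < h <= 1 -> `|psi (h *: e + x) - psi x| <= C * h) ->
  (forall x, ~ N x ->
     (harmonic n)^-1 * (psi (harmonic n *: e + x) - psi x) @[n --> \oo] --> G x) ->
  \int[mu]_x G x = 0.
Proof.
move=> hpsi hG mN N0 lip cG.
pose h n : R := harmonic n.
have h0 n : 0 < h n <= 1.
  by rewrite /h /harmonic /= invr_gt0 ltr0n /= invf_le1// ler1n.
pose F_ n x := (h n)^-1 * (psi (h n *: e + x) - psi x).
have bF n : bounded_supp (F_ n).
  apply: bounded_suppMl; first exact: loc_bounded_cst.
  by apply: bounded_suppD; [exact: bounded_supp_translate|exact: bounded_suppN].
have F0 n : \int[mu]_x F_ n x = 0.
  rewrite integral_planeZ; last first.
    by apply: bounded_suppD; [exact: bounded_supp_translate|exact: bounded_suppN].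
  rewrite integral_planeD; [|exact: bounded_supp_translate|exact: bounded_suppN].
  rewrite integral_planeN// (integral_plane_scales (translation_scales _))//.
  by rewrite mul1r subrr mulr0.
have [_ [M [_ M0 _ hM]]] := bounded_supp_bound hpsi.
(* All step lengths are at most [1], so every difference quotient vanishes outside this enlarged
   box, and [C] times its indicator dominates them. *)
pose M' := M + Num.max `|e.1| `|e.2|.
have lim : \int[mu]_x F_ n x @[n --> \oo] --> \int[mu]_x G x.
  apply: (@Rintegral_dominated _ N _ _ (fun x => C * \1_(box M') x)) => //.
  - by move=> n; case: (bF n) => -[].
  - by case: hG => -[].
  - apply: bounded_supp_integrable => //; apply: bounded_suppMl; first exact: loc_bounded_cst.
    apply: (@bounded_supp_indic _ M'); [exact: box_measurable|by []].
  - move=> n x _; have /andP[hn0 hn1] := h0 n.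
    have [bx|bx] := pselect (box M' x).
      rewrite indicE mem_set// mulr1 /F_ normrM gtr0_norm ?invr_gt0//.
      by rewrite mulrC ler_pdivrMr// lip// hn0.
    rewrite indicE memNset// mulr0 /F_ !hM ?subrr ?mulr0 ?normr0//.
      move=> [h1 h2]; apply: bx; split; rewrite (le_trans (_ : _ <= M))// lerDl.
        by rewrite le_max normr_ge0.
      by rewrite le_max normr_ge0.
    move=> [h1 h2]; apply: bx; split.
      rewrite (_ : x.1 = (h n *: e + x).1 - h n * e.1);
        last by rewrite -[(h n *: e + x).1]/(h n * e.1 + x.1) addrAC subrr add0r.
      rewrite (le_trans (ler_normB _ _))// lerD// le_max normrM gtr0_norm//.
      by rewrite ler_piMl.
    rewrite (_ : x.2 = (h n *: e + x).2 - h n * e.2);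
        last by rewrite -[(h n *: e + x).2]/(h n * e.2 + x.2) addrAC subrr add0r.
    rewrite (le_trans (ler_normB _ _))// lerD// le_max normrM gtr0_norm//.
    by rewrite ler_piMl// orbT.
  by move=> x _; exact: cG.
have : (fun n => \int[mu]_x F_ n x) = fun=> 0 by apply/funext.
by move=> hE; move: lim; rewrite hE => /cvg_lim <-//; rewrite lim_cst.
Qed.

End BoundedSupport.

(** * Smooth functions *)

Section SmoothFunctions.
Context {R : realType}.
Local Notation plane := (R * R)%type.
Local Notation mplane := (measurableTypeR R * measurableTypeR R)%type.
Local Notation mu := (@lebesgue2 R).

(* The family [P (1 / t) exp (- 1 / t)], [t > 0], extended by [0], is stable
   under differentiation. *)
Definition flat (P : {poly R}) (t : R) : R :=
  if 0 < t then P.[t^-1] * expR (- t^-1) else 0.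

Lemma flat_le0 P t : t <= 0 -> flat P t = 0.
Proof. by rewrite /flat ltNge => ->. Qed.

(** With [u = 1 / t], the exponential series gives [u ^ (i + 2) / (i + 2)! <= exp u], hence
    [u ^ i * exp (- u) <= (i + 2)! * t ^ 2]. The square is what makes the difference quotient at [0]
    vanish. *)
Lemma flat_bound P : exists2 C : R, 0 <= C & forall t : R, 0 < t <= 1 -> `|flat P t| <= C * t ^+ 2.
Proof.
exists (\sum_(i < size P) `|P`_i| * (i.+2)`!%:R).
  by apply: sumr_ge0 => i _; rewrite mulr_ge0.
move=> t /andP[t0 t1]; rewrite /flat t0 horner_coef mulr_suml.
apply: le_trans (ler_norm_sum _ _ _) _; rewrite mulr_suml; apply: ler_sum => i _.
rewrite -mulrA normrM -mulrA ler_wpM2l// ger0_norm; last first.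
  by rewrite mulr_ge0 ?expR_ge0// exprn_ge0// invr_ge0 ltW.
have u0 : 0 <= t^-1 by rewrite invr_ge0 ltW.
have := expR_ge1Dxn i.+1 u0; rewrite expRN ler_pdivrMr ?expR_gt0// => h.
have {h} : t^-1 ^+ i.+2 / (i.+2)`!%:R <= expR t^-1 by apply: le_trans h; rewrite lerDr.
rewrite ler_pdivrMr ?ltr0n ?fact_gt0// => h.
rewrite -mulrA -ler_pdivrMl; last by rewrite ltr0n fact_gt0.
rewrite mulrC ler_pdivrMr ?ltr0n ?fact_gt0//.
rewrite -mulrA -ler_pdivrMl ?exprn_gt0//; apply: le_trans h.
by rewrite -exprVn -exprD add2n.
Qed.

Lemma cvg_is_derive (V : normedModType R) (phi : V -> R) (x e : V) (d : R) :
  h^-1 *: (phi (h *: e + x) - phi x) @[h --> 0^'] --> d -> is_derive x e phi d.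
Proof.
by move=> h; apply: DeriveDef; [apply/cvg_ex; exists d|exact: cvg_lim h].
Qed.

Lemma is_derive_cvg (V : normedModType R) (phi : V -> R) (x e : V) (d : R) :
  is_derive x e phi d -> h^-1 *: (phi (h *: e + x) - phi x) @[h --> 0^'] --> d.
Proof. by move=> [/cvgP h <-]; apply: h. Qed.

(** Since [u = 1 / t] has derivative [- u ^ 2], differentiating [P(u) * exp (- u)] gives
    [u ^ 2 * (P - P')(u) * exp (- u)]. At [0] the quadratic bound applies. *)
Lemma is_derive_flat P (t : R) : is_derive t 1 (flat P) (flat ('X^2 * (P - P^`())) t).
Proof.
have [t0|t0|->] := ltgtP t 0.
- rewrite flat_le0 ?ltW//; apply: (@near_eq_is_derive _ _ _ (cst 0)).
  near=> x; rewrite flat_le0//; apply/ltW; near: x; exact: lt_nbhsl.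
- rewrite [X in is_derive _ _ _ X]/flat t0.
  apply: (@near_eq_is_derive R R R (fun x => P.[x^-1] * expR (- x^-1))).
    near=> x; rewrite /flat ifT//; near: x; exact: lt_nbhsr.
  have dV : is_derive t 1 (fun x : R => x^-1) (- t ^- 2).
    apply: is_derive_eq (is_deriveV (f := id) _ (is_derive_id t 1)) _.
      by rewrite /= gt_eqF.
    exact: mulr1.
  have d1 := is_derive1_comp (is_derive_poly P t^-1) dV.
  have dNV : is_derive t 1 (fun x : R => - x^-1) (- - t ^- 2) by exact: is_deriveN dV.
  have d2 := @is_derive1_comp R expR (fun x => - x^-1) t _ _ (is_derive_expR (- t^-1)) dNV.
  apply: is_derive_eq (is_deriveM d1 d2) _.
  rewrite -[LHS]/(P.[t^-1] * (expR (- t^-1) * - - t ^- 2) +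
    expR (- t^-1) * (P^`().[t^-1] * - t ^- 2)).
  by rewrite hornerM hornerXn hornerD hornerN -exprVn; ring.
- rewrite flat_le0//; have [C C0 hC] := flat_bound P.
  apply: cvg_is_derive; apply/cvgrPdist_le => /= e e0; near=> h.
  rewrite /GRing.scale /= mulr1 addr0 (flat_le0 _ (lexx 0)) subr0 sub0r normrN.
  have h0 : h != 0 by near: h; exact: nbhs_dnbhs_neq.
  have [hn|hp] := leP h 0; first by rewrite flat_le0// mulr0 normr0 ltW.
  have h1 : h <= 1.
    rewrite (le_trans (ler_norm _))//; near: h; apply: dnbhs0_le; exact: ltr01.
  rewrite [leLHS](_ : _ = `|flat P h| / h) ?ler_pdivrMr//; last first.
    by rewrite normrM normfV (gtr0_norm hp) mulrC.
  apply: le_trans (hC _ _) _; first by rewrite hp.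
  rewrite expr2 mulrA ler_pM2r//.
  have : `|h| <= e / (C + 1).
    by near: h; apply: dnbhs0_le; rewrite divr_gt0// ltr_wpDl.
  rewrite gtr0_norm// ler_pdivlMr ?ltr_wpDl// => ?.
  by rewrite (le_trans _ (_ : h * (C + 1) <= e))// mulrC ler_wpM2l ?ltW// ltrDl.
Unshelve. all: by end_near. Qed.

Lemma continuous_flat P : continuous (flat P).
Proof.
move=> t; apply: differentiable_continuous; apply/derivable1_diffP.
exact: (@ex_derive _ _ _ _ _ _ _ (is_derive_flat P t)).
Qed.

Definition affine (a b c : R) (x : plane) : R := a * x.1 + b * x.2 + c.

Lemma is_derive_affine_comp (a b c : R) (g : R -> R) (g' : R) (x e : plane) :
  is_derive (affine a b c x) 1 g g' ->
  is_derive x e (g \o affine a b c) ((a * e.1 + b * e.2) * g').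
Proof.
move=> hg; set k := a * e.1 + b * e.2.
have /derivable1_diffP dg : derivable g (affine a b c x) 1 by exact: ex_derive.
have hk : is_derive (affine a b c x) k g (k * g').
  apply: DeriveDef; first exact: diff_derivable.
  rewrite deriveE// -[k in 'd g _ k]mulr1 linearZ /= -deriveE//.
  by rewrite derive_val.
apply: cvg_is_derive; have := is_derive_cvg hk.
suff -> : (fun h => h^-1 *: (g (h *: k + affine a b c x) - g (affine a b c x))) =
  (fun h => h^-1 *: ((g \o affine a b c) (h *: e + x) - (g \o affine a b c) x)) by [].
apply/funext => h /=; congr (_ *: (g _ - _)).
by rewrite /affine /k /GRing.scale /= /GRing.scale /=; ring.
Qed.

Lemma is_derive_affine (a b c : R) (x e : plane) :
  is_derive x e (affine a b c) (a * e.1 + b * e.2).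
Proof.
have := @is_derive_affine_comp a b c id 1 x e (is_derive_id _ _).
by rewrite mulr1.
Qed.

Lemma derive_funext (phi dphi : plane -> R) (e : plane) :
  (forall x, is_derive x e phi (dphi x)) -> (fun x => 'D_e phi x) = dphi.
Proof. by move=> h; apply/funext => x; apply: derive_val. Qed.

Lemma derive2_val (phi dphi : plane -> R) (e e' x : plane) d :
  (forall y, is_derive y e' phi (dphi y)) -> is_derive x e dphi d ->
  'D_e (fun y => 'D_e' phi y) x = d.
Proof. by move=> h1 h2; rewrite (derive_funext h1) derive_val. Qed.

Lemma Ck_intro k (phi : plane -> R) (dphi : plane -> plane -> R) : continuous phi ->
  (forall e x, is_derive x e phi (dphi e x)) ->
  (forall e, Ck k (dphi e)) -> Ck k.+1 phi.
Proof.
move=> cphi hd hC; split => // e _; split=> [x|]; first exact: ex_derive.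
by rewrite (derive_funext (hd e)).
Qed.

Lemma Ck_derive k (phi : plane -> R) e : e = e1 \/ e = e2 -> Ck k.+1 phi ->
  Ck k (fun x => 'D_e phi x).
Proof. by move=> he [_ /(_ e he)[]]. Qed.

Lemma Ck_is_derive k (phi : plane -> R) e x : e = e1 \/ e = e2 -> Ck k.+1 phi ->
  is_derive x e phi ('D_e phi x).
Proof. by move=> he [_ /(_ e he)[h _]]; exact/derivableP. Qed.

Lemma Ck_cont k (phi : plane -> R) : Ck k phi -> continuous phi.
Proof. by case: k => [|k] []. Qed.

Lemma CkS k (phi : plane -> R) : Ck k.+1 phi -> Ck k phi.
Proof.
elim: k phi => [|k ih] phi [cphi h]; first by split.
by split => // e he; have [d hk] := h e he; split => //; exact: ih.
Qed.

Lemma Ck_cst k c : Ck k (fun _ : plane => c).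
Proof.
elim: k c => [|k ih] c; first by split => // x; exact: cvg_cst.
by apply: (@Ck_intro k _ (fun _ _ => 0)) => // x; exact: cvg_cst.
Qed.

Lemma Ck_affine k a b c : Ck k (affine a b c).
Proof.
case: k => [|k]; first by split => //; exact: continuous_affine.
apply: (@Ck_intro k _ (fun e _ => a * e.1 + b * e.2)).
- exact: continuous_affine.
- by move=> e x; exact: is_derive_affine.
- by move=> e; exact: Ck_cst.
Qed.

Lemma CkD k (phi psi : plane -> R) : Ck k phi -> Ck k psi ->
  Ck k (fun x => phi x + psi x).
Proof.
elim: k phi psi => [|k ih] phi psi hphi hpsi.
  by split => // x; apply: cvgD; [exact: (Ck_cont hphi)|exact: (Ck_cont hpsi)].
split => [x|e he]; first by apply: cvgD; [exact: (Ck_cont hphi)|exact: (Ck_cont hpsi)].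
have d x : is_derive x e (fun x => phi x + psi x) ('D_e phi x + 'D_e psi x).
  by apply: is_deriveD; apply: Ck_is_derive; eassumption.
split=> [x|]; first exact: ex_derive.
by rewrite (derive_funext d); apply: ih; exact: Ck_derive.
Qed.

Lemma is_derive_mul (W : normedModType R) (phi psi : W -> R) x e (a b : R) : is_derive x e phi a ->
  is_derive x e psi b -> is_derive x e (fun x => phi x * psi x) (a * psi x + phi x * b).
Proof.
move=> ha hb; apply: is_derive_eq (is_deriveM ha hb) _.
by rewrite /GRing.scale /= addrC (mulrC a).
Qed.

Lemma CkM k (phi psi : plane -> R) : Ck k phi -> Ck k psi ->
  Ck k (fun x => phi x * psi x).
Proof.
elim: k phi psi => [|k ih] phi psi hphi hpsi.
  by split => // x; apply: cvgM; [exact: (Ck_cont hphi)|exact: (Ck_cont hpsi)].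
split => [x|e he]; first by apply: cvgM; [exact: (Ck_cont hphi)|exact: (Ck_cont hpsi)].
have d x : is_derive x e (fun x => phi x * psi x) ('D_e phi x * psi x + phi x * 'D_e psi x).
  by apply: is_derive_mul; apply: Ck_is_derive; eassumption.
split=> [x|]; first exact: ex_derive.
rewrite (derive_funext d); apply: CkD; apply: ih;
  by [exact: Ck_derive|exact: CkS].
Qed.

Lemma Ck_flat k P a b c : Ck k (flat P \o affine a b c).
Proof.
have cf Q : continuous (flat Q \o affine a b c).
  by move=> x; apply: continuous_comp; [exact: continuous_affine|exact: continuous_flat].
elim: k P => [|k ih] P; first by split.
apply: (@Ck_intro k _ (fun e x => (a * e.1 + b * e.2) *
   (flat ('X^2 * (P - P^`())) \o affine a b c) x)) => //.
- by move=> e x; apply: is_derive_affine_comp; exact: is_derive_flat.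
- by move=> e; apply: CkM; [exact: Ck_cst|exact: ih].
Qed.

(* Restricting to functions whose mixed partial derivatives commute spares us
   Schwarz' theorem. *)
Definition smooth (phi : plane -> R) := (forall k, Ck k phi) /\
  forall u v x, u = e1 \/ u = e2 -> v = e1 \/ v = e2 ->
    'D_u (fun y => 'D_v phi y) x = 'D_v (fun y => 'D_u phi y) x.

(** Each differentiation contributes a scalar factor depending only on its direction, so the order
    is immaterial. *)
Lemma smooth_flat P a b c : smooth (flat P \o affine a b c).
Proof.
split=> [k|u v x _ _]; first exact: Ck_flat.
have d Q e y : is_derive y e (flat Q \o affine a b c) ((a * e.1 + b * e.2) *
   (flat ('X^2 * (Q - Q^`())) \o affine a b c) y).
  by apply: is_derive_affine_comp; exact: is_derive_flat.
pose Q : {poly R} := 'X^2 * (P - P^`()).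
have d2 k e y : is_derive y e (fun y => k * (flat Q \o affine a b c) y)
   (k * ((a * e.1 + b * e.2) *
   (flat ('X^2 * (Q - Q^`())) \o affine a b c) y)).
  apply: is_derive_eq (is_derive_mul (is_derive_cst k y e) (d Q e y)) _.
  by rewrite mul0r add0r.
have E e e' : 'D_e (fun y => 'D_e' (flat P \o affine a b c) y) x =
    (a * e'.1 + b * e'.2) * ((a * e.1 + b * e.2) *
      (flat ('X^2 * (Q - Q^`())) \o affine a b c) x).
  exact: derive2_val (d P e') (d2 _ e x).
by apply: etrans (E _ _) (etrans _ (esym (E _ _))); rewrite mulrCA.
Qed.

Lemma smoothM (phi psi : plane -> R) : smooth phi -> smooth psi ->
  smooth (fun x => phi x * psi x).
Proof.
move=> [hphi sphi] [hpsi spsi]; split => [k|u v x hu hv]; first exact: CkM.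
have d e y : e = e1 \/ e = e2 -> is_derive y e (fun x => phi x * psi x)
    ('D_e phi y * psi y + phi y * 'D_e psi y).
  by move=> he; apply: is_derive_mul; apply: (@Ck_is_derive 0).
have d2 e e' : e = e1 \/ e = e2 -> e' = e1 \/ e' = e2 -> is_derive x e'
    (fun y => 'D_e phi y * psi y + phi y * 'D_e psi y)
    (('D_e' (fun y => 'D_e phi y) x * psi x + 'D_e phi x * 'D_e' psi x) +
     ('D_e' phi x * 'D_e psi x + phi x * 'D_e' (fun y => 'D_e psi y) x)).
  move=> he he'; apply: is_deriveD; apply: is_derive_mul;
    apply: (@Ck_is_derive 0) => //; by [exact: hphi|exact: hpsi|apply: Ck_derive].
have E e e' (he : e = e1 \/ e = e2) (he' : e' = e1 \/ e' = e2) :=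
  derive2_val (fun y => d e y he) (d2 e e' he he').
have alg (A A' B B' p q y z : R) : A = A' -> B = B' ->
    A * y + p + (q + z * B) = A' * y + q + (p + z * B').
  by move=> -> ->; rewrite addrACA.
exact: etrans (E v u hv hu) (etrans (alg _ _ _ _ _ _ _ _ (sphi _ _ _ hu hv)
  (spsi _ _ _ hu hv)) (esym (E u v hu hv))).
Qed.

End SmoothFunctions.

(** * Triangles and barycentric coordinates *)

Section Triangle.
Context {R : realType}.
Local Notation plane := (R * R)%type.

Definition i0 : 'I_3 := @Ordinal 3 0 isT.
Definition i1 : 'I_3 := @Ordinal 3 1 isT.
Definition i2 : 'I_3 := @Ordinal 3 2 isT.
(* The edge of index [i] is opposite to the vertex of index [i], and joins the
   vertices [nx i] and [nx (nx i)]. *)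
Definition nx (i : 'I_3) : 'I_3 :=
  match val i with 0%N => i1 | 1%N => i2 | _ => i0 end.

Lemma I3_ind (P : 'I_3 -> Prop) : P i0 -> P i1 -> P i2 -> forall i, P i.
Proof.
move=> p0 p1 p2 [[|[|[|//]]] h].
- by rewrite (_ : Ordinal h = i0)//; apply: val_inj.
- by rewrite (_ : Ordinal h = i1)//; apply: val_inj.
- by rewrite (_ : Ordinal h = i2)//; apply: val_inj.
Qed.

Lemma sum3 (V : zmodType) (F : 'I_3 -> V) : \sum_i F i = F i0 + F i1 + F i2.
Proof.
rewrite !big_ord_recl big_ord0 addr0 addrA.
by congr (F _ + F _ + F _); apply: val_inj.
Qed.

Implicit Types (V W : 'I_3 -> plane) (x y : plane).

Definition det3 V : R :=
  ((V i1).1 - (V i0).1) * ((V i2).2 - (V i0).2) - ((V i1).2 - (V i0).2) * ((V i2).1 - (V i0).1).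

(** The gradient of the barycentric coordinate of vertex [i]: the opposite edge turned by a right
    angle, over twice the signed area. *)
Definition gradlam V i : plane :=
  (((V (nx i)).2 - (V (nx (nx i))).2) / det3 V, ((V (nx (nx i))).1 - (V (nx i)).1) / det3 V).

(** The barycentric coordinate of vertex [i] on the whole plane. Being an explicit affine function,
    it leaves its identities to [field], and triangles, edges and sides of an edge are all expressed
    by its sign. *)
Definition lam V i : plane -> R := affine (gradlam V i).1 (gradlam V i).2
  (((V (nx i)).1 * (V (nx (nx i))).2 - (V (nx i)).2 * (V (nx (nx i))).1) / det3 V).

Definition tri V : set plane := conv3 (V i0) (V i1) (V i2).

Definition comb V (r : 'I_3 -> R) : plane := r i0 *: V i0 + r i1 *: V i1 + r i2 *: V i2.

Lemma lam_sum V x : det3 V != 0 -> lam V i0 x + lam V i1 x + lam V i2 x = 1.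
Proof. by rewrite /lam /affine /gradlam /= /det3 => D0; field. Qed.

Lemma comb_lam V x : det3 V != 0 -> x = comb V (lam V ^~ x).
Proof.
rewrite /lam /affine /gradlam /= /det3 /comb => D0.
by case: x => x y; congr pair; rewrite /= /GRing.scale /=; field.
Qed.

Lemma lam_comb V (r : 'I_3 -> R) i : det3 V != 0 -> r i0 + r i1 + r i2 = 1 ->
  lam V i (comb V r) = r i.
Proof.
rewrite /lam /affine /gradlam /= /det3 /comb => D0 r1.
move: r1; move: i; apply: I3_ind; rewrite /= /GRing.scale /=;
  move: (r i0) (r i1) (r i2) => a b c abc;
  have -> : a = 1 - b - c by rewrite -abc; ring.
- by field.
- by field.
- by field.
Qed.

Lemma lamD V i x y t : lam V i (x + t *: (y - x)) = lam V i x + t * (lam V i y - lam V i x).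
Proof. by rewrite /lam /affine /= /GRing.scale /=; ring. Qed.

Lemma lam_continuous V i : continuous (lam V i).
Proof. exact: continuous_affine. Qed.

Lemma lam_vertex V i j : det3 V != 0 -> lam V i (V j) = (i == j)%:R.
Proof.
move=> D0; have -> : V j = comb V (fun k => (k == j)%:R).
  by rewrite /comb; move: j; apply: I3_ind; rewrite /= !scale0r scale1r ?addr0 ?add0r.
by rewrite lam_comb//; move: j; apply: I3_ind; rewrite /= ?addr0 ?add0r.
Qed.

Lemma triP V x : det3 V != 0 -> tri V x <-> forall i, 0 <= lam V i x.
Proof.
move=> D0; split=> [[r [s [t [r0 s0 t0 rst ->]]]]|h].
  pose q (i : 'I_3) := match val i with 0%N => r | 1%N => s | _ => t end.
  have -> : r *: V i0 + s *: V i1 + t *: V i2 = comb V q by [].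
  by move=> i; rewrite lam_comb//; move: i; apply: I3_ind.
exists (lam V i0 x), (lam V i1 x), (lam V i2 x); split => //; first exact: lam_sum.
exact: comb_lam.
Qed.

Lemma nbhs_line (A : set plane) x v : nbhs x A -> \forall t \near (0 : R), A (x + t *: v).
Proof.
move=> xA.
have : (x + t *: v) @[t --> (0 : R)] --> x + 0 *: v.
  by apply: cvgD; [exact: cvg_cst|apply: cvgZr_tmp; exact: cvg_id].
by rewrite scale0r addr0; apply.
Qed.

(** Where the coordinate of a vertex vanishes, an arbitrarily short move away from that vertex makes
    it negative; conversely, strict positivity is an open condition. *)
Lemma interior_tri V : det3 V != 0 -> (tri V)° = [set x | forall i, 0 < lam V i x].
Proof.
move=> D0; apply/seteqP; split => [x xT i|x h].
  have /triP : tri V x by exact: interior_subset.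
  move=> /(_ D0)/(_ i); rewrite le_eqVlt => /orP[/eqP l0|//].
  have := nbhs_line (x - V i) xT.
  move=> /nbhs_ballP[e /= e0 /(_ (e / 2))].
  have e20 : 0 < e / 2 by rewrite divr_gt0.
  rewrite /ball /= sub0r normrN gtr0_norm// ltr_pdivrMr// ltr_pMr// ltr1n => /(_ isT).
  move=> /(triP _ D0)/(_ i).
  rewrite (_ : x + _ = x + (- (e / 2)) *: (V i - x)); last by rewrite scaleNr -scalerN opprB.
  rewrite lamD -l0 lam_vertex// eqxx subr0 mulr1 add0r oppr_ge0 leNgt e20.
  by [].
have : open [set x | forall i, 0 < lam V i x].
  have -> : [set x | forall i, 0 < lam V i x] =
    (lam V i0 @^-1` [set t | 0 < t]) `&` (lam V i1 @^-1` [set t | 0 < t]) `&`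
    (lam V i2 @^-1` [set t | 0 < t]).
    apply/seteqP; split => [y hy|y [[? ?] ?]]; first by do !split; exact: hy.
    exact: I3_ind.
  by apply: openI; [apply: openI|]; apply: open_comp => [y _|]; by [exact: lam_continuous|exact: open_gt].
move=> oh; apply: (@interiorS _ [set x | forall i, 0 < lam V i x]); last first.
  by move/interior_id : oh => ->.
by move=> y hy; apply/triP => // i; exact/ltW.
Qed.

End Triangle.

Lemma nbhs_forall (T : topologicalType) (x : T) (I : finType) (f : I -> set T) :
  (forall i, nbhs x (f i)) -> nbhs x [set y | forall i, f i y].
Proof. exact: filter_forall. Qed.

Lemma nbhsI (T : topologicalType) (x : T) (A B : set T) :
  nbhs x A -> nbhs x B -> nbhs x (A `&` B).
Proof. exact: filterI. Qed.

(** * Vertices and edges of a triangle, and triangles with a common edge *)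

Section Adjacency.
Context {R : realType}.
Local Notation plane := (R * R)%type.
Implicit Types (V W : 'I_3 -> plane) (x y : plane).

Definition vfun (a b c : plane) (i : 'I_3) : plane :=
  match val i with 0%N => a | 1%N => b | _ => c end.

Lemma triangle_with_vfun (T : set plane) a b c : triangle_with T a b c ->
  det3 (vfun a b c) != 0 /\ T = tri (vfun a b c).
Proof. by move=> [nc ->]. Qed.

Lemma triangle_with_swap (T : set plane) a b c : triangle_with T a b c -> triangle_with T b a c.
Proof.
move=> [nc ->]; split.
  by move: nc; rewrite /noncollinear; apply: contra_neq => nc; rewrite -[RHS]oppr0 -nc; ring.
by apply/seteqP; split => x [r [s [t [r0 s0 t0 rst ->]]]]; exists s, r, t;
  split => //; rewrite ?(addrC s)// (addrC (s *: _)).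
Qed.

Lemma triangle_with_rot (T : set plane) a b c : triangle_with T a b c -> triangle_with T b c a.
Proof.
move=> [nc ->]; split.
  by move: nc; rewrite /noncollinear; apply: contra_neq => nc; rewrite -nc; ring.
apply/seteqP; split => x [r [s [t [r0 s0 t0 rst ->]]]].
  exists s, t, r; split => //; first by lra.
  by rewrite -addrA addrC.
exists t, r, s; split => //; first by lra.
by rewrite addrC addrA.
Qed.

Lemma is_triangle_vfun (T : set plane) : is_triangle T ->
  exists V, det3 V != 0 /\ T = tri V.
Proof. by move=> [a [b [c /triangle_with_vfun h]]]; exists (vfun a b c). Qed.

Lemma triangle_with_tri V : det3 V != 0 -> triangle_with (tri V) (V i0) (V i1) (V i2).
Proof. by []. Qed.

Lemma affine_comb (a b c : R) V (r : 'I_3 -> R) : r i0 + r i1 + r i2 = 1 ->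
  affine a b c (comb V r) =
  r i0 * affine a b c (V i0) + r i1 * affine a b c (V i1) + r i2 * affine a b c (V i2).
Proof.
move=> r1; have -> : r i0 = 1 - r i1 - r i2 by rewrite -r1; ring.
rewrite /affine /comb /= /GRing.scale /=.
have -> : r i0 = 1 - r i1 - r i2 by rewrite -r1; ring.
ring.
Qed.

Lemma affine_lam (a b c : R) V x : det3 V != 0 ->
  affine a b c x = lam V i0 x * affine a b c (V i0) +
    lam V i1 x * affine a b c (V i1) + lam V i2 x * affine a b c (V i2).
Proof.
by move=> D0; rewrite {1}(comb_lam x D0) affine_comb//; exact: lam_sum.
Qed.

Lemma nx_neq i : nx i != i. Proof. by move: i; exact: I3_ind. Qed.

Lemma nx2_neq i : nx (nx i) != i. Proof. by move: i; exact: I3_ind. Qed.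

Lemma nx_cases (l j : 'I_3) : l != j -> l = nx j \/ l = nx (nx j).
Proof. by move: l j; apply: I3_ind; apply: I3_ind => //; auto. Qed.

Lemma sum3_nx (U : zmodType) (F : 'I_3 -> U) i :
  F i0 + F i1 + F i2 = F i + F (nx i) + F (nx (nx i)).
Proof.
by move: i; apply: I3_ind => //=; [rewrite -addrA addrC|rewrite addrC addrA].
Qed.

Lemma third_index (i k : 'I_3) : exists2 l, l != i & l != k.
Proof.
by move: i k; apply: I3_ind; apply: I3_ind;
  [exists i1|exists i2|exists i1|exists i2|exists i0|exists i0|exists i1|exists i0|exists i0].
Qed.

Lemma tri_vertex V i : det3 V != 0 -> tri V (V i).
Proof. by move=> D0; apply/triP => // j; rewrite lam_vertex//. Qed.

Lemma lam_le1 V i x : det3 V != 0 -> tri V x -> lam V i x <= 1.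
Proof.
move=> D0 /triP -/(_ D0) h; rewrite -(lam_sum x D0).
move: (h i0) (h i1) (h i2) => h0 h1 h2; move: i; apply: I3_ind; lra.
Qed.

(** The point set determines its vertices: the coordinate of [a] in the description [W] is at most
    [1] on the triangle and equals [1] only at [a]. Its value at [a] is an average of its values at
    the vertices of [V], so it equals [1] at one of these. *)
Lemma is_vertex_tri V a : det3 V != 0 -> is_vertex (tri V) a -> exists i, a = V i.
Proof.
move=> D0 [b [c /triangle_with_vfun[DW TW]]]; set W := vfun a b c in DW TW.
have Wa : W i0 = a by [].
have Ta : tri V a by rewrite TW -Wa; exact: tri_vertex.
have le i : lam W i0 (V i) <= 1 by apply: lam_le1 => //; rewrite -TW; exact: tri_vertex.
have e : lam W i0 a = 1 by rewrite -Wa lam_vertex// eqxx.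
have [i ei] : exists i, lam W i0 (V i) = 1.
  apply: contrapT => /forallNP h.
  have lt i : lam W i0 (V i) < 1 by rewrite lt_neqAle le andbT; apply/eqP/h.
  have := triP a D0; move=> /iffLR/(_ Ta) ra.
  have := lam_sum a D0.
  move: e; rewrite {1}/lam (affine_lam _ _ _ a D0) -!/(lam W i0 _).
  move: (ra i0) (ra i1) (ra i2) (lt i0) (lt i1) (lt i2).
  move: (lam V i0 a) (lam V i1 a) (lam V i2 a) (lam W i0 (V i0)) (lam W i0 (V i1)) (lam W i0 (V i2)).
  move=> p q r u v w p0 q0 r0 u1 v1 w1 e s.
  have : p * (1 - u) + q * (1 - v) + r * (1 - w) = 0 by lra.
  move=> z.
  have [P Q S] : [/\ p * (1 - u) = 0, q * (1 - v) = 0 & r * (1 - w) = 0].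
    have := mulr_ge0 p0 (ltW (_ : 0 < 1 - u)); rewrite subr_gt0 => /(_ u1) ?.
    have := mulr_ge0 q0 (ltW (_ : 0 < 1 - v)); rewrite subr_gt0 => /(_ v1) ?.
    have := mulr_ge0 r0 (ltW (_ : 0 < 1 - w)); rewrite subr_gt0 => /(_ w1) ?.
    split; lra.
  move: P Q S => /eqP; rewrite mulf_eq0 subr_eq0 (gt_eqF u1) orbF => /eqP p00.
  move=> /eqP; rewrite mulf_eq0 subr_eq0 (gt_eqF v1) orbF => /eqP q00.
  move=> /eqP; rewrite mulf_eq0 subr_eq0 (gt_eqF w1) orbF => /eqP r00.
  by move: s; rewrite p00 q00 r00; lra.
exists i; have /triP -/(_ DW) hi : tri W (V i) by rewrite -TW; exact: tri_vertex.
have s := lam_sum (V i) DW.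
rewrite (comb_lam (V i) DW) /comb ei scale1r.
have z1 : lam W i1 (V i) = 0 by have := hi i1; have := hi i2; lra.
have z2 : lam W i2 (V i) = 0 by have := hi i1; have := hi i2; lra.
by rewrite z1 z2 !scale0r !addr0.
Qed.

Definition edge_of V i (a b : plane) : Prop :=
  (a = V (nx i) /\ b = V (nx (nx i))) \/ (a = V (nx (nx i)) /\ b = V (nx i)).

Lemma is_edge_tri V a b : det3 V != 0 -> is_edge (tri V) a b -> exists i, edge_of V i a b.
Proof.
move=> D0 [c h].
have [i ai] : exists i, a = V i by apply: is_vertex_tri => //; exists b, c.
have [j bj] : exists j, b = V j.
  by apply: is_vertex_tri => //; exists a, c; exact: triangle_with_swap.
have ij : i != j.
  apply: contraPneq h => ij [+ _]; rewrite /noncollinear ai bj ij => /eqP; apply.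
  by rewrite !subrr; ring.
by move: i j ai bj ij {h}; apply: I3_ind; apply: I3_ind => // -> -> _;
  [exists i2|exists i1|exists i2|exists i0|exists i1|exists i0]; rewrite /edge_of /=; auto.
Qed.

Lemma edge_of_is_edge V i a b : det3 V != 0 -> edge_of V i a b -> is_edge (tri V) a b.
Proof.
move=> D0; have T0 := triangle_with_tri D0.
have T1 := triangle_with_rot T0; have T2 := triangle_with_rot T1.
move: i; apply: I3_ind => -[] [-> ->] /=.
- by exists (V i0).
- by exists (V i0); exact: triangle_with_swap.
- by exists (V i1).
- by exists (V i1); exact: triangle_with_swap.
- by exists (V i2).
- by exists (V i2); exact: triangle_with_swap.
Qed.

Lemma edge_of_lam V i a b l : det3 V != 0 -> edge_of V i a b ->
  lam V l (midpoint a b) = if l == i then 0 else 2^-1.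
Proof.
move=> D0 h; have -> : midpoint a b = comb V (fun k => if k == i then 0 else 2^-1).
  rewrite /comb /midpoint; move: i h; apply: I3_ind => -[] [-> ->] /=;
    rewrite scale0r ?addr0 ?add0r scalerDr //; exact: addrC.
by rewrite lam_comb//; move: i {h}; apply: I3_ind => /=; field.
Qed.

Lemma segment_lam V i a b x : det3 V != 0 -> edge_of V i a b ->
  segment a b x -> lam V i x = 0.
Proof.
move=> D0 h [t [_ ->]].
have -> : (1 - t) *: a + t *: b = a + t *: (b - a).
  by rewrite scalerBl scale1r scalerBr addrA addrAC.
by rewrite lamD; move: i h; apply: I3_ind => -[] [-> ->] /=; rewrite !lam_vertex//=; ring.
Qed.

(* The edge [i] of [V] is the edge [j] of [W]. *)
Definition nbr V i W j := (V (nx i) = W (nx j) /\ V (nx (nx i)) = W (nx (nx j))) \/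
  (V (nx i) = W (nx (nx j)) /\ V (nx (nx i)) = W (nx j)).

Lemma nbr_sym V i W j : nbr V i W j -> nbr W j V i.
Proof. by move=> [[h1 h2]|[h1 h2]]; [left|right]. Qed.

Lemma edge_of_nbr V i W j a b : edge_of V i a b -> edge_of W j a b -> nbr V i W j.
Proof. by move=> [[-> ->]|[-> ->]] [[? ?]|[? ?]]; [left|right|right|left]. Qed.

Lemma nbr_edge_of V i W j a b : nbr V i W j -> edge_of V i a b -> edge_of W j a b.
Proof. by move=> [[h1 h2]|[h1 h2]] [[-> ->]|[-> ->]]; rewrite ?h1 ?h2 /edge_of; auto. Qed.

(** Both coordinates vanish on the line of the common edge, so they are proportional; evaluating at
    [W j] gives the factor. Its sign tells on which side [W] lies, its modulus is the ratio of the
    areas. *)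
Lemma lam_nbr V i W j x : det3 V != 0 -> det3 W != 0 -> nbr V i W j ->
  lam V i x = lam V i (W j) * lam W j x.
Proof.
move=> DV DW h.
have [z1 z2] : lam V i (W (nx j)) = 0 /\ lam V i (W (nx (nx j))) = 0.
  by move: h => [[<- <-]|[<- <-]]; rewrite !lam_vertex//; move: i; apply: I3_ind.
rewrite {1}/lam (affine_lam _ _ _ x DW) -!/(lam V i _).
by move: j z1 z2 {h}; apply: I3_ind => /= -> ->; ring.
Qed.

End Adjacency.

(** The regularity condition for triangles indexed by ordinals, with their vertices chosen and
    ordered, so that integrals over the mesh become finite sums. *)
Definition regular_mesh (R : realType) (N : nat) (V : 'I_N -> 'I_3 -> R * R) :=
  forall m n, m <> n ->
  [\/ tri (V m) `&` tri (V n) = set0,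
      exists a b, [/\ is_edge (tri (V m)) a b, is_edge (tri (V n)) a b
                        & tri (V m) `&` tri (V n) = segment a b]
    | exists a, [/\ is_vertex (tri (V m)) a, is_vertex (tri (V n)) a
                      & tri (V m) `&` tri (V n) = [set a]]].

(** * Incidence in a regular mesh: disjoint interiors, at most two triangles at an edge *)

Section Mesh.
Context {R : realType}.
Local Notation plane := (R * R)%type.
Context {N : nat} (V : 'I_N -> 'I_3 -> plane).
Implicit Types (m n : 'I_N) (i j : 'I_3).
Hypothesis hdet : forall n, det3 (V n) != 0.
Hypothesis hreg : regular_mesh V.

(** In each case of the regularity condition, common points have a vanishing barycentric coordinate
    in [V m]. *)
Lemma mesh_interior_disjoint m n x : (forall i, 0 < lam (V m) i x) -> tri (V n) x -> m = n.
Proof.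
move=> hx Tx; apply: contrapT => mn.
have Tmx : tri (V m) x by apply/triP => // i; exact: ltW.
have mnx : (tri (V m) `&` tri (V n)) x by [].
case: (hreg mn) => [e|[a [b [/is_edge_tri -/(_ (hdet _))[i ei] _ e]]]|
  [a [/is_vertex_tri -/(_ (hdet _))[i ei] _ e]]].
- by rewrite e in mnx.
- by rewrite e in mnx; have := segment_lam (hdet m) ei mnx => /eqP; rewrite (gt_eqF (hx i)).
- rewrite e /= ei in mnx; have := hx (nx i); rewrite mnx lam_vertex//.
  by move: i {ei mnx}; apply: I3_ind; rewrite ltxx.
Qed.

(** Otherwise both triangles would lie on the same side of the common edge, and a point slightly off
    its midpoint would be interior to one and contained in the other. A zero value would make
    [lam (V m) i] vanish identically. *)
Lemma nbr_opposite m n i j : m <> n -> nbr (V m) i (V n) j -> lam (V m) i (V n j) < 0.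
Proof.
move=> mn h; rewrite ltNge; apply/negP; rewrite le_eqVlt => /orP[/eqP s0|s0].
  have := lam_nbr (V m i) (hdet m) (hdet n) h; rewrite -s0 mul0r lam_vertex// eqxx.
  by move/eqP; rewrite oner_eq0.
pose a := V m (nx i); pose b := V m (nx (nx i)).
have ea : edge_of (V m) i a b by left.
have eb : edge_of (V n) j a b by exact: nbr_edge_of ea.
have : \forall t \near (0 : R), forall l, l != j -> 0 < lam (V n) l (midpoint a b + t *: (V m i - midpoint a b)).
  apply: (nbhs_line (A := [set x | forall l, l != j -> 0 < lam (V n) l x])).
  apply: (nbhs_forall (f := fun l => [set x | l != j -> 0 < lam (V n) l x])) => l.
  have [->|lj] := eqVneq l j; first by apply: filterE => x /eqP[].
  have : nbhs (midpoint a b) (lam (V n) l @^-1` [set t | 0 < t]).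
    apply: lam_continuous; apply: open_nbhs_nbhs; split; first exact: open_gt.
    by rewrite /= (edge_of_lam l (hdet n) eb) (negPf lj) invr_gt0.
  by apply: filterS => x /= ? _.
move=> /nbhs_ballP[e /= e0 he].
(* [e / 2] stays where the other coordinates of [V n] are positive; [1 / 2] keeps the coordinates
   [(1 - t) / 2] in [V m] positive. *)
pose t := Num.min (e / 2) (2^-1).
have t0 : 0 < t by rewrite lt_min divr_gt0//= invr_gt0.
have te : t < e by rewrite gt_min ltr_pdivrMr// ltr_pMr// ltr1n.
have t1 : t <= 2^-1 by rewrite ge_min lexx orbT.
have := he t; rewrite /ball /= sub0r normrN gtr0_norm// => /(_ te) ht.
set x := midpoint a b + t *: _ in ht; apply: mn.
have lx l : lam (V m) l x = if l == i then t else (1 - t) / 2.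
  rewrite /x lamD (edge_of_lam l (hdet m) ea) lam_vertex//.
  by case: eqP => _ /=; field.
apply: (@mesh_interior_disjoint m n x).
  by move=> l; rewrite lx; case: eqP => // _; rewrite divr_gt0//; lra.
apply/triP => // l; have [->|lj] := eqVneq l j; last exact/ltW/ht.
have := lam_nbr x (hdet m) (hdet n) h; rewrite lx eqxx => te'.
by rewrite -(pmulr_rge0 _ s0) -te' ltW.
Qed.

(** Two neighbours across the same edge would lie on the same side of it, against [nbr_opposite]
    applied to the pair they form. *)
Lemma nbr_unique m n i j n' j' : m <> n -> nbr (V m) i (V n) j ->
  m <> n' -> nbr (V m) i (V n') j' -> n = n' /\ j = j'.
Proof.
move=> mn h mn' h'.
have s := nbr_opposite mn h; have s' := nbr_opposite mn' h'.
have E x : lam (V m) i (V n j) * lam (V n) j x = lam (V m) i (V n' j') * lam (V n') j' x.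
  by rewrite -!lam_nbr.
have nn : n = n'.
  apply: contrapT => nn.
  have h2 : nbr (V n) j (V n') j'.
    have e : edge_of (V m) i (V m (nx i)) (V m (nx (nx i))) by left.
    exact: edge_of_nbr (nbr_edge_of h e) (nbr_edge_of h' e).
  have s2 := nbr_opposite nn h2.
  have := E (V n' j'); rewrite [in RHS]lam_vertex// eqxx mulr1 => e.
  by have := nmulr_rgt0 (lam (V n) j (V n' j')) s; rewrite e s2 ltNge (ltW s').
split => //; subst n'; have := E (V n j); rewrite !lam_vertex// eqxx.
case: eqP => [//|_]; rewrite mulr1 mulr0 => e; by rewrite e ltxx in s.
Qed.

(** A common vertex is a single point, so distinct common points leave only the case of a common
    edge. *)
Lemma mesh_common_points m n x y : m <> n -> x <> y ->
  tri (V m) x -> tri (V n) x -> tri (V m) y -> tri (V n) y ->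
  exists i j, [/\ nbr (V m) i (V n) j, lam (V m) i x = 0 & lam (V m) i y = 0].
Proof.
move=> mn xy mx nx_ my ny_.
have Ix : (tri (V m) `&` tri (V n)) x by [].
have Iy : (tri (V m) `&` tri (V n)) y by [].
case: (hreg mn) => [e|[a [b [/is_edge_tri -/(_ (hdet _))[i ei]
  /is_edge_tri -/(_ (hdet _))[j ej] e]]]|[a [_ _ e]]].
- by rewrite e in Ix.
- rewrite e in Ix Iy; exists i, j; split; first exact: edge_of_nbr ei ej.
    exact: segment_lam Ix.
  exact: segment_lam Iy.
- by rewrite e /= in Ix Iy; case: xy; rewrite Ix Iy.
Qed.

End Mesh.

(** * Triangulations of a Lipschitz domain *)

(* Above a point of the boundary graph, [Omega] and its closure have no points. *)
Lemma lipschitz_interior_closure (R : realType) (Omega : set (R * R)%type) :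
  open Omega -> lipschitz_boundary Omega -> (closure Omega)° `<=` Omega.
Proof.
move=> oO lip z zi; apply: contrapT => nz.
have bz : boundary Omega z.
  split; first exact: interior_subset.
  by move/interior_subset.
have [c [s [r [k [g [cs r0 glip hg]]]]]] := lip z bz.
have gz : g (dot (c, s) z) <= dot (- s, c) z.
  by rewrite leNgt; apply/negP => h; apply: nz; apply/hg => //; exact: ballxx.
pose v : R * R := (- s, c).
have vz t : dot (- s, c) (z + t *: v) = dot (- s, c) z + t.
  rewrite /dot /= /GRing.scale /=.
  transitivity (- s * z.1 + c * z.2 + t * (c ^+ 2 + s ^+ 2)); first by ring.
  by rewrite cs mulr1.
have uz t : dot (c, s) (z + t *: v) = dot (c, s) z.
  by rewrite /dot /= /GRing.scale /=; ring.
have near1 : \forall t \near (0 : R), closure Omega (z + t *: v) /\ ball z r (z + t *: v).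
  by apply: (nbhs_line (A := closure Omega `&` ball z r)); apply: filterI => //; exact: nbhsx_ballx.
have [t [t0 cl bl]] : exists t : R, [/\ 0 < t, closure Omega (z + t *: v) & ball z r (z + t *: v)].
  case/nbhs_ballP: near1 => e /= e0 he; exists (e / 2); have e20 : 0 < e / 2 by rewrite divr_gt0.
  have := he (e / 2); rewrite /ball /= sub0r normrN gtr0_norm// ltr_pdivrMr// ltr_pMr// ltr1n.
  by move=> /(_ isT)[].
set y := z + t *: v in cl bl.
have cdot (a b : R) : continuous (fun x : R * R => dot (a, b) x).
  have -> : (fun x : R * R => dot (a, b) x) = affine a b 0.
    by apply/funext => x; rewrite /affine addr0.
  exact: continuous_affine.
have cg : continuous g.
  move=> x; apply/cvgrPdist_lt => e e0.
  have K0 : 0 < `|k| + 1 by rewrite ltr_wpDl.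
  near=> w.
  apply: le_lt_trans (glip (x, w) _) _; first by split.
  rewrite /=; apply: (@le_lt_trans _ _ ((`|k| + 1) * `|x - w|)).
    by rewrite ler_wpM2r// (le_trans (ler_norm _))// lerDl.
  rewrite mulrC -ltr_pdivlMr//; near: w.
  by apply: cvgr_dist_lt => //; rewrite divr_gt0.
(* The height above the boundary graph: positive near [y], but negative at the points of [Omega] in
   the ball, although [y] lies in the closure. *)
pose F (x : R * R) := dot (- s, c) x - g (dot (c, s) x).
have cF : continuous F.
  move=> x; apply: cvgB; first exact: cdot.
  by apply: continuous_comp; [exact: cdot|exact: cg].
have Fy : 0 < F y by rewrite /F vz uz; lra.
have ny : nbhs y (ball z r `&` (F @^-1` [set x | 0 < x])).
  apply: filterI.
    by apply: open_nbhs_nbhs; split => //; exact: ball_open.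
  by apply: cF; apply: open_nbhs_nbhs; split => //; exact: open_gt.
have [w [Ow [/hg[h _] Fw]]] := cl _ ny.
by move: Fw (h Ow); rewrite /F /=; lra.
Unshelve. all: by end_near. Qed.

(** * Shared edges are the edges meeting the open domain *)

Section MeshDomain.
Context {R : realType}.
Local Notation plane := (R * R)%type.
Context {N : nat} (V : 'I_N -> 'I_3 -> plane) (Omega : set plane).
Implicit Types (m n : 'I_N) (i j : 'I_3) (x y : plane).
Hypothesis hdet : forall n, det3 (V n) != 0.
Hypothesis hreg : regular_mesh V.
Hypothesis oO : open Omega.
Hypothesis hint : (closure Omega)° `<=` Omega.
Hypothesis hcl : forall x, closure Omega x <-> exists n, tri (V n) x.

Lemma mesh_cover x : Omega x -> exists n, tri (V n) x.
Proof. by move=> Ox; apply/hcl; exact: subset_closure. Qed.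

Lemma mesh_interior n x : (forall i, 0 < lam (V n) i x) -> Omega x.
Proof.
move=> hx; apply: hint.
have : (tri (V n))° x by rewrite interior_tri.
by apply: interiorS => y Ty; apply/hcl; exists n.
Qed.

Lemma nbhs_lam_gt0 n (P : pred 'I_3) x : (forall i, P i -> 0 < lam (V n) i x) ->
  nbhs x [set y | forall i, P i -> 0 < lam (V n) i y].
Proof.
move=> h; apply: (nbhs_forall (f := fun i => [set y | P i -> 0 < lam (V n) i y])) => i.
have [Pi|Pi] := boolP (P i); last exact: filterE.
have : nbhs x (lam (V n) i @^-1` [set t | 0 < t]).
  apply: lam_continuous; apply: open_nbhs_nbhs; split; first exact: open_gt.
  exact: h.
by apply: filterS => y ? _.
Qed.

(** Around a point in the relative interior of a shared edge the two triangles fill a neighbourhood,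
    so the point is interior to the closure of [Omega]. *)
Lemma mesh_shared_edge m n i j x : m <> n -> nbr (V m) i (V n) j ->
  lam (V m) i x = 0 -> (forall l, l != i -> 0 < lam (V m) l x) -> Omega x.
Proof.
move=> mn h xi xl; apply: hint.
have s0 := nbr_opposite hdet hreg mn h.
have yl l : l != j -> 0 < lam (V n) l x.
  move=> lj; rewrite {1}/lam (affine_lam _ _ _ x (hdet m)) -!/(lam (V n) l _).
  have /= -> := sum3_nx (fun k => lam (V m) k x * lam (V n) l (V m k)) i.
  rewrite xi mul0r add0r.
  have p1 := xl _ (nx_neq i); have p2 := xl _ (nx2_neq i).
  have : nx j != nx (nx j) by rewrite eq_sym nx_neq.
  by case: (nx_cases lj) h => -> [[-> ->]|[-> ->]] /negPf jj;
    rewrite !lam_vertex// eqxx ?jj ?(eq_sym (nx (nx j))) ?jj ?mulr0 ?mulr1 ?add0r ?addr0.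
have : nbhs x ([set y | forall l, l != i -> 0 < lam (V m) l y] `&` [set y | forall l, l != j -> 0 < lam (V n) l y]).
  by apply: filterI; exact: nbhs_lam_gt0.
apply: filterS => y [hm hn]; apply/hcl.
have [ly|ly] := leP 0 (lam (V m) i y).
  by exists m; apply/triP => // l; have [->//|/hm/ltW] := eqVneq l i.
exists n; apply/triP => // l; have [->|/hn/ltW//] := eqVneq l j.
by move: ly; rewrite (lam_nbr y (hdet m) (hdet n) h) nmulr_rlt0// => /ltW.
Qed.

(** Triangles are closed and finite in number, so those missing [x] miss a neighbourhood of it. *)
Lemma mesh_local x : Omega x ->
  \forall y \near x, Omega y /\ forall n, tri (V n) y -> tri (V n) x.
Proof.
move=> Ox; apply: filterI; first exact: open_nbhs_nbhs.
apply: (nbhs_forall (f := fun n => [set y | tri (V n) y -> tri (V n) x])) => n.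
have [Tx|nTx] := pselect (tri (V n) x); first by apply: filterE => y.
have [i li] : exists i, lam (V n) i x < 0.
  apply: contrapT => /forallNP h; apply: nTx; apply/triP => // i.
  by rewrite leNgt; apply/negP/h.
have : nbhs x (lam (V n) i @^-1` [set t | t < 0]).
  by apply: lam_continuous; apply: open_nbhs_nbhs; split => //; exact: open_lt.
by apply: filterS => y /= ly /(triP _ (hdet n))/(_ i); rewrite leNgt ly.
Qed.

(** A short step across the edge stays in [Omega] and ends in another triangle, which contains [x]
    by [mesh_local]; as [x] has only one vanishing coordinate, the intersection can only be this
    edge. *)
Lemma mesh_interior_edge m i x : Omega x -> lam (V m) i x = 0 ->
  (forall l, l != i -> 0 < lam (V m) l x) -> exists n j, m <> n /\ nbr (V m) i (V n) j.
Proof.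
move=> Ox xi xl.
have := nbhs_line (x - V m i) (mesh_local Ox).
move=> /nbhs_ballP[e /= e0 /(_ (e / 2))]; set t := e / 2.
have t0 : 0 < t by rewrite divr_gt0.
rewrite /ball /= sub0r normrN gtr0_norm// ltr_pdivrMr// ltr_pMr// ltr1n => /(_ isT)[].
set y := x + _ => Oy hy.
have yi : lam (V m) i y < 0.
  rewrite /y (_ : t *: _ = (- t) *: (V m i - x)); last by rewrite scaleNr -scalerN opprB.
  by rewrite lamD xi lam_vertex// eqxx subr0 mulr1 add0r oppr_lt0.
have [n Tny] := mesh_cover Oy.
have mn : m <> n.
  by move=> mn; subst n; move/triP : Tny => /(_ (hdet m) i); rewrite leNgt yi.
have Tnx := hy _ Tny.
have Tmx : tri (V m) x.
  by apply/triP => // l; have [->|/xl/ltW//] := eqVneq l i; rewrite xi.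
have mnx : (tri (V m) `&` tri (V n)) x by [].
case: (hreg mn) => [h|[a [b [/is_edge_tri -/(_ (hdet _))[k ek]
  /is_edge_tri -/(_ (hdet _))[j ej] h]]]|[a [/is_vertex_tri -/(_ (hdet _))[k ak] _ h]]].
- by rewrite h in mnx.
- have ik : i = k.
    apply: contrapT => /eqP ik; rewrite h in mnx.
    have := segment_lam (hdet m) ek mnx; move/eqP; rewrite gt_eqF//.
    by apply: xl; rewrite eq_sym.
  by exists n, j; split => //; subst k; exact: edge_of_nbr ek ej.
- exfalso; rewrite h /= ak in mnx; have [l li lk] := third_index i k.
  by have := xl l li; rewrite mnx lam_vertex// (negPf lk) ltxx.
Qed.

(** The point of the edge in [Omega] may be an endpoint; moving it slightly towards the midpoint
    puts it into the relative interior of the edge without leaving [Omega]. *)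
Lemma edge_not_boundary m i a b : edge_of (V m) i a b ->
  ~ (segment a b `<=` boundary Omega) -> exists n j, m <> n /\ nbr (V m) i (V n) j.
Proof.
move=> e /existsNP[x /not_implyP[sx nb]].
have [t [/andP[t0 t1] xE]] := sx.
have lx l : lam (V m) l x = lam (V m) l a + t * (lam (V m) l b - lam (V m) l a).
  by rewrite xE -lamD scalerBl scale1r scalerBr addrA addrAC.
have Tx : tri (V m) x.
  apply/triP => // l; rewrite lx.
  by move: e => [[-> ->]|[-> ->]]; rewrite !lam_vertex//; do 2 case: eqP => _; rewrite /=; lra.
have Ox : Omega x.
  apply: contrapT => nO; apply: nb; split; first by apply/hcl; exists m.
  by move/interior_subset.
have xi : lam (V m) i x = 0 by exact: segment_lam sx.
have := nbhs_line (midpoint a b - x) (open_nbhs_nbhs (conj oO Ox)).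
move=> /nbhs_ballP[d /= d0].
pose s := Num.min (d / 2) (2^-1).
have s0 : 0 < s by rewrite lt_min divr_gt0//= invr_gt0.
have sd : s < d by rewrite gt_min ltr_pdivrMr// ltr_pMr// ltr1n.
have s1 : s <= 2^-1 by rewrite ge_min lexx orbT.
move=> /(_ s); rewrite /ball /= sub0r normrN gtr0_norm// => /(_ sd) Oy.
apply: mesh_interior_edge Oy _ _.
  by rewrite lamD xi (edge_of_lam i (hdet m) e) eqxx subrr mulr0 addr0.
move=> l li; rewrite lamD (edge_of_lam l (hdet m) e) (negPf li).
have := triP x (hdet m) => /iffLR/(_ Tx l).
by move: (lam (V m) l x) => z z0; nra.
Qed.

End MeshDomain.

(** * Potentials of piecewise constant fields *)

(** The supremum of the points reachable from [a] is itself reachable, and the local property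
    carries past it unless it is [b]. This plays the role of a subdivision by a Lebesgue number. *)
Lemma interval_induction (R : realType) (P : R -> R -> Prop) (a b : R) : a <= b ->
  (forall x y z, a <= x <= y -> y <= z <= b -> P x y -> P y z -> P x z) ->
  (forall t, a <= t <= b -> exists2 d : R, 0 < d & forall x y, a <= x <= t -> t <= y <= b ->
     t - d < x -> y < t + d -> P x y) ->
  P a b.
Proof.
move=> ab add loc.
pose S := [set t | a <= t <= b /\ P a t].
have Sa : S a.
  split; first by rewrite lexx.
  have [|d d0 h] := loc a; first by rewrite lexx.
  by apply: h; rewrite ?lexx ?ltrBlDr ?ltrDl.
have supS : has_sup S by split; [exists a|exists b => t [/andP[]]].
have ub : forall t, S t -> t <= sup S by move=> t St; exact: sup_upper_bound.
have sb : sup S <= b by apply: ge_sup => //; [exists a|move=> t [/andP[]]].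
have [|d d0 h] := loc (sup S); first by rewrite ub.
have [t [/andP[at_ tb] Pt] ht] : exists2 t, S t & sup S - d < t by exact: sup_adherent.
have Ps : P a (sup S).
  have ts : t <= sup S by apply: ub; split => //; rewrite at_.
  apply: (add a t) => //; first by rewrite lexx.
    by rewrite ts.
  by apply: h => //; rewrite ?at_ ?lexx// ltrDl.
pose y := Num.min b (sup S + d / 2).
have Ss := ub _ Sa.
have ys : sup S <= y by rewrite le_min sb lerDl divr_ge0// ltW.
have Py : P a y.
  apply: (add a (sup S)) => //; rewrite ?lexx ?ys ?ge_min ?lexx//.
  apply: h; rewrite ?Ss ?lexx ?ys ?ge_min ?lexx//; first by rewrite ltrBlDr ltrDl.
  by rewrite gt_min ltrD2l ltr_pdivrMr// ltr_pMr// ltr1n orbT.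
have : y <= sup S.
  by apply: ub; split => //; rewrite (le_trans Ss ys)/= ge_min lexx.
rewrite ge_min => /orP[bs|]; last first.
  by rewrite gerDl leNgt divr_gt0.
by rewrite (_ : b = sup S)//; apply/eqP; rewrite eq_le sb bs.
Qed.

Section Lift.
Context {R : realType}.
Local Notation plane := (R * R)%type.
Context {N : nat} (V : 'I_N -> 'I_3 -> plane) (Omega : set plane) (w : 'I_N -> plane).
Implicit Types (m n : 'I_N) (i j : 'I_3) (x y : plane).
Hypothesis hdet : forall n, det3 (V n) != 0.
Hypothesis hcover : forall x, Omega x -> exists n, tri (V n) x.
Hypothesis hloc : forall x, Omega x ->
  \forall y \near x, Omega y /\ forall n, tri (V n) y -> tri (V n) x.
Hypothesis hw : forall m n x y, tri (V m) x -> tri (V n) x -> tri (V m) y ->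
  tri (V n) y -> dot (w m) (y - x) = dot (w n) (y - x).

Definition itvcc (a b : R) : set R := [set t | a <= t <= b].

(** The increment of the sought potential prescribed by any triangle containing both points; [hw]
    makes it independent of the triangle. *)
Definition step x y (d : R) := exists n, [/\ tri (V n) x, tri (V n) y & d = dot (w n) (y - x)].

Lemma step_unique x y d d' : step x y d -> step x y d' -> d = d'.
Proof. by move=> [n [nx_ ny ->]] [m [mx my ->]]; exact: hw. Qed.

(** The analogue of a lift to a covering space: [h] follows the potential along [g]. The domain is
    arbitrary so that paths and homotopy squares are treated alike. *)
Definition is_lift (X : topologicalType) (D : set X) (g : X -> plane) (h : X -> R) :=
  forall t, D t -> nbhs t [set s | D s -> step (g t) (g s) (h s - h t)].

Definition cont_in (X : topologicalType) (D : set X) (Y : topologicalType) (g : X -> Y) :=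
  forall t, D t -> forall U, nbhs (g t) U -> nbhs t [set s | D s -> U (g s)].

Lemma is_lift_sub (X : topologicalType) (D D' : set X) g h : D' `<=` D ->
  is_lift D g h -> is_lift D' g h.
Proof.
move=> DD hl t /DD Dt; have := hl t Dt; apply: filterS => s /= hs /DD; exact: hs.
Qed.

Lemma is_lift_comp (X Y : topologicalType) (D : set X) (D' : set Y) (th : Y -> X) g h :
  (forall t, D' t -> D (th t)) -> cont_in D' th ->
  is_lift D g h -> is_lift D' (g \o th) (h \o th).
Proof.
move=> DD cth hl t D't.
have h1 := hl _ (DD _ D't).
have := cth t D't _ h1.
apply: filterS => s /= hs D's.
by apply: hs => //; exact: DD.
Qed.

(** Near [t0] every triangle containing [g s] also contains [g t0], so the increment from [g t0] to
    [g s] is defined and serves as [h s]. *)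
Lemma is_lift_local (X : topologicalType) (D : set X) g t0 : D t0 -> cont_in D g ->
  (forall t, D t -> Omega (g t)) ->
  exists (U : set X) (h : X -> R), nbhs t0 U /\ is_lift (D `&` U) g h.
Proof.
move=> D0 cg gO.
pose U := [set s | D s -> forall n, tri (V n) (g s) -> tri (V n) (g t0)].
exists U, (fun s => xget 0 [set d | step (g t0) (g s) d]); split.
  have := cg t0 D0 _ (hloc (gO _ D0)).
  by apply: filterS => s /= hs /hs[].
have val s n : tri (V n) (g t0) -> tri (V n) (g s) ->
    xget 0 [set d | step (g t0) (g s) d] = dot (w n) (g s - g t0).
  move=> n0 ns; have hs : step (g t0) (g s) (dot (w n) (g s - g t0)) by exists n.
  by apply: (step_unique (x := g t0) (y := g s)) => //; exact: (xgetPex 0 (ex_intro _ _ hs)).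
move=> t [Dt Ut]; have := cg t Dt _ (hloc (gO _ Dt)).
apply: filterS => s /= hs [Ds Us].
have [_ hn] := hs Ds; have [n ns] := hcover (gO _ Ds).
have nt := hn _ ns; have n0 := Us Ds _ ns.
exists n; split => //; rewrite !(val _ n)//.
by rewrite /dot /=; ring.
Qed.

(** Increments are unique, so the difference of two lifts is locally constant, hence constant on an
    interval. *)
Lemma is_lift_unique (a b : R) (g : R -> plane) h h' : a <= b ->
  is_lift (itvcc a b) g h -> is_lift (itvcc a b) g h' ->
  forall t, a <= t <= b -> h t - h' t = h a - h' a.
Proof.
move=> ab hl hl' t /andP[at_ tb].
have := @interval_induction R (fun x y : R => h y - h' y = h x - h' x) a t at_; apply.
  by move=> x y z _ _ -> ->.
move=> s /andP[as_ st].
have Ds : (itvcc a b) s by rewrite /itvcc /= as_ (le_trans st).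
have := nbhsI (hl s Ds) (hl' s Ds).
move=> /nbhs_ballP[d /= d0 hd]; exists d => // x y /andP[ax xs] /andP[sy yt] xd yd.
have key z : a <= z <= b -> `|s - z| < d -> h z - h' z = h s - h' s.
  move=> zab zd; have [h1 h2] := hd z zd.
  by have := step_unique (h1 zab) (h2 zab); lra.
rewrite !key//.
- by rewrite ax (le_trans xs)// (le_trans st).
- by rewrite ger0_norm ?subr_ge0//; lra.
- by rewrite (le_trans as_)//= (le_trans yt).
- by rewrite ler0_norm ?subr_le0//; lra.
Qed.

(** Lifts that differ by a constant on the slice [pi t = c] fit together once the second is shifted
    by it. For paths [pi] is the parameter, for squares one of the coordinates. *)
Lemma is_lift_glue (X : topologicalType) (D : set X) (pi : X -> R) (c : R) g h1 h2 K :
  continuous pi ->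
  is_lift (D `&` [set t | pi t <= c]) g h1 -> is_lift (D `&` [set t | c <= pi t]) g h2 ->
  (forall t, D t -> pi t = c -> h1 t = h2 t + K) ->
  exists h, is_lift D g h.
Proof.
move=> cpi l1 l2 hK; exists (fun t => if pi t <= c then h1 t else h2 t + K) => t Dt.
have [tc|ct|tc] := ltgtP (pi t) c.
- have n1 : \forall s \near t, pi s < c.
    have : nbhs (pi t) [set u | u < c] by apply: open_nbhs_nbhs; split => //; exact: open_lt.
    exact: cpi.
  have := nbhsI n1 (l1 t (conj Dt (ltW tc))).
  by apply: filterS => s /= [sc hs] Ds; rewrite (ltW sc); apply: hs; split => //; exact: ltW.
- have n1 : \forall s \near t, c < pi s.
    have : nbhs (pi t) [set u | c < u] by apply: open_nbhs_nbhs; split => //; exact: open_gt.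
    exact: cpi.
  have := nbhsI n1 (l2 t (conj Dt (ltW ct))).
  apply: filterS => s /= [sc hs] Ds; rewrite leNgt sc /=.
  have := hs (conj Ds (ltW sc)).
  by rewrite (_ : h2 s + K - (h2 t + K) = h2 s - h2 t)//; ring.
- have a1 : (D `&` [set t | pi t <= c]) t by split => //=; rewrite tc.
  have a2 : (D `&` [set t | c <= pi t]) t by split => //=; rewrite tc.
  have := nbhsI (l1 t a1) (l2 t a2).
  apply: filterS => s /= [s1 s2] Ds; case: leP => sc; first by apply: s1.
  have := s2 (conj Ds (ltW sc)).
  by rewrite (_ : h2 s + K - h1 t = h2 s - h2 t)// (hK t)//; ring.
Qed.

Lemma lift_path (g : R -> plane) : cont_in (itvcc 0 1) g ->
  (forall t, 0 <= t <= 1 -> Omega (g t)) -> exists h, is_lift (itvcc 0 1) g h.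
Proof.
move=> cg gO.
apply: (@interval_induction R (fun a b => exists h, is_lift (itvcc a b) g h) 0 1) => //.
  move=> x y z /andP[x0 xy] /andP[yz z1] [h1 l1] [h2 l2].
  apply: (@is_lift_glue _ _ id y g h1 h2 (h1 y - h2 y)).
  - by move=> ?; exact: cvg_id.
  - by apply: is_lift_sub l1 => t /= [/andP[? _] ?]; apply/andP.
  - by apply: is_lift_sub l2 => t /= [/andP[_ ?] ?]; apply/andP.
  - by move=> t _ /= ->; ring.
move=> t t01; have Dt : (itvcc 0 1) t by [].
have [|U [h [Ut hl]]] := is_lift_local Dt cg.
  by move=> s /=; exact: gO.
case/nbhs_ballP: Ut => d /= d0 dU; exists d => // x y /andP[x0 xt] /andP[ty y1] xd yd.
exists h; apply: is_lift_sub hl => s /=; move=> /andP[xs sy]; split.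
  by rewrite /itvcc /= (le_trans x0)//= (le_trans sy).
by apply: dU; rewrite /ball /= ltr_norml; apply/andP; split; lra.
Qed.

(** Two nested inductions: local lifts are glued along the first variable to a thin strip, and the
    strips along the second. On each common slice, which is an interval, the lifts differ by a
    constant by [is_lift_unique]. *)
Lemma lift_square (H : R * R -> plane) : cont_in (itvcc 0 1 `*` itvcc 0 1) H ->
  (forall t s, 0 <= t <= 1 -> 0 <= s <= 1 -> Omega (H (t, s))) ->
  exists h, is_lift (itvcc 0 1 `*` itvcc 0 1) H h.
Proof.
move=> cH HO.
have cpair1 (s : R) (E : set R) : cont_in E (fun t : R => (t, s)).
  move=> t _ U /nbhs_ballP[d d0 dU]; apply/nbhs_ballP; exists d => // u bu _.
  by apply: dU; split => //; exact: ballxx.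
have cpair2 (s : R) (E : set R) : cont_in E (fun t : R => (s, t)).
  move=> t _ U /nbhs_ballP[d d0 dU]; apply/nbhs_ballP; exists d => // u bu _.
  by apply: dU; split => //; exact: ballxx.
apply: (@interval_induction R (fun a b => exists h, is_lift (itvcc 0 1 `*` itvcc a b) H h) 0 1) => //.
  move=> x y z /andP[x0 xy] /andP[yz z1] [h1 l1] [h2 l2].
  apply: (@is_lift_glue _ _ snd y H h1 h2 (h1 (0, y) - h2 (0, y))).
  - by move=> ?; exact: cvg_snd.
  - by apply: is_lift_sub l1 => t /= [[? /andP[? _]] ?]; split => //; apply/andP.
  - by apply: is_lift_sub l2 => t /= [[? /andP[_ ?]] ?]; split => //; apply/andP.
  - move=> [t s] [/=]; move=> t01 _ ->.
    have e1 : is_lift (itvcc 0 1) (H \o (fun t => (t, y))) (h1 \o (fun t => (t, y))).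
      apply: is_lift_comp l1 => // u /= u01; split => //=.
      by rewrite /itvcc /= lexx xy.
    have e2 : is_lift (itvcc 0 1) (H \o (fun t => (t, y))) (h2 \o (fun t => (t, y))).
      apply: is_lift_comp l2 => // u /= u01; split => //=.
      by rewrite /itvcc /= lexx yz.
    by have /= := is_lift_unique ler01 e1 e2 t01; lra.
move=> s0 s01.
(* The thickness [d] is part of the inductive property, so that gluing two pieces may pass to the
   smaller one. *)
pose E d := itvcc (s0 - d) (s0 + d) `&` itvcc 0 1.
suff [d [d0 [h hl]]] : exists d : R, 0 < d /\ exists h, is_lift (itvcc 0 1 `*` E d) H h.
  exists d => // x y /andP[x0 xt] /andP[ty y1] xd yd; exists h.
  apply: is_lift_sub hl => -[t s] /= [t01]; move=> /andP[xs sy]; split => //.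
  by split; rewrite /itvcc /=; apply/andP; split; lra.
apply: (@interval_induction R (fun a b => exists d : R, 0 < d /\
  exists h, is_lift (itvcc a b `*` E d) H h) 0 1) => //.
  move=> x y z /andP[x0 xy] /andP[yz z1] [d1 [d10 [h1 l1]]] [d2 [d20 [h2 l2]]].
  pose d := Num.min d1 d2; exists d; split; first by rewrite lt_min d10.
  have Ed1 : E d `<=` E d1.
    move=> s /= []; rewrite /itvcc /= => /andP[h3 h4] h5; split; rewrite /itvcc //=.
    have : d <= d1 by rewrite ge_min lexx.
    by move=> ?; apply/andP; split; lra.
  have Ed2 : E d `<=` E d2.
    move=> s /= []; rewrite /itvcc /= => /andP[h3 h4] h5; split; rewrite /itvcc //=.
    have : d <= d2 by rewrite ge_min lexx orbT.
    by move=> ?; apply/andP; split; lra.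
  apply: (@is_lift_glue _ _ fst y H h1 h2 (h1 (y, s0) - h2 (y, s0))).
  - by move=> ?; exact: cvg_fst.
  - by apply: is_lift_sub l1 => t /= [[/andP[? _] /Ed1 ?] ?]; split => //; apply/andP.
  - by apply: is_lift_sub l2 => t /= [[/andP[_ ?] /Ed2 ?] ?]; split => //; apply/andP.
  - move=> [t s] [/= _ Es] ->.
    (* The slice [{y} x E d] is the interval from [a] to [b], possibly cut off by the square. *)
    pose a := Num.max (s0 - d) 0; pose b := Num.min (s0 + d) 1.
    have d0 : 0 < d by rewrite lt_min d10.
    have /andP[s00 s0le1] := s01.
    have Eab u : a <= u <= b -> E d u.
      rewrite ge_max le_min => /andP[/andP[? ?] /andP[? ?]].
      by split; rewrite /itvcc /=; apply/andP.
    have Eba u : E d u -> a <= u <= b.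
      move=> []; rewrite /itvcc /= => /andP[? ?] /andP[? ?].
      by rewrite ge_max le_min; apply/andP; split; apply/andP.
    have Es0 : E d s0 by split; rewrite /itvcc /=; apply/andP; split => //; lra.
    have /andP[as0 s0b] := Eba _ Es0.
    have e1 : is_lift (itvcc a b) (H \o (fun t => (y, t))) (h1 \o (fun t => (y, t))).
      apply: is_lift_comp l1 => // u /=; move=> /Eab/Ed1 hu; split => //=.
      by rewrite /itvcc /= lexx xy.
    have e2 : is_lift (itvcc a b) (H \o (fun t => (y, t))) (h2 \o (fun t => (y, t))).
      apply: is_lift_comp l2 => // u /=; move=> /Eab/Ed2 hu; split => //=.
      by rewrite /itvcc /= lexx yz.
    have ab : a <= b by apply: le_trans s0b.
    have /= q1 := is_lift_unique ab e1 e2 (Eba _ Es).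
    have /= q2 := is_lift_unique ab e1 e2 (Eba _ Es0).
    by lra.
move=> t0 t01.
have D0 : (itvcc 0 1 `*` itvcc 0 1) (t0, s0) by split.
have [|U [h [Ut hl]]] := is_lift_local D0 cH.
  by move=> [t s] [] /=; exact: HO.
case/nbhs_ballP: Ut => d /= d0 dU; exists d => // x y /andP[x0 xt] /andP[ty y1] xd yd.
exists (d / 2); split; first by rewrite divr_gt0.
exists h; apply: is_lift_sub hl => -[t s] [] /=; move=> /andP[xs sy].
move=> []; rewrite /itvcc /= => /andP[? ?] s'01; split.
  by split; rewrite //=  (le_trans x0)//= (le_trans sy).
by apply: dU; split; rewrite /ball /= ltr_norml; apply/andP; split; lra.
Qed.

Lemma is_lift_cst (D : set R) (c : plane) : Omega c -> is_lift D (fun=> c) (fun=> 0).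
Proof.
move=> /hcover[n nc] t Dt; apply: filterE => s _; exists n; split => //.
by rewrite /dot !subrr !mulr0 addr0.
Qed.

(** On three sides of the square the homotopy is constant, hence so is the lift of the square. It
    therefore takes equal values at both ends of the fourth side, where it differs from [h] by a
    constant. *)
Lemma monodromy (H : R * R -> plane) (g : R -> plane) (h : R -> R) :
  cont_in (itvcc 0 1 `*` itvcc 0 1) H ->
  (forall t s, 0 <= t <= 1 -> 0 <= s <= 1 -> Omega (H (t, s))) ->
  (forall t, 0 <= t <= 1 -> H (t, 0) = g t) ->
  (forall t, 0 <= t <= 1 -> H (t, 1) = g 0) ->
  (forall s, 0 <= s <= 1 -> H (0, s) = g 0 /\ H (1, s) = g 0) ->
  is_lift (itvcc 0 1) g h -> h 0 = h 1.
Proof.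
move=> cH HO H0 H1 Hs hl.
have [k lk] := lift_square cH HO.
have Og : Omega (g 0) by rewrite -H0 ?lexx ?ler01//; apply: HO; rewrite lexx ler01.
have z01 : 0 <= (0 : R) <= 1 by rewrite lexx ler01.
have o01 : 0 <= (1 : R) <= 1 by rewrite lexx ler01.
have side (th : R -> R * R) : (forall t, 0 <= t <= 1 -> (itvcc 0 1 `*` itvcc 0 1) (th t)) ->
    continuous th -> (forall t, 0 <= t <= 1 -> H (th t) = g 0) -> k (th 1) = k (th 0).
  move=> h1 cth h2.
  have l1 : is_lift (itvcc 0 1) (H \o th) (k \o th).
    apply: is_lift_comp lk => // t Dt U tU; have : nbhs t (th @^-1` U) := cth t _ tU.
    by apply: filterS => s ? _.
  have l2 : is_lift (itvcc 0 1) (fun=> g 0) (k \o th).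
    move=> t Dt; have := l1 t Dt; apply: filterS => s /= hs Ds.
    by have := hs Ds; rewrite !h2.
  have := is_lift_unique ler01 l2 (is_lift_cst (D := itvcc 0 1) Og) o01.
  by rewrite /= !subr0.
have c1 (s : R) : continuous (fun t : R => (t, s)).
  move=> t U /nbhs_ballP[d d0 dU]; apply/nbhs_ballP; exists d => // u bu.
  by apply: dU; split => //; exact: ballxx.
have c2 (s : R) : continuous (fun t : R => (s, t)).
  move=> t U /nbhs_ballP[d d0 dU]; apply/nbhs_ballP; exists d => // u bu.
  by apply: dU; split => //; exact: ballxx.
have s1 : k (1, 1) = k (0, 1).
  by apply: (side (fun t => (t, 1))) => // [t t01]; split.
have s2 : k (0, 1) = k (0, 0).
  apply: (side (fun t => (0, t))) => // t t01.
  by have [] := Hs t t01.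
have s3 : k (1, 1) = k (1, 0).
  apply: (side (fun t => (1, t))) => // t t01.
  by have [] := Hs t t01.
have l3 : is_lift (itvcc 0 1) g (k \o (fun t => (t, 0))).
  have l1 : is_lift (itvcc 0 1) (H \o (fun t => (t, 0))) (k \o (fun t => (t, 0))).
    apply: is_lift_comp lk => [t Dt|t Dt U tU]; first by split.
    by have : nbhs t ((fun t : R => (t, 0 : R)) @^-1` U) := c1 0 t _ tU; apply: filterS => s ? _.
  move=> t Dt; have := l1 t Dt; apply: filterS => s /= hs Ds.
  by have := hs Ds; rewrite !H0.
have := is_lift_unique ler01 hl l3 o01; rewrite /=; lra.
Qed.

Lemma within_cont_in (X Y : topologicalType) (A : set X) (g : X -> Y) :
  {within A, continuous g} -> cont_in A g.
Proof.
move=> cg t Dt U gU.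
have : nbhs_subspace (t : subspace A) (g @^-1` U) := cg t U gU.
by rewrite -nbhs_subspace_in.
Qed.

(** The retraction onto the unit interval turns a path continuous within it into a continuous map of
    the whole line, so that paths can be concatenated by a sum instead of by cases. *)
Definition clamp (t : R) : R := Num.max 0 (Num.min t 1).

Lemma clamp_itv t : 0 <= clamp t <= 1.
Proof.
rewrite /clamp le_max lexx /= ge_max ler01 /= ge_min lexx orbT //.
Qed.

Lemma clamp_id t : 0 <= t <= 1 -> clamp t = t.
Proof. by move=> /andP[t0 t1]; rewrite /clamp min_l// max_r. Qed.

Lemma clamp_le0 t : t <= 0 -> clamp t = 0.
Proof.
by move=> t0; rewrite /clamp max_l// ge_min t0.
Qed.

Lemma clamp_ge1 t : 1 <= t -> clamp t = 1.
Proof. by move=> t1; rewrite /clamp min_r// max_r. Qed.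

Lemma clampE t : clamp t = if t <= 0 then 0 else if t <= 1 then t else 1.
Proof.
case: (leP t 0) => [/clamp_le0//|t0]; case: (leP t 1) => t1.
  by rewrite clamp_id// ltW.
by rewrite clamp_ge1// ltW.
Qed.

Lemma clamp_lip s t : `|clamp s - clamp t| <= `|s - t|.
Proof.
wlog st : s t / s <= t.
  by move=> h; case: (leP s t) => [/h//|/ltW/h]; rewrite distrC (distrC t).
have [c1 c2] : clamp s <= clamp t /\ clamp t - clamp s <= t - s.
  rewrite !clampE.
  case: (leP s 0) => ?; case: (leP t 0) => ?; case: (leP s 1) => ?; case: (leP t 1) => ?;
    split; lra.
by rewrite !ler0_norm ?subr_le0// !opprB.
Qed.

Lemma clamp_continuous : continuous clamp.
Proof.
move=> t; apply/cvgrPdist_lt => /= e e0; near=> s.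
apply: le_lt_trans (clamp_lip _ _) _; near: s.
exact: cvgr_dist_lt.
Unshelve. all: by end_near. Qed.

Lemma cont_in_clamp (g : R -> plane) : cont_in (itvcc 0 1) g ->
  continuous (g \o clamp).
Proof.
move=> cg t U gU; have : nbhs t (clamp @^-1` [set s | itvcc 0 1 s -> U (g s)]).
  by apply: clamp_continuous; apply: cg => //; exact: clamp_itv.
by apply: filterS => s /=; apply; exact: clamp_itv.
Qed.

(* The potential is the increment of the lift of a path from a base point;
   comparing two paths takes the lift of the loop formed by the first path, a
   short segment and the reverse of the second path. *)
Lemma global_potential : simply_connected Omega -> Omega !=set0 ->
  exists beta : plane -> R, forall x, Omega x ->
    \forall y \near x, step x y (beta y - beta x).
Proof.
move=> [pc sc] [x0 Ox0].
(* Outside [Omega] a dummy path makes the choice total. *)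
have paths x : exists g : R -> plane, Omega x -> [/\ path_in Omega g, g 0 = x0 & g 1 = x].
  have [Ox|nO] := pselect (Omega x); last by exists (fun=> x0).
  by have [g gP] := pc _ _ Ox0 Ox; exists g.
have [ga gaP] := choice paths.
have lifts x : exists h : R -> R, Omega x -> is_lift (itvcc 0 1) (ga x) h.
  have [Ox|nO] := pselect (Omega x); last by exists (fun=> 0).
  have [[cg gO] _ _] := gaP x Ox.
  by have [h hl] := lift_path (within_cont_in cg) gO; exists h.
have [hh hhP] := choice lifts.
exists (fun x => hh x 1 - hh x 0) => x Ox.
have /nbhs_ballP[d /= d0 hd] := hloc Ox.
apply/nbhs_ballP; exists d => // y xy.
have [Oy hy] := hd y xy.
have [n ny] := hcover Oy; have nx_ := hy n ny.
exists n; split => //.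
pose sg t : plane := x + t *: (y - x).
have sgB t : 0 <= t <= 1 -> ball x d (sg t).
  move=> /andP[t0 t1]; case: xy => xy1 xy2; split; rewrite /ball /= /sg /=.
    rewrite opprD addrA subrr sub0r normrN normrM ger0_norm//.
    by apply: le_lt_trans xy1; rewrite distrC ler_piMl.
  rewrite opprD addrA subrr sub0r normrN normrM ger0_norm//.
  by apply: le_lt_trans xy2; rewrite distrC ler_piMl.
have sgT t : 0 <= t <= 1 -> tri (V n) (sg t).
  move=> /andP[t0 t1]; apply/triP => // i; rewrite /sg lamD.
  have := triP x (hdet n) => /iffLR/(_ nx_ i); have := triP y (hdet n) => /iffLR/(_ ny i).
  by move: (lam (V n) i x) (lam (V n) i y) => u v; nra.
have sgl : is_lift (itvcc 0 1) sg (fun t => t * dot (w n) (y - x)).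
  move=> t t01; apply: filterE => s s01; exists n; split; try exact: sgT.
  by rewrite /sg /dot /= /GRing.scale /=; ring.
have [[cx xO] x_0 x_1] := gaP x Ox; have [[cy yO] y_0 y_1] := gaP y Oy.
(* Each summand varies on one third of the interval only and contributes [x0], [y - x] or [x0 - y]
   in turn at its varying end, so the sum runs along the path to [x], the segment to [y] and the
   reversed path to [y]. *)
pose g (t : R) : plane := ga x (clamp (3 * t)) + (sg (clamp (3 * t - 1)) - x) +
  (ga y (clamp (3 - 3 * t)) - y).
have g1 t : 0 <= t <= 3^-1 -> g t = ga x (3 * t).
  move=> t01; rewrite /g clamp_id; last by lra.
  rewrite (@clamp_le0 (3 * t - 1)); last by lra.
  rewrite (@clamp_ge1 (3 - 3 * t)); last by lra.
  by rewrite y_1 subrr addr0 /sg scale0r addr0 subrr addr0.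
have g2 t : 3^-1 <= t <= 2 / 3 -> g t = sg (3 * t - 1).
  move=> t01; rewrite /g clamp_ge1; last by lra.
  rewrite clamp_id; last by lra.
  rewrite (@clamp_ge1 (3 - 3 * t)); last by lra.
  by rewrite y_1 subrr addr0 x_1 addrC subrK.
have g3 t : 2 / 3 <= t <= 1 -> g t = ga y (3 - 3 * t).
  move=> t01; rewrite /g clamp_ge1; last by lra.
  rewrite (@clamp_ge1 (3 * t - 1)); last by lra.
  rewrite clamp_id; last by lra.
  rewrite x_1 /sg scale1r.
  have xyx : x + (y - x) = y by rewrite addrC subrK.
  by rewrite xyx xyx addrC subrK.
have gO t : 0 <= t <= 1 -> Omega (g t).
  move=> t01; have [t1|t1] := leP t 3^-1.
    by rewrite g1; [apply: xO|]; lra.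
  have [t2|t2] := leP t (2 / 3).
    by rewrite g2; [apply: (hd _ (sgB _ _)).1|]; lra.
  by rewrite g3; [apply: yO|]; lra.
have caff (a b : R) : continuous (fun t : R => a * t + b).
  move=> t; apply: cvgD; last exact: cvg_cst.
  by apply: cvgM; [exact: cvg_cst|exact: cvg_id].
have ccomp (f : R -> plane) (a b : R) : continuous f -> continuous (fun t : R => f (a * t + b)).
  by move=> cf t; apply: (@continuous_comp R R plane _ f t); [exact: caff|exact: cf].
have cx3 : continuous (fun t : R => ga x (clamp (3 * t))).
  have -> : (fun t : R => ga x (clamp (3 * t))) = (fun t : R => (ga x \o clamp) (3 * t + 0)).
    by apply/funext => t; rewrite /= addr0.
  exact/ccomp/cont_in_clamp/within_cont_in.
have cy3 : continuous (fun t : R => ga y (clamp (3 - 3 * t))).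
  have -> : (fun t : R => ga y (clamp (3 - 3 * t))) = (fun t : R => (ga y \o clamp) (- 3 * t + 3)).
    by apply/funext => t; rewrite /= mulNr addrC.
  exact/ccomp/cont_in_clamp/within_cont_in.
have cs3 : continuous (fun t : R => sg (clamp (3 * t - 1))).
  apply: (ccomp (sg \o clamp)) => t; apply: continuous_comp; first exact: clamp_continuous.
  by apply: cvgD; [exact: cvg_cst|apply: cvgZr_tmp; exact: cvg_id].
have cg : continuous g.
  move=> t; apply: cvgD; first apply: cvgD.
  - exact: cx3.
  - by apply: cvgB; [exact: cs3|exact: cvg_cst].
  - by apply: cvgB; [exact: cy3|exact: cvg_cst].
have pg : path_in Omega g by split => //; exact: continuous_subspaceT.
have g0 : g 0 = x0 by rewrite g1 ?mulr0//; lra.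
have g1_ : g 1 = x0 by rewrite g3 ?mulr1 ?subrr//; lra.
have [H [cH HO H0 H1 Hs]] := sc g pg (etrans g0 (esym g1_)).
have [k kl] := lift_path (within_cont_in pg.1) gO.
have k01 : k 0 = k 1 by exact: (monodromy (within_cont_in cH) HO H0 H1 Hs kl).
have reparam (a b : R) (f : R -> plane) :
    (forall t, 0 <= t <= 1 -> 0 <= a * t + b <= 1 /\ g (a * t + b) = f t) ->
    is_lift (itvcc 0 1) f (fun t => k (a * t + b)).
  move=> h; have l : is_lift (itvcc 0 1) (g \o (fun t => a * t + b)) (k \o (fun t => a * t + b)).
    apply: is_lift_comp kl => [t /h[]//|t Dt U tU].
    have : nbhs t ((fun t => a * t + b) @^-1` U) := caff a b t _ tU.
    by apply: filterS => s ? _.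
  move=> t Dt; have := l t Dt; apply: filterS => s /= hs Ds.
  by have := hs Ds; rewrite (h t Dt).2 (h s Ds).2.
have o01 : 0 <= (1 : R) <= 1 by rewrite lexx ler01.
have l1 : is_lift (itvcc 0 1) (ga x) (fun t => k (3^-1 * t + 0)).
  apply: reparam => t /andP[t0 t1]; split; first by lra.
  by rewrite g1; [congr (ga x _); field|lra].
have l2 : is_lift (itvcc 0 1) sg (fun t => k (3^-1 * t + 3^-1)).
  apply: reparam => t /andP[t0 t1]; split; first by lra.
  by rewrite g2; [congr sg; field|lra].
have l3 : is_lift (itvcc 0 1) (ga y) (fun t => k (- 3^-1 * t + 1)).
  apply: reparam => t /andP[t0 t1]; split; first by lra.
  by rewrite g3; [congr (ga y _); field|lra].
(* Uniqueness identifies the increments of [k] over the three thirds with those of the lifts already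
   known; by [k01] they add up to zero. *)
have := is_lift_unique ler01 l1 (hhP x Ox) o01.
have := is_lift_unique ler01 l2 sgl o01.
have := is_lift_unique ler01 l3 (hhP y Oy) o01.
rewrite !mulr1 !mulr0 !add0r !addr0 mul0r mul1r.
have -> : - 3^-1 + 1 = 2 / 3 :> R by field.
have -> : 3^-1 + 3^-1 = 2 / 3 :> R by field.
lra.
Qed.

(** Both [beta] and the linear function given by [w n] lift the segment from [x] to [y]. Only its
    starting point can lie on the boundary of the triangle, and that point is in [Omega] by
    hypothesis. *)
Lemma potential_affine (beta : plane -> R) n x y :
  (forall m x, (forall j, 0 < lam (V m) j x) -> Omega x) ->
  (forall x, Omega x -> \forall y \near x, step x y (beta y - beta x)) ->
  Omega x -> tri (V n) x -> (forall i, 0 < lam (V n) i y) ->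
  beta y - beta x = dot (w n) (y - x).
Proof.
move=> hint hb Ox nx_ ny.
pose sg t : plane := x + t *: (y - x).
have sgl t i : 0 <= t <= 1 -> 0 <= lam (V n) i (sg t).
  move=> /andP[t0 t1]; rewrite /sg lamD.
  have := triP x (hdet n) => /iffLR/(_ nx_ i); have := ny i.
  by move: (lam (V n) i x) (lam (V n) i y) => u v; nra.
have sgT t : 0 <= t <= 1 -> tri (V n) (sg t) by move=> t01; apply/triP => // i; exact: sgl.
have sgO t : 0 <= t <= 1 -> Omega (sg t).
  move=> /andP[t0 t1]; move: t0; rewrite le_eqVlt => /orP[/eqP <-|t0].
    by rewrite /sg scale0r addr0.
  apply: (hint n) => i; rewrite /sg lamD.
  have := triP x (hdet n) => /iffLR/(_ nx_ i); have := ny i.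
  by move: (lam (V n) i x) (lam (V n) i y) => u v; nra.
have csg : continuous sg.
  move=> s; apply: cvgD; first exact: cvg_cst.
  by apply: cvgZr_tmp; exact: cvg_id.
have l1 : is_lift (itvcc 0 1) sg (beta \o sg).
  move=> t Dt; have : nbhs t (sg @^-1` [set z | step (sg t) z (beta z - beta (sg t))]).
    by apply: csg; exact: hb (sgO t Dt).
  by apply: filterS => s ? _.
have l2 : is_lift (itvcc 0 1) sg (fun t => t * dot (w n) (y - x)).
  move=> t t01; apply: filterE => s s01; exists n; split; try exact: sgT.
  by rewrite /sg /dot /= /GRing.scale /=; ring.
have o01 : 0 <= (1 : R) <= 1 by rewrite lexx ler01.
have := is_lift_unique ler01 l1 l2 o01.
rewrite /= /sg scale0r addr0 mul0r mul1r scale1r (addrC x (y - x)) subrK.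
lra.
Qed.

End Lift.

(** * Smooth cutoffs *)

Section Cutoff.
Context {R : realType}.
Local Notation plane := (R * R)%type.
Local Notation mplane := (measurableTypeR R * measurableTypeR R)%type.
Local Notation mu := (@lebesgue2 R).

Lemma derive_off_closed (psi : plane -> R) (K : set plane) e x : closed K ->
  (forall y, ~ K y -> psi y = 0) -> ~ K x -> 'D_e psi x = 0.
Proof.
move=> cK hK Kx.
have h : \forall y \near x, cst 0 y = psi y.
  have : nbhs x (~` K) by apply: open_nbhs_nbhs; split => //; exact: closed_openC.
  by apply: filterS => y /hK ->.
by rewrite -(near_eq_derive _ h) derive_cst.
Qed.

Lemma box_closed M : closed (@box R M).
Proof. apply: compact_closed; [exact: norm_hausdorff|exact: box_compact]. Qed.

Lemma Ck_line_bound (psi : plane -> R) e C : e = e1 \/ e = e2 -> Ck 1 psi ->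
  (forall x, `|'D_e psi x| <= C) ->
  forall h x, 0 < h -> `|psi (h *: e + x) - psi x| <= C * h.
Proof.
move=> he hpsi hC h x h0.
pose f (t : R) := psi (t *: e + x).
have df (t : R) : is_derive t (1 : R) f ('D_e psi (t *: e + x)).
  have := is_derive_cvg (Ck_is_derive (t *: e + x) he hpsi) => hd.
  apply: cvg_is_derive; apply: cvg_trans hd; apply: near_eq_cvg; apply: nearW => s.
  by rewrite /f /= [s *: 1]mulr1 scalerDl addrA.
have cf : {within `[0, h], continuous f}.
  apply: continuous_subspaceT => t; apply: differentiable_continuous.
  by apply/derivable1_diffP; exact: ex_derive.
have [c _] := MVT h0 (fun t _ => df t) cf.
rewrite /f scale0r add0r subr0 => ->.
by rewrite normrM (gtr0_norm h0) ler_pM2r.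
Qed.

Lemma cvg_harmonic_derive (W : normedModType R) (psi : W -> R) e d x : is_derive x e psi d ->
  (harmonic n)^-1 * (psi (harmonic n *: e + x) - psi x) @[n --> \oo] --> d.
Proof.
move=> /is_derive_cvg hd.
have h0 : (harmonic n : R) @[n --> \oo] --> (0 : R)^'.
  move=> A hA; have : nbhs (0 : R) [set h | h != 0 -> A h] by [].
  move=> hA'; have : \forall n \near \oo, (harmonic n : R) != 0 -> A (harmonic n).
    exact: cvg_harmonic hA'.
  apply: filterS => n /=; apply.
  by rewrite /harmonic /= invr_eq0 pnatr_eq0.
exact: (cvg_comp _ _ h0 hd).
Qed.

Lemma integral_Ck_derivative0 (psi : plane -> R) e M : e = e1 \/ e = e2 -> Ck 1 psi ->
  (forall x, ~ box M x -> psi x = 0) -> \int[mu]_x ('D_e psi x) = 0.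
Proof.
move=> he hpsi hM.
have bpsi : bounded_supp psi.
  by split; [exact/loc_bounded_cont/(Ck_cont hpsi)|exists M].
have bD : bounded_supp (fun x => 'D_e psi x).
  split; first exact/loc_bounded_cont/(Ck_cont (Ck_derive he hpsi)).
  by exists M => x bx; apply: (derive_off_closed _ (@box_closed M)).
have [C [_ [_ _ hC _]]] := bounded_supp_bound bD.
apply: (@integral_derivative0 _ e psi _ C set0) => //.
- by move=> h x /andP[h0 _]; exact: (Ck_line_bound he hpsi).
- by move=> x _; apply: cvg_harmonic_derive; exact: (Ck_is_derive x he hpsi).
Qed.

Implicit Types (V : 'I_3 -> plane).

(** Spelled out as [flat 1] of an explicit affine function so that [smooth_flat] applies. It
    vanishes where [lam V i] is at most [1 / (k + 1)] and tends to [1] wherever [lam V i] is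
    positive. *)
Definition cutoff (k : nat) V (i : 'I_3) : plane -> R :=
  flat 1 \o affine (k.+1%:R * (gradlam V i).1) (k.+1%:R * (gradlam V i).2)
    (k.+1%:R * (((V (nx i)).1 * (V (nx (nx i))).2 - (V (nx i)).2 * (V (nx (nx i))).1) / det3 V) - 1).

Lemma cutoffE k V i x : cutoff k V i x = flat 1 (k.+1%:R * lam V i x - 1).
Proof. rewrite /cutoff /=; congr (flat 1 _); rewrite /lam /affine /gradlam /=.
by move: (k.+1%:R : R) => K; ring. Qed.

Lemma flat1_itv (t : R) : 0 <= flat 1 t <= 1.
Proof.
rewrite /flat; case: ifP => [t0|_]; last by rewrite lexx ler01.
by rewrite hornerC mul1r expR_ge0 expR_le1 oppr_le0 invr_ge0 ltW.
Qed.

Lemma flat1_gt0 (t : R) : 0 < t -> 0 < flat 1 t.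
Proof. by rewrite /flat => ->; rewrite hornerC mul1r expR_gt0. Qed.

(** Smooth, between [0] and [1], compactly supported in the open triangle and converging to its
    indicator: multiplying by it localises a test function to one triangle. *)
Definition bump (k : nat) V (x : plane) : R :=
  cutoff k V i0 x * (cutoff k V i1 x * cutoff k V i2 x).

Lemma smooth_bump k V : smooth (bump k V).
Proof. by do 2 (apply: smoothM; first exact: smooth_flat); exact: smooth_flat. Qed.

Lemma bump_itv k V x : 0 <= bump k V x <= 1.
Proof.
rewrite /bump !cutoffE.
have := flat1_itv (k.+1%:R * lam V i0 x - 1).
have := flat1_itv (k.+1%:R * lam V i1 x - 1).
have := flat1_itv (k.+1%:R * lam V i2 x - 1).
move: (flat _ _) (flat _ _) (flat _ _) => a b c /andP[? ?] /andP[? ?] /andP[? ?].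
by rewrite !mulr_ge0//= mulr_ile1 ?mulr_ge0 ?mulr_ile1.
Qed.

Lemma bump_eq0 k V x i : lam V i x < k.+1%:R^-1 -> bump k V x = 0.
Proof.
move=> li; suff : cutoff k V i x = 0.
  by rewrite /bump; move: i {li}; apply: I3_ind => ->; rewrite ?mul0r ?mulr0 ?mul0r ?mulr0.
by rewrite cutoffE flat_le0// subr_le0 mulrC -ler_pdivlMr// mul1r ltW.
Qed.

Lemma bump_cvg1 V x : (forall i, 0 < lam V i x) -> bump k V x @[k --> \oo] --> (1 : R).
Proof.
move=> hx.
suff h i : cutoff k V i x @[k --> \oo] --> (1 : R).
  by have := cvgM (h i0) (cvgM (h i1) (h i2)); rewrite !mulr1; exact.
have l0 := hx i.
have -> : (fun k => cutoff k V i x) = (fun k => flat 1 (k.+1%:R * lam V i x - 1)).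
  by apply/funext => k; rewrite cutoffE.
apply/cvgrPdist_le => /= e e0; near=> k.
set t := k.+1%:R * lam V i x - 1.
have t0 : e^-1 < t.
  rewrite /t ltrBrDr -ltr_pdivrMr//.
  apply: (@lt_trans _ _ k%:R); last by rewrite ltr_nat.
  by near: k; exact: nbhs_infty_gtr.
have tp : 0 < t by rewrite (lt_trans _ t0)// invr_gt0.
rewrite /flat tp hornerC mul1r ger0_norm; last first.
  by rewrite subr_ge0 expR_le1 oppr_le0 invr_ge0 ltW.
have := expR_ge1Dx (- t^-1).
have : t^-1 <= e by rewrite -[e]invrK lef_pV2 ?posrE ?invr_gt0// ltW.
lra.
Unshelve. all: by end_near. Qed.

Definition tri_int V : set plane := [set x | forall i, 0 < lam V i x].

Lemma tri_int_open V : open (tri_int V).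
Proof.
have -> : tri_int V = (lam V i0 @^-1` [set t | 0 < t]) `&` (lam V i1 @^-1` [set t | 0 < t]) `&`
    (lam V i2 @^-1` [set t | 0 < t]).
  apply/seteqP; split => [y hy|y [[? ?] ?]]; first by do !split; exact: hy.
  exact: I3_ind.
by apply: openI; [apply: openI|]; apply: open_comp => [y _|]; by [exact: lam_continuous|exact: open_gt].
Qed.

Lemma tri_int_measurable V : measurable (tri_int V : set mplane).
Proof. by apply: open_measurable_plane; exact: tri_int_open. Qed.

Lemma tri_bounded V : det3 V != 0 -> exists M, tri V `<=` box M.
Proof.
move=> D0; exists (`|(V i0).1| + `|(V i1).1| + `|(V i2).1| + `|(V i0).2| + `|(V i1).2| + `|(V i2).2|).
move=> x Tx.
have h i : 0 <= lam V i x <= 1 by rewrite lam_le1// andbT; move/triP : Tx; apply.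
have xe := comb_lam x D0; have xe1 := congr1 fst xe; have xe2 := congr1 snd xe.
have := h i0; have := h i1; have := h i2; rewrite /box /= xe1 xe2 /comb /=.
move: (lam V i0 x) (lam V i1 x) (lam V i2 x) => p q r /andP[? ?] /andP[? ?] /andP[? ?].
have key (u v w a b c : R) : 0 <= a -> 0 <= b -> 0 <= c ->
    `|p * u + q * v + r * w| <= `|u| + `|v| + `|w| + a + b + c.
  move=> a0 b0 c0; have : `|p * u + q * v + r * w| <= `|u| + `|v| + `|w|.
    rewrite (le_trans (ler_normD _ _))// lerD//; last by rewrite normrM ger0_norm// ler_piMl.
    by rewrite (le_trans (ler_normD _ _))// lerD// normrM ger0_norm// ler_piMl.
  lra.
split; first exact: key.
rewrite -!addrA; rewrite [leRHS](_ : _ = `|(V i0).2| + `|(V i1).2| + `|(V i2).2| +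
  `|(V i0).1| + `|(V i1).1| + `|(V i2).1|); last by ring.
by rewrite addrA; exact: key.
Qed.

Lemma bump_cvg V x : det3 V != 0 -> bump k V x @[k --> \oo] --> (\1_(tri_int V) x : R).
Proof.
move=> D0; rewrite indicE; case: (boolP (x \in tri_int V)) => [/set_mem|/negP] hx.
  exact: bump_cvg1.
have [i li] : exists i, lam V i x <= 0.
  apply: contrapT => /forallNP h; apply: hx; apply/mem_set => i.
  by rewrite ltNge; apply/negP/h.
have -> : (fun k => bump k V x) = (fun=> 0).
  by apply/funext => k; apply: (@bump_eq0 _ _ _ i); rewrite (le_lt_trans li)// invr_gt0.
exact: cvg_cst.
Qed.

Definition bump_supp (k : nat) V : set plane := [set x | forall i, k.+1%:R^-1 <= lam V i x].

Lemma bump_supp_closed k V : closed (bump_supp k V).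
Proof.
have cl i : closed (lam V i @^-1` [set t | k.+1%:R^-1 <= t]).
  by apply: closed_comp => [y _|]; [exact: lam_continuous|exact: closed_ge].
have -> : bump_supp k V = (lam V i0 @^-1` [set t | k.+1%:R^-1 <= t]) `&`
    (lam V i1 @^-1` [set t | k.+1%:R^-1 <= t]) `&` (lam V i2 @^-1` [set t | k.+1%:R^-1 <= t]).
  apply/seteqP; split => [y hy|y [[? ?] ?]]; first by do !split; exact: hy.
  exact: I3_ind.
by apply: closedI => //; apply: closedI.
Qed.

Lemma bump_off k V x : ~ bump_supp k V x -> bump k V x = 0.
Proof.
by move=> /existsNP[i /negP]; rewrite -ltNge; exact: bump_eq0.
Qed.

Lemma bump_supp_int k V : bump_supp k V `<=` tri_int V.
Proof. by move=> x h i; apply: lt_le_trans (h i); rewrite invr_gt0. Qed.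

Lemma tri_int_sub V : det3 V != 0 -> tri_int V `<=` tri V.
Proof. by move=> D0 x h; apply/triP => // i; exact/ltW. Qed.

Lemma bump_supp_compact k V : det3 V != 0 -> compact (bump_supp k V).
Proof.
move=> D0; have [M hM] := tri_bounded D0.
apply: (@subclosed_compact _ (bump_supp k V) (box M)).
- exact: bump_supp_closed.
- exact: box_compact.
by move=> x /bump_supp_int/(tri_int_sub D0)/hM.
Qed.

Lemma bump_test (Omega : set plane) k V (phi : plane -> R) : det3 V != 0 ->
  tri_int V `<=` Omega -> (forall j, Ck j phi) ->
  test_function Omega (fun x => bump k V x * phi x).
Proof.
move=> D0 VO hphi; split => [j|].
  by apply: CkM => //; case: (smooth_bump k V).
exists (bump_supp k V); split; first exact: bump_supp_compact.
  by move=> x /bump_supp_int/VO.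
by move=> x /bump_off ->; rewrite mul0r.
Qed.

End Cutoff.

(** * Integration over triangles *)

Section TriangleIntegral.
Context {R : realType}.
Local Notation plane := (R * R)%type.
Local Notation mplane := (measurableTypeR R * measurableTypeR R)%type.
Local Notation mu := (@lebesgue2 R).
Implicit Types (V : 'I_3 -> plane) (i j : 'I_3).

(** Sends [(1, 0)], [(0, 1)] and [0] to the vertices [i], [nx i] and [nx (nx i)]. Varying [i] makes
    each barycentric coordinate the first coordinate of some chart. *)
Definition chart V i (p : plane) : plane :=
  let c := V (nx (nx i)) in
  (c.1 + p.1 * (V i - c).1 + p.2 * (V (nx i) - c).1,
   c.2 + p.1 * (V i - c).2 + p.2 * (V (nx i) - c).2).

Lemma chart_det V i : let c := V (nx (nx i)) in
  (V i - c).1 * (V (nx i) - c).2 - (V i - c).2 * (V (nx i) - c).1 = det3 V.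
Proof. by rewrite /det3; move: i; apply: I3_ind => /=; ring. Qed.

Lemma integral_chart V i (F : plane -> R) : det3 V != 0 -> bounded_supp F ->
  \int[mu]_x F x = `|det3 V| * \int[mu]_p F (chart V i p).
Proof.
move=> D0 hF.
have := @scales_measure_linear R (V (nx (nx i))) (V i - V (nx (nx i))) (V (nx i) - V (nx (nx i))).
rewrite /= chart_det => /(_ D0) hs.
by rewrite (integral_plane_scales hs hF) mulrA divff ?mul1r// normr_eq0.
Qed.

Lemma lam_chart V i p : det3 V != 0 ->
  [/\ lam V i (chart V i p) = p.1, lam V (nx i) (chart V i p) = p.2 &
      lam V (nx (nx i)) (chart V i p) = 1 - p.1 - p.2].
Proof.
rewrite /det3 => D0; rewrite /lam /affine /gradlam /chart /det3 /=.
by move: i; apply: I3_ind => /=; split; field.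
Qed.

Definition ref_int : set plane := [set p | [/\ 0 < p.1, 0 < p.2 & p.1 + p.2 < 1]].

Lemma tri_int_chart V i p : det3 V != 0 -> tri_int V (chart V i p) <-> ref_int p.
Proof.
move=> D0; have [h0 h1 h2] := lam_chart i p D0; split.
  by move=> h; split; [rewrite -h0|rewrite -h1|have := h (nx (nx i)); rewrite h2; lra].
move=> [p1 p2 p3] j; have [->|ji] := eqVneq j i; first by rewrite h0.
by case: (nx_cases ji) => ->; [rewrite h1|rewrite h2; lra].
Qed.

Lemma indic_chart V i p : det3 V != 0 -> \1_(tri_int V) (chart V i p) = \1_ref_int p :> R.
Proof.
move=> D0; rewrite !indicE; congr (nat_of_bool _)%:R.
by apply/idP/idP => /set_mem h; apply/mem_set; apply/(tri_int_chart i p D0).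
Qed.

Lemma bounded_supp_tri_int V : det3 V != 0 -> bounded_supp (\1_(tri_int V)).
Proof.
move=> D0; have [M hM] := tri_bounded D0.
apply: (@bounded_supp_indic R _ M); first exact: tri_int_measurable.
by move=> x /(tri_int_sub D0)/hM.
Qed.

(** Kept as a symbol: it enters as a common factor, through its sign alone. *)
Definition ref_area : R := \int[mu]_p (\1_ref_int p).
Definition area V : R := `|det3 V| * ref_area.

(** The open square with both coordinates between [1 / 4] and [1 / 3] lies inside and has positive
    measure. *)
Lemma ref_area_gt0 : 0 < ref_area.
Proof.
pose B : set mplane := `]4^-1, 3^-1[ `*` `]4^-1, 3^-1[.
have mB : measurable B by exact: measurableX.
have BM : B `<=` @box R 1.
  move=> [x y] [] /=; rewrite !in_itv /= => /andP[? ?] /andP[? ?].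
  by split; rewrite /= ger0_norm; lra.
pose V0 : 'I_3 -> plane := vfun (1, 0) (0, 1) (0, 0).
have D0 : det3 V0 != 0 by rewrite /det3 /V0 /vfun /=; apply/eqP; lra.
have c0 p : chart V0 i0 p = p.
  by rewrite /chart /V0 /vfun /=; case: p => x y /=; congr pair; ring.
have mref : measurable (ref_int : set mplane).
  have -> : ref_int = tri_int V0.
    by apply/seteqP; split => p; have := tri_int_chart i0 p D0; rewrite c0 => -[].
  exact: tri_int_measurable.
have bref : bounded_supp (\1_ref_int : plane -> R).
  apply: (@bounded_supp_indic R _ 1) => // p [p1 p2 p3].
  by split; rewrite ger0_norm; lra.
apply: (@lt_le_trans _ _ (\int[mu]_p (\1_B p))); last first.
  apply: le_Rintegral => //.
  - by apply: bounded_supp_integrable => //; exact: bounded_supp_indic BM.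
  - exact: bounded_supp_integrable.
  move=> p _; rewrite !indicE; case: (boolP (p \in B)) => // /set_mem [].
  case: p => x y; rewrite /= !in_itv /= => /andP[? ?] /andP[? ?].
  by rewrite mem_set// /ref_int /=; split; lra.
rewrite /Rintegral integral_indic// setIT.
rewrite [X in fine X](product_measure1E lebesgue_measure lebesgue_measure)//.
have m34 : lebesgue_measure (`]4^-1, 3^-1[%classic : set (measurableTypeR R)) = (3^-1 - 4^-1)%:E.
  apply: etrans (lebesgue_measure_itv `]4^-1, 3^-1[) _; rewrite /= lte_fin.
  by have -> : (4^-1 < 3^-1 :> R) by lra.
rewrite [X in fine X](_ : _ = ((3^-1 - 4^-1) * (3^-1 - 4^-1))%:E).
  by rewrite /=; apply: mulr_gt0; lra.
by rewrite EFinM; congr (_ * _)%E; exact: m34.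
Qed.

Lemma area_gt0 V : det3 V != 0 -> 0 < area V.
Proof. by move=> D0; rewrite mulr_gt0 ?normr_gt0// ref_area_gt0. Qed.

Lemma integral_tri_int V : det3 V != 0 -> \int[mu]_x (\1_(tri_int V) x) = area V.
Proof.
move=> D0; rewrite (integral_chart i0 D0); last exact: bounded_supp_tri_int.
by congr (_ * _); apply: eq_Rintegral => p _; rewrite indic_chart.
Qed.

Lemma loc_bounded_affine a b c : loc_bounded (@affine R a b c).
Proof. by apply: loc_bounded_cont; exact: continuous_affine. Qed.

(** The charts give the three coordinates equal integrals, and the coordinates sum to [1]. *)
Lemma integral_lam V i : det3 V != 0 ->
  \int[mu]_x (lam V i x * \1_(tri_int V) x) = area V / 3.
Proof.
move=> D0.
have bF j : bounded_supp (fun x => lam V j x * \1_(tri_int V) x).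
  by apply: bounded_suppMl; [exact: loc_bounded_affine|exact: bounded_supp_tri_int].
have E j : \int[mu]_x (lam V j x * \1_(tri_int V) x) = `|det3 V| * \int[mu]_p (p.1 * \1_ref_int p).
  rewrite (integral_chart j D0)//; congr (_ * _); apply: eq_Rintegral => p _.
  by rewrite indic_chart//; have [-> _ _] := lam_chart j p D0.
have : area V = \int[mu]_x (lam V i0 x * \1_(tri_int V) x) +
   \int[mu]_x (lam V i1 x * \1_(tri_int V) x) + \int[mu]_x (lam V i2 x * \1_(tri_int V) x).
  rewrite -integral_tri_int// -integral_planeD// -integral_planeD//; last exact: bounded_suppD.
  by apply: eq_Rintegral => x _; rewrite -!mulrDl lam_sum// mul1r.
by rewrite !E => ->; field.
Qed.

Lemma lam_zero_measurable V i : measurable ([set x | lam V i x = 0] : set mplane).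
Proof.
rewrite (_ : [set x | _] = ~` (lam V i @^-1` [set t | t != 0])).
  apply: measurableC; apply: open_measurable_plane.
  by apply: open_comp => [y _|]; [exact: lam_continuous|exact: open_neq].
apply/seteqP; split => x /=; first by move=> ->; rewrite eqxx.
by move/negP; rewrite negbK => /eqP.
Qed.

(** In a suitable chart the line becomes the vertical axis, a product with a null factor. *)
Lemma lam_null V i : det3 V != 0 -> mu [set x | lam V i x = 0] = 0%E.
Proof.
move=> D0.
have := @scales_measure_linear R (V (nx (nx i))) (V i - V (nx (nx i))) (V (nx i) - V (nx (nx i))).
rewrite /= chart_det => /(_ D0) [_ k0 hs].
have mN := lam_zero_measurable V i.
have := hs _ mN; set A := (X in mu X = _); have -> : A = [set 0] `*` setT.
  apply/seteqP; split => p; rewrite /A /=; have [h _ _] := lam_chart i p D0.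
    by move=> e; split => //; exact: etrans (esym h) e.
  by move=> [e _]; exact: etrans h e.
rewrite [LHS]product_measure1E// [X in (X * _)%E](lebesgue_measure_set1 0) mul0e => /esym/eqP.
by rewrite mule_eq0 eqe (gt_eqF k0)/= => /eqP.
Qed.

End TriangleIntegral.

(** * Splitting integrals over the domain into integrals over triangles *)

Section MeshIntegral.
Context {R : realType}.
Local Notation plane := (R * R)%type.
Local Notation mplane := (measurableTypeR R * measurableTypeR R)%type.
Local Notation mu := (@lebesgue2 R).
Context {N : nat} (V : 'I_N -> 'I_3 -> plane) (Omega : set plane).
Implicit Types (m n : 'I_N) (i j : 'I_3) (x y : plane).
Hypothesis hdet : forall n, det3 (V n) != 0.
Hypothesis hdisj : forall m n x, tri_int (V m) x -> tri (V n) x -> m = n.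
Hypothesis oO : open Omega.
Hypothesis hint : forall n, tri_int (V n) `<=` Omega.
Hypothesis hcover : forall x, Omega x -> exists n, tri (V n) x.

(** The full lines carrying the edges: a null set off which every point of [Omega] lies in an open
    triangle. *)
Definition skeleton : set plane := \bigcup_(p : 'I_N * 'I_3) [set x | lam (V p.1) p.2 x = 0].

Lemma skeleton_measurable : measurable (skeleton : set mplane).
Proof.
rewrite /skeleton bigcup_mkcond; apply: countable_bigcupT_measurable => // p.
by case: ifPn => // _; exact: lam_zero_measurable.
Qed.

Lemma skeleton_null : mu skeleton = 0%E.
Proof.
pose F k : set mplane := if @unpickle ('I_N * 'I_3)%type k is Some p
  then [set x | lam (V p.1) p.2 x = 0] else set0.
have -> : skeleton = \bigcup_k F k.
  apply/seteqP; split => [x [p _ px]|x [k _]].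
    by exists (pickle p) => //; rewrite /F pickleK.
  by rewrite /F; case: unpickle => // p px; exists p.
have mF k : measurable (F k).
  by rewrite /F; case: unpickle => // p; exact: lam_zero_measurable.
apply/negligibleP; first exact: bigcupT_measurable.
apply: negligible_bigcup => k; apply/negligibleP => //.
by rewrite /F; case: unpickle => [p|]; [exact: lam_null|exact: measure0].
Qed.

Lemma cover_off_skeleton x : Omega x -> ~ skeleton x -> exists n, tri_int (V n) x.
Proof.
move=> /hcover[n Tn] nS; exists n => i; move/triP : Tn => /(_ (hdet n) i).
rewrite le_eqVlt => /orP[/eqP e|//]; exfalso; apply: nS.
by exists (n, i).
Qed.

Lemma indic_tri_int n x : tri_int (V n) x ->
  forall m, \1_(tri_int (V m)) x = (m == n)%:R :> R.
Proof.
move=> h m; rewrite indicE; congr (nat_of_bool _)%:R; apply/idP/idP.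
  move=> /set_mem hm; apply/eqP; apply: (hdisj hm).
  exact: tri_int_sub.
by move=> /eqP ->; exact: mem_set.
Qed.

Lemma sum_indic (F : 'I_N -> R) n x : tri_int (V n) x ->
  \sum_m F m * \1_(tri_int (V m)) x = F n.
Proof.
move=> h; rewrite (bigD1 n)//= (indic_tri_int h) eqxx mulr1 big1 ?addr0// => m mn.
by rewrite (indic_tri_int h) (negPf mn) mulr0.
Qed.

Lemma sum_indic_off (F : 'I_N -> R) x : ~ Omega x ->
  \sum_m F m * \1_(tri_int (V m)) x = 0.
Proof.
move=> h; rewrite big1 // => m _; rewrite indicE memNset ?mulr0//.
by move=> /hint.
Qed.

Lemma Omega_measurable : measurable (Omega : set mplane).
Proof. exact: open_measurable_plane. Qed.

Lemma integrable_sum_Omega (F : 'I_N -> plane -> R) :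
  (forall n, mu.-integrable (Omega : set mplane) (EFin \o F n)) ->
  mu.-integrable (Omega : set mplane) (EFin \o (fun x => \sum_n F n x)) /\
  \int[mu]_(x in Omega) (\sum_n F n x) = \sum_n \int[mu]_(x in Omega) F n x.
Proof.
move=> hF; elim: (index_enum _) => [|n s [ih1 ih2]].
  have -> : (fun x => \sum_(n <- [::]) F n x) = (fun=> 0) by apply/funext => x; rewrite big_nil.
  rewrite big_nil; split.
    exact: integrable0.
  by rewrite Rintegral_cst ?mul0r//; exact: Omega_measurable.
have E : (fun x => \sum_(m <- n :: s) F m x) = (fun x => F n x + \sum_(m <- s) F m x).
  by apply/funext => x; rewrite big_cons.
rewrite E big_cons -ih2 -RintegralD//; last exact: Omega_measurable.
split => //; have := integrableD Omega_measurable (hF n) ih1.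
by apply: eq_integrable; [exact: Omega_measurable|move=> x _; rewrite /= EFinD].
Qed.

(* Only the values inside the triangles matter, the skeleton being null *)
Lemma integral_mesh (W : plane -> R) (F : 'I_N -> plane -> R) :
  measurable_fun (Omega : set mplane) (W : mplane -> R) ->
  (forall n x, tri_int (V n) x -> W x = F n x) ->
  (forall n, mu.-integrable (Omega : set mplane) (EFin \o (fun x => F n x * \1_(tri_int (V n)) x))) ->
  mu.-integrable (Omega : set mplane) (EFin \o W) /\
  \int[mu]_(x in Omega) W x = \sum_n \int[mu]_(x in Omega) (F n x * \1_(tri_int (V n)) x).
Proof.
move=> mW WF iF; have [iS <-] := integrable_sum_Omega iF.
have eq x : Omega x -> ~ skeleton x -> W x = \sum_n F n x * \1_(tri_int (V n)) x.
  move=> Ox /(cover_off_skeleton Ox)[n nx_].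
  by rewrite (sum_indic (F ^~ x) nx_) (WF n).
have mS : measurable_fun (Omega : set mplane) (fun x => \sum_n F n x * \1_(tri_int (V n)) x).
  by apply/measurable_EFinP; case/integrableP : iS.
split; last first.
  apply: (Rintegral_ae_eq Omega_measurable skeleton_measurable skeleton_null) => //.
apply/integrableP; split; first exact/measurable_EFinP.
case/integrableP : iS => _; congr (_ < _)%E; apply: ae_eq_integral.
- exact: Omega_measurable.
- by do 2 apply: measurableT_comp => //; exact/measurable_EFinP.
- by do 2 apply: measurableT_comp => //; exact/measurable_EFinP.
exists skeleton; split; [exact: skeleton_measurable|exact: skeleton_null|].
move=> x /= /not_implyP[Ox h]; apply: contrapT => /(eq x Ox) e; apply: h.
by rewrite e.
Qed.

Lemma integral_plane_Omega (F : plane -> R) : (forall x, ~ Omega x -> F x = 0) ->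
  \int[mu]_(x in Omega) F x = \int[mu]_x F x.
Proof.
move=> h; rewrite Rintegral_mkcond; apply: eq_Rintegral => x _; rewrite patchE.
by case: ifPn => // /negP nO; rewrite h// => Ox; apply: nO; exact: mem_set.
Qed.

Lemma integral_mesh_bounded (W : plane -> R) (F : 'I_N -> plane -> R) :
  measurable_fun (Omega : set mplane) (W : mplane -> R) ->
  (forall n x, tri_int (V n) x -> W x = F n x) ->
  (forall n, loc_bounded (F n)) ->
  mu.-integrable (Omega : set mplane) (EFin \o W) /\
  \int[mu]_(x in Omega) W x = \sum_n \int[mu]_x (F n x * \1_(tri_int (V n)) x).
Proof.
move=> mW WF bF; have [|iW ->] := integral_mesh mW WF.
  move=> n; apply: bounded_supp_integrable; last exact: Omega_measurable.
  by apply: bounded_suppMl => //; exact: bounded_supp_tri_int.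
split => //; apply: eq_bigr => n _; apply: integral_plane_Omega => x nO.
by rewrite indicE memNset ?mulr0// => /hint.
Qed.

End MeshIntegral.

(** * Continuity of fluxes across edges *)

Section Profile.
Context {R : realType}.
Local Notation plane := (R * R)%type.
Local Notation mplane := (measurableTypeR R * measurableTypeR R)%type.
Local Notation mu := (@lebesgue2 R).
Implicit Types (V : 'I_3 -> plane) (i j k l : 'I_3) (F G H : R -> R).

(** One-variable factors of the products [F (lam V k x) * H (lam V i x)]. Asking for measurability
    instead of continuity admits the jump of [side]. *)
Definition profile F := measurable_fun setT F /\
  exists C M : R, forall t, `|F t| <= C /\ (M < `|t| -> F t = 0).

Lemma profile_cont F M : continuous F -> (forall t, M < `|t| -> F t = 0) -> profile F.
Proof.
move=> cF hM; split; first exact: continuous_measurable_fun.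
have [|C [_ /(_ (C + 1)) h]] := @compact_bounded _ _ (F @` `[- M, M]).
  apply: continuous_compact; [exact: continuous_subspaceT|exact: segment_compact].
exists `|C + 1|, M => t; split; last exact: hM.
have [tM|tM] := leP `|t| M; last by rewrite hM// normr0.
apply: le_trans (ler_norm _); apply: h; first by rewrite ltrDl.
by exists t => //; rewrite /= in_itv /= -ler_norml.
Qed.

Lemma profileM F G : measurable_fun setT G -> (exists C : R, forall t, `|G t| <= C) ->
  profile F -> profile (fun t => G t * F t).
Proof.
move=> mG [C' hC'] [mF [C [M h]]]; split; first exact: measurable_funM.
exists (C' * C), M => t; have [h1 h2] := h t; split.
  by rewrite normrM ler_pM.
by move=> /h2 ->; rewrite mulr0.
Qed.

Lemma profile_poly F (a b : R) : profile F -> profile (fun t => (a + b * t) * F t).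
Proof.
move=> [mF [C [M h]]]; split.
  apply: measurable_funM => //; apply: measurable_funD => //; exact: measurable_funM.
exists ((`|a| + `|b| * `|M|) * `|C|), M => t; have [h1 h2] := h t; split; last first.
  by move=> /h2 ->; rewrite mulr0.
have [tM|/h2 ->] := leP `|t| M; last first.
  by rewrite mulr0 normr0 mulr_ge0// addr_ge0// mulr_ge0.
rewrite normrM ler_pM//; last exact: le_trans h1 (ler_norm _).
rewrite (le_trans (ler_normD _ _))// lerD// normrM ler_wpM2l//.
exact: le_trans tM (ler_norm _).
Qed.

Lemma profileD F G : profile F -> profile G -> profile (fun t => F t + G t).
Proof.
move=> [mF [C [M hF]]] [mG [C' [M' hG]]]; split; first exact: measurable_funD.
exists (C + C'), (Num.max M M') => t; split.
  by rewrite (le_trans (ler_normD _ _))// lerD ?(hF t).1 ?(hG t).1.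
by rewrite gt_max => /andP[h1 h2]; rewrite (hF t).2// (hG t).2// addr0.
Qed.

Lemma lam_shift V i (a b x : plane) (h : R) :
  lam V i (h *: (a - b) + x) = lam V i x + h * (lam V i a - lam V i b).
Proof. by rewrite /lam /affine /= /GRing.scale /=; ring. Qed.

Lemma sum3_distinct (F : 'I_3 -> R) i k l : i != k -> l != i -> l != k ->
  F i0 + F i1 + F i2 = F i + F k + F l.
Proof.
rewrite eq_sym => ki li lk; rewrite (sum3_nx F i).
case: (nx_cases ki) (nx_cases li) lk => -> [] ->; rewrite ?eqxx//.
by move=> _; rewrite addrAC.
Qed.

(** Two barycentric coordinates determine the third, and interpolation then bounds every affine
    function, in particular both Cartesian coordinates. *)
Lemma lam_box V i k (M : R) : det3 V != 0 -> i != k -> exists M' : R,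
  forall x, `|lam V i x| <= M -> `|lam V k x| <= M -> box M' x.
Proof.
move=> D0 ik; have [l li lk] := third_index i k.
(* [1 + 2 * M] bounds the third coordinate, hence all three. *)
pose S (f : plane -> R) := (1 + 2 * M) * (`|f (V i)| + `|f (V k)| + `|f (V l)|).
have key (a b c : R) x : `|lam V i x| <= M -> `|lam V k x| <= M ->
    `|affine a b c x| <= S (affine a b c).
  move=> h1 h2; rewrite (affine_lam a b c x D0).
  rewrite (sum3_distinct (fun j => lam V j x * affine a b c (V j)) ik li lk) /S.
  have h3 : `|lam V l x| <= 1 + 2 * M.
    rewrite (_ : lam V l x = 1 - lam V i x - lam V k x); last first.
      by have := lam_sum x D0; rewrite (sum3_distinct (lam V ^~ x) ik li lk); lra.
    have := ler_normB (1 - lam V i x) (lam V k x); have := ler_normB 1 (lam V i x).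
    rewrite normr1; lra.
  have M0 : 0 <= M by apply: le_trans h1.
  rewrite 2![in leRHS]mulrDr; apply: le_trans (ler_normD _ _) _; apply: lerD; last first.
    by rewrite normrM ler_wpM2r.
  by apply: le_trans (ler_normD _ _) _; apply: lerD; rewrite normrM ler_wpM2r//; lra.
exists (Num.max (S (affine 1 0 0)) (S (affine 0 1 0))) => x h1 h2; split.
  by have := key 1 0 0 x h1 h2; rewrite le_max {1}/affine mul1r mul0r !addr0 => ->.
by have := key 0 1 0 x h1 h2; rewrite le_max {1}/affine mul1r mul0r add0r addr0 => ->; rewrite orbT.
Qed.

Lemma lam_measurable V i : measurable_fun setT (lam V i : mplane -> R).
Proof. by apply: continuous_measurable_plane; exact: lam_continuous. Qed.

Lemma bounded_supp_profile V i k F H : det3 V != 0 -> i != k -> profile F -> profile H ->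
  bounded_supp (fun x => F (lam V k x) * H (lam V i x)).
Proof.
move=> D0 ik [mF [C [M hF]]] [mH [C' [M' hH]]].
split; first split.
- apply: measurable_funM; apply: measurableT_comp => //; exact: lam_measurable.
- by exists (C * C') => x _; rewrite normrM ler_pM//; [case: (hF (lam V k x))|case: (hH (lam V i x))].
have [B hB] := lam_box (Num.max M M') D0 ik.
exists B => x bx.
have [h1|h1] := leP `|lam V k x| M; last by rewrite (hF _).2// mul0r.
have [h2|h2] := leP `|lam V i x| M'; last by rewrite (hH _).2// mulr0.
exfalso; apply: bx; apply: hB; rewrite le_max ?h1 ?h2 ?orbT//.
Qed.

(** In the direction [V k - V l] the coordinate [lam V k] grows at unit speed while [lam V i] stays
    fixed, so the integrand is a directional derivative. A kink of [F] at [0] is harmless, since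
    [lam V k] vanishes only on a null set. *)
Lemma integral_profile_derive0 V i k F F' H (C : R) : det3 V != 0 -> i != k ->
  profile F -> profile F' -> profile H ->
  (forall s t, `|F s - F t| <= C * `|s - t|) ->
  (forall t, t != 0 -> is_derive t (1 : R) F (F' t)) ->
  \int[mu]_x (F' (lam V k x) * H (lam V i x)) = 0.
Proof.
move=> D0 ik pF pF' pH lip dF; have [l li lk] := third_index i k.
have [_ [B [B' hB]]] := pH.
have B0 : 0 <= B by apply: le_trans (hB 0).1.
have sk (h : R) x : lam V k (h *: (V k - V l) + x) = h + lam V k x.
  by rewrite lam_shift !lam_vertex// eqxx eq_sym (negPf lk) subr0 mulr1 addrC.
have si (h : R) x : lam V i (h *: (V k - V l) + x) = lam V i x.
  by rewrite lam_shift !lam_vertex// (negPf ik) eq_sym (negPf li) subr0 mulr0 addr0.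
apply: (@integral_derivative0 _ (V k - V l) (fun x => F (lam V k x) * H (lam V i x)) _ (C * B)
  [set x | lam V k x = 0]).
- exact: bounded_supp_profile.
- exact: bounded_supp_profile.
- exact: lam_zero_measurable.
- exact: lam_null.
- move=> h x /andP[h0 _]; rewrite sk si -mulrBl normrM.
  have := lip (h + lam V k x) (lam V k x); rewrite addrK (gtr0_norm h0) => h1.
  by rewrite mulrAC ler_pM// (hB _).1.
- move=> x /eqP nx0.
  have := is_derive_mul (dF _ nx0) (is_derive_cst (H (lam V i x)) (lam V k x) 1).
  move=> /cvg_harmonic_derive; rewrite mulr0 addr0.
  by apply: cvg_trans; apply: near_eq_cvg; apply: nearW => n; rewrite sk si /= [_ *: 1]mulr1.
Qed.

End Profile.

(** * Bumps around an edge and the flux through it *)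

Section Tent.
Context {R : realType}.
Local Notation plane := (R * R)%type.
Local Notation mplane := (measurableTypeR R * measurableTypeR R)%type.
Local Notation mu := (@lebesgue2 R).
Implicit Types (V : 'I_3 -> plane) (i j k l : 'I_3) (a b s t : R).

Lemma derive_bounded_lipschitz (F F' : R -> R) (C : R) :
  (forall t : R, is_derive t (1 : R) F (F' t)) -> (forall t, `|F' t| <= C) ->
  forall s t, `|F s - F t| <= C * `|s - t|.
Proof.
move=> dF hC.
have cF (t : R) : {for t, continuous F}.
  by apply: differentiable_continuous; apply/derivable1_diffP; exact: ex_derive.
have h s t : s < t -> `|F t - F s| <= C * `|t - s|.
  move=> st; have cs : {within `[s, t], continuous F} by exact: continuous_subspaceT.
  have [c _ ->] := MVT st (fun t _ => dF t) cs.
  by rewrite normrM ler_wpM2r.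
move=> s t; have [st|st|->] := ltgtP s t; last by rewrite !subrr normr0 mulr0.
  by rewrite distrC (distrC s); exact: h.
exact: h.
Qed.

Lemma is_derive_eq1 (F : R -> R) (t d d' : R) : is_derive t (1 : R) F d -> d = d' ->
  is_derive t (1 : R) F d'.
Proof. by move=> h <-. Qed.

Definition dflat : {poly R} := 'X^2 * (1 - 1^`()).
Definition tent a b t : R := flat 1 (t - a) * flat 1 (b - t).
Definition dtent a b t : R :=
  flat dflat (t - a) * flat 1 (b - t) - flat 1 (t - a) * flat dflat (b - t).

Lemma is_derive_tent a b t : is_derive t (1 : R) (tent a b) (dtent a b t).
Proof.
have h1 : is_derive t (1 : R) (fun u : R => u - a) 1.
  by apply: is_derive_eq1 (is_deriveB (is_derive_id t 1) (is_derive_cst a t 1)) _; rewrite subr0.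
have h2 : is_derive t (1 : R) (fun u : R => b - u) (- 1).
  by apply: is_derive_eq1 (is_deriveB (is_derive_cst b t 1) (is_derive_id t 1)) _; rewrite sub0r.
have := is_derive_mul (@is_derive1_comp _ (flat 1) (fun u => u - a) t _ _ (is_derive_flat 1 (t - a)) h1)
  (@is_derive1_comp _ (flat 1) (fun u => b - u) t _ _ (is_derive_flat 1 (b - t)) h2).
by move=> /is_derive_eq1; apply; rewrite mulr1 mulrN1 mulrN.
Qed.

Lemma tent_out a b t : t <= a \/ b <= t -> tent a b t = 0 /\ dtent a b t = 0.
Proof.
rewrite /tent /dtent => -[h|h].
  by rewrite !(flat_le0 _ (t := t - a)) ?subr_le0// !mul0r subr0.
by rewrite !(flat_le0 _ (t := b - t)) ?subr_le0// !mulr0 subr0.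
Qed.

Lemma tent_ge0 a b t : 0 <= tent a b t.
Proof. by rewrite mulr_ge0//; [case/andP: (flat1_itv (t - a))|case/andP: (flat1_itv (b - t))]. Qed.

Lemma tent_gt0 a b t : a < t -> t < b -> 0 < tent a b t.
Proof. by move=> h1 h2; rewrite mulr_gt0// flat1_gt0// subr_gt0. Qed.

(** The derivative of [flat 1] at [u > 0] is [flat 1 u / u ^ 2], so the sign is that of
    [(t + e) ^ -2 - (e - t) ^ -2]. *)
Lemma dtent_lt0 (e t : R) : 0 < t -> t < e -> dtent (- e) e t < 0.
Proof.
move=> t0 te; have h1 : 0 < t - - e by lra.
have h2 : 0 < e - t by lra.
have hd (u : R) : 0 < u -> flat dflat u = flat 1 u * u^-1 ^+ 2.
  move=> u0; rewrite /flat u0 /dflat !hornerE /= -polyC1 derivC !hornerE; ring.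
rewrite /dtent !hd//.
rewrite (_ : _ - _ = flat 1 (t - - e) * flat 1 (e - t) * ((t - - e)^-1 ^+ 2 - (e - t)^-1 ^+ 2)); last by ring.
rewrite pmulr_rlt0; last by rewrite mulr_gt0// flat1_gt0.
by rewrite subr_lt0 ltr_pXn2r ?nnegrE ?invr_ge0 ?ltW// ltf_pV2 ?posrE//; lra.
Qed.

Lemma dtent_le0 (e t : R) : 0 < t -> dtent (- e) e t <= 0.
Proof.
move=> t0; have [h|h] := ltP t e; first exact/ltW/dtent_lt0.
by rewrite (tent_out _).2//; right.
Qed.

Lemma tent_profile a b : profile (tent a b) /\ profile (dtent a b).
Proof.
have cc (P : {poly R}) : continuous (fun t => flat P (t - a)) /\ continuous (fun t => flat P (b - t)).
  split=> t.
    apply: (continuous_comp (f := fun u : R => u - a) (g := flat P)); last exact: continuous_flat.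
    by apply: cvgB; [exact: cvg_id|exact: cvg_cst].
  apply: (continuous_comp (f := fun u : R => b - u) (g := flat P)); last exact: continuous_flat.
  by apply: cvgB; [exact: cvg_cst|exact: cvg_id].
have out t : Num.max `|a| `|b| < `|t| -> tent a b t = 0 /\ dtent a b t = 0.
  rewrite gt_max => /andP[h1 h2]; apply: tent_out; have [t0|t0] := leP 0 t.
    by right; rewrite (le_trans (ler_norm b))// ltW// -(ger0_norm t0).
  left; have := ler_norm (- a); rewrite normrN; rewrite (ltr0_norm t0) in h1; lra.
split; apply: (@profile_cont _ _ (Num.max `|a| `|b|)).
- by move=> t; apply: cvgM; [exact: (cc 1).1|exact: (cc 1).2].
- by move=> t /out[].
- move=> t; apply: cvgB; apply: cvgM;
  by [exact: (cc 1).1|exact: (cc 1).2|exact: (cc dflat).1|exact: (cc dflat).2].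
- by move=> t /out[].
Qed.

(** The indicator of the open half-line of the sign of [s]; applied to [lam V i] with [s = 1] and
    [s = -1], it selects the two sides of the edge [i]. *)
Definition side (s t : R) : R := (0 < s * t)%R%:R.

Lemma profile_side (s : R) (F : R -> R) : profile F -> profile (fun t => side s t * F t).
Proof.
apply: profileM; last first.
  by exists 1 => t; rewrite /side; case: (_ < _); rewrite ?normr1 ?normr0.
have -> : side s = \1_[set t | 0 < s * t].
  by apply/funext => t; rewrite /side indicE; congr (nat_of_bool _)%:R;
    apply/idP/idP => [?|/set_mem//]; exact/mem_set.
apply: measurable_indic; apply: open_measurable.
apply: (@open_comp _ _ (fun t : R => s * t) [set u | 0 < u]); last exact: open_gt.
by move=> t _; apply: cvgM; [exact: cvg_cst|exact: cvg_id].
Qed.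

Lemma side_near (s t : R) : s != 0 -> t != 0 -> \forall u \near t, side s u = side s t.
Proof.
move=> s0 t0; have st0 : s * t != 0 by rewrite mulf_neq0.
have c : (s * u) @[u --> t] --> s * t by apply: cvgM; [exact: cvg_cst|exact: cvg_id].
have [h|h|/eqP h] := ltgtP (s * t) 0; last by rewrite (negPf st0) in h.
  near=> u; rewrite /side [in RHS]ltNge (ltW h) ltNge; congr (nat_of_bool _)%:R.
  apply/negbTE; rewrite negbK ltW//; near: u; exact: (c _ (lt_nbhsl h)).
near=> u; rewrite /side h; suff -> : 0 < s * u by [].
near: u; exact: (c _ (lt_nbhsr h)).
Unshelve. all: by end_near. Qed.

Lemma is_derive_side (s t : R) (F : R -> R) d : s != 0 -> t != 0 -> is_derive t (1 : R) F d ->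
  is_derive t (1 : R) (fun u => side s u * F u) (side s t * d).
Proof.
move=> s0 t0 dF; apply: (@near_eq_is_derive _ _ _ (fun u => side s t * F u)).
  have := side_near s0 t0; apply: filterS => u ->; by [].
Qed.

(** As [F] vanishes at [0], cutting it off there creates no jump: between points on different sides,
    [|u - t|] is at least [|u|]. *)
Lemma side_lipschitz (s : R) (F : R -> R) (C : R) : F 0 = 0 ->
  (forall u t, `|F u - F t| <= C * `|u - t|) ->
  forall u t, `|side s u * F u - side s t * F t| <= C * `|u - t|.
Proof.
move=> F0 lip.
have C0 : 0 <= C by have := le_trans (normr_ge0 _) (lip 1 0); rewrite subr0 normr1 mulr1.
have h u t : 0 < s * u -> s * t <= 0 -> `|F u| <= C * `|u - t|.
  move=> h1 h2; have := lip u 0; rewrite F0 !subr0 => /le_trans; apply; rewrite ler_wpM2l//.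
  have [s0|s0|s0] := ltgtP s 0; last by rewrite s0 mul0r ltxx in h1.
    rewrite nmulr_rgt0// in h1; rewrite nmulr_rle0// in h2.
    rewrite !ltr0_norm//; lra.
  rewrite pmulr_rgt0// in h1; rewrite pmulr_rle0// in h2.
  rewrite !gtr0_norm//; lra.
move=> u t; rewrite /side; case: (ltP 0 (s * u)) => hu; case: (ltP 0 (s * t)) => ht;
  rewrite ?mul1r ?mul0r ?subr0 ?sub0r ?normrN ?normr0 ?mulr_ge0//.
  exact: h.
by rewrite distrC; exact: h.
Qed.

(** A vanishing integral would force [F] to vanish almost everywhere, and the triangle, which has
    positive area, would be null. *)
Lemma integral_plane_gt0 (F : plane -> R) V : bounded_supp F -> det3 V != 0 ->
  (forall x, 0 <= F x) -> (forall x, tri_int V x -> 0 < F x) -> 0 < \int[mu]_x F x.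
Proof.
move=> bF D0 F0 FV; rewrite lt_neqAle integral_plane_ge0// andbT; apply/negP => /eqP e.
have iF := bounded_supp_integrable bF measurableT.
have mF : measurable_fun setT (F : mplane -> R) by case: bF => -[].
have : (\int[mu]_x `|(EFin \o F) x|)%E = 0%E.
  rewrite (_ : (fun x => `|(EFin \o F) x|)%E = EFin \o F); last first.
    by apply/funext => x /=; rewrite ger0_norm.
  by rewrite -[LHS]fineK ?integrable_fin_num//; congr EFin; rewrite -[LHS]/(\int[mu]_x F x) -e.
have mE : measurable_fun setT (EFin \o F : mplane -> \bar R) by exact/measurable_EFinP.
move=> /(ae_eq_integral_abs mu measurableT mE).1 [N [mN N0 hN]].
have := integral_tri_int D0; suff -> : \int[mu]_x \1_(tri_int V) x = 0.
  by move=> /eqP; rewrite lt_eqF// area_gt0.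
rewrite -[RHS]integral_plane0; apply: (@Rintegral_ae_eq _ _ N) => //.
- by apply: measurable_indic; exact: tri_int_measurable.
- move=> x _ nx_; rewrite indicE memNset// => Vx; apply: nx_; apply: hN => /= h.
  by have := FV _ Vx; have := h I => -[->]; rewrite ltxx.
Qed.

(* Local Raviart-Thomas fields; [flux a b V i] is the constant value of
   [dot (rt a b x) (gradlam V i)] on the line [lam V i x = 0]. *)
Definition rt (a : plane) (b : R) (x : plane) : plane := a + b *: x.
Definition flux (a : plane) b V i : R := dot a (gradlam V i) - b * lam V i 0.

Lemma rt_flux (a : plane) b V i x : dot (rt a b x) (gradlam V i) = flux a b V i + b * lam V i x.
Proof. by rewrite /flux /rt /dot /lam /affine /= /GRing.scale /=; ring. Qed.

Section EdgeBump.
Variables (V : 'I_3 -> plane) (i k : 'I_3) (e : R).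
Hypotheses (D0 : det3 V != 0) (ik : i != k) (e0 : 0 < e).

Let A := tent 3^-1 (2 / 3).
Let A' := dtent 3^-1 (2 / 3).
Let B := tent (- e) e.
Let B' := dtent (- e) e.

Definition edge_bump (x : plane) : R := A (lam V k x) * B (lam V i x).
Definition edge_bump_grad (x : plane) : plane :=
  (A' (lam V k x) * B (lam V i x)) *: gradlam V k +
  (A (lam V k x) * B' (lam V i x)) *: gradlam V i.

(* In the coordinates [lam V k], [lam V i] the integrand is a sum of derivatives of
   compactly supported Lipschitz functions, which integrate to [0], and of [flux]
   times the integrand on the right-hand side. *)
Lemma half_flux (a : plane) (b s : R) : s != 0 ->
  \int[mu]_x (side s (lam V i x) * (dot (rt a b x) (edge_bump_grad x) + 2 * b * edge_bump x)) =
  flux a b V i * \int[mu]_x (A (lam V k x) * (side s (lam V i x) * B' (lam V i x))).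
Proof.
move=> s0; have [pA pA'] := tent_profile 3^-1 (2 / 3).
have [pB pB'] := tent_profile (- e) e.
pose al := flux a b V k.
(* The term [2 * b] splits evenly: one [b] completes the derivative of [P] in [lam V k], the other
   that of [Q] in [lam V i]. As [Q] vanishes at [0] it may be cut off by [side]; [B] does not, which
   leaves the flux term. *)
pose P t := (al + b * t) * A t.
pose P' t := b * A t + (al + b * t) * A' t.
pose Q t := t * B t.
pose Q' t := B t + t * B' t.
have dlin (c d t : R) : is_derive t (1 : R) (fun u : R => c + d * u) d.
  apply: is_derive_eq1 (is_deriveD (is_derive_cst c t 1)
    (is_derive_mul (is_derive_cst d t 1) (is_derive_id t 1))) _.
  by rewrite mul0r !add0r mulr1.
have dP t : is_derive t (1 : R) P (P' t).
  exact: is_derive_mul (dlin al b t) (is_derive_tent _ _ t).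
have dQ t : is_derive t (1 : R) Q (Q' t).
  apply: is_derive_eq1 (is_derive_mul (is_derive_id t 1) (is_derive_tent (- e) e t)) _.
  by rewrite mul1r.
have pP : profile P by exact: profile_poly.
have pP' : profile P'.
  apply: profileD; last exact: profile_poly.
  have := profile_poly b 0 pA; congr profile; apply/funext => t.
  by rewrite mul0r addr0.
have lin G : profile G -> profile (fun t => t * G t).
  by move=> /(profile_poly 0 1); congr profile; apply/funext => t; rewrite add0r mul1r.
have pQ' : profile Q' by apply: profileD => //; exact: lin.
have pQ : profile Q by exact: lin.
have lipP : exists C : R, forall u t, `|P u - P t| <= C * `|u - t|.
  have [_ [C [M h]]] := pP'; exists C; apply: derive_bounded_lipschitz dP _ => t.
  by case: (h t).
have lipQ : exists C : R, forall u t, `|side s u * Q u - side s t * Q t| <= C * `|u - t|.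
  have [_ [C [M h]]] := pQ'; exists C; apply: side_lipschitz; first by rewrite /Q mul0r.
  by apply: derive_bounded_lipschitz dQ _ => t; case: (h t).
have [C1 l1] := lipP; have [C2 l2] := lipQ.
have ki : k != i by rewrite eq_sym.
have I1 := integral_profile_derive0 D0 ik pP pP' (profile_side s pB) l1 (fun t _ => dP t).
have I2 := integral_profile_derive0 D0 ki (profile_side s pQ) (profile_side s pQ') pA l2
  (fun (t : R) (tn : t != 0) => is_derive_side s0 tn (dQ t)).
have b1 := bounded_supp_profile D0 ik pP' (profile_side s pB).
have b2 := bounded_supp_profile D0 ki (profile_side s pQ') pA.
have b3 := bounded_supp_profile D0 ik pA (profile_side s pB').
transitivity (\int[mu]_x (P' (lam V k x) * (side s (lam V i x) * B (lam V i x)) +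
   b * (side s (lam V i x) * Q' (lam V i x) * A (lam V k x)) +
   flux a b V i * (A (lam V k x) * (side s (lam V i x) * B' (lam V i x))))).
  apply: eq_Rintegral => x _.
  have -> : dot (rt a b x) (edge_bump_grad x) =
     (A' (lam V k x) * B (lam V i x)) * dot (rt a b x) (gradlam V k) +
     (A (lam V k x) * B' (lam V i x)) * dot (rt a b x) (gradlam V i).
    by rewrite /dot /edge_bump_grad /= /GRing.scale /=; ring.
  by rewrite !rt_flux /P' /Q' /edge_bump -/al; ring.
have b2' c : bounded_supp (fun x => c * (side s (lam V i x) * Q' (lam V i x) * A (lam V k x))).
  by apply: bounded_suppMl => //; exact: loc_bounded_cst.
have b3' c : bounded_supp (fun x => c * (A (lam V k x) * (side s (lam V i x) * B' (lam V i x)))).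
  by apply: bounded_suppMl => //; exact: loc_bounded_cst.
rewrite integral_planeD//; last exact: bounded_suppD.
by rewrite integral_planeD// I1 integral_planeZ// I2 integral_planeZ// mulr0 !add0r.
Qed.

Let J (s : R) := \int[mu]_x (A (lam V k x) * (side s (lam V i x) * B' (lam V i x))).

(** Off [0] the two halves add up to [B'], the derivative of the uncut smooth bump, whose integral
    vanishes. *)
Lemma half_flux_opp : J 1 + J (-1) = 0.
Proof.
have [pA pA'] := tent_profile 3^-1 (2 / 3); have [pB pB'] := tent_profile (- e) e.
have bJ s := bounded_supp_profile D0 ik pA (profile_side s pB').
rewrite /J -integral_planeD; [|exact: bJ|exact: bJ].
have ki : k != i by rewrite eq_sym.
have [_ [C [M h]]] := pB'.
have pF' : profile (fun t => side 1 t * B' t + side (-1) t * B' t).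
  by apply: profileD; exact: profile_side.
have dB t : t != 0 -> is_derive t (1 : R) B (side 1 t * B' t + side (-1) t * B' t); last first.
  rewrite -[RHS](integral_profile_derive0 D0 ki pB pF' pA
    (derive_bounded_lipschitz (is_derive_tent _ _) (fun t => (h t).1)) dB).
  by apply: eq_Rintegral => x _; rewrite -mulrDr mulrC.
move=> t0; apply: is_derive_eq1 (is_derive_tent _ _ t) _.
rewrite /side mul1r mulN1r oppr_gt0.
by case: ltgtP t0; rewrite // ?mul0r ?addr0 ?add0r mul1r.
Qed.

(** The integrand is nonpositive, and negative on a small triangle [W] resting on the middle third
    of the edge. *)
Lemma half_flux_neq0 : J 1 < 0.
Proof.
have [pA pA'] := tent_profile 3^-1 (2 / 3); have [pB pB'] := tent_profile (- e) e.
have bJ := bounded_supp_profile D0 ik pA (profile_side 1 pB').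
rewrite -oppr_gt0 -integral_planeN//.
have [l li lk] := third_index i k.
(* The point whose coordinates [lam V k] and [lam V i] are [u] and [v]. *)
pose p (u v : R) := u *: (V k - V l) + (v *: (V i - V l) + V l).
have pk u v : lam V k (p u v) = u.
  rewrite !lam_shift !lam_vertex// eqxx ![k == _]eq_sym (negPf lk) (negPf ik).
  by rewrite !subr0 mulr0 addr0 mulr1 add0r.
have pi u v : lam V i (p u v) = v.
  rewrite !lam_shift !lam_vertex// eqxx ![i == l]eq_sym (negPf li) (negPf ik).
  by rewrite !subr0 mulr0 addr0 mulr1 add0r.
pose W := vfun (p 3^-1 0) (p (2 / 3) 0) (p 3^-1 e).
have DW : det3 W != 0.
  have dv : det3 V != 0 -> (V k - V l).1 * (V i - V l).2 - (V k - V l).2 * (V i - V l).1 != 0.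
    case: (nx_cases li) => lE; have kE : k = nx (nx i) \/ k = nx i; try by
      case: (nx_cases (_ : k != i)) => [|->|->]; rewrite 1?eq_sym//; auto.
    - case: kE => kE; last by rewrite lE kE eqxx in lk.
      rewrite (_ : _ - _ = det3 V)// -(chart_det V k).
      have -> : nx k = i by rewrite kE; move: (i); apply: I3_ind.
      by rewrite (_ : nx i = l).
    - case: kE => kE; first by rewrite lE kE eqxx in lk.
      move=> Dv; have h := chart_det V i; rewrite /= -lE -kE in h.
      rewrite -h -oppr_eq0 in Dv; apply: contraNN Dv => /eqP z; apply/eqP; rewrite -[RHS]z.
      by ring.
  rewrite (_ : det3 W = 3^-1 * e * ((V k - V l).1 * (V i - V l).2 - (V k - V l).2 * (V i - V l).1)).
    by rewrite !mulf_neq0 ?dv// ?invr_eq0 ?pnatr_eq0// gt_eqF.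
  rewrite /det3 /W /vfun /p /=.
  by move: (V k - V l) (V i - V l) (V l) => [? ?] [? ?] [? ?]; rewrite /= /GRing.scale /=; field.
have inW x : tri_int W x -> [/\ 0 < lam V i x, lam V i x < e, 3^-1 < lam V k x & lam V k x < 2 / 3].
  move=> Wx; have := Wx i0; have := Wx i1; have := Wx i2; have := lam_sum x DW.
  have Wl j : lam V j x = lam W i0 x * lam V j (W i0) + lam W i1 x * lam V j (W i1) +
    lam W i2 x * lam V j (W i2) by exact: affine_lam.
  rewrite !Wl ![W _]/= ![lam V i _]pi ![lam V k _]pk.
  move: (lam W i0 x) (lam W i1 x) (lam W i2 x) => u v w uvw w0 v0 u0.
  have uE : u = 1 - v - w by lra.
  rewrite {}uE in u0 *; have := mulr_gt0 w0 e0; have := mulr_gt0 u0 e0; have := mulr_gt0 v0 e0.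
  by split; lra.
apply: (integral_plane_gt0 (V := W)) => //.
- exact: bounded_suppN.
- move=> x; rewrite -mulrN mulr_ge0 ?tent_ge0// -mulrN /side mul1r.
  by case: ltP => [h|_]; rewrite ?mul0r// mul1r oppr_ge0 dtent_le0.
- move=> x /inW[h1 h2 h3 h4]; rewrite -mulrN mulr_gt0 ?tent_gt0// -mulrN /side !mul1r h1 mul1r.
  by rewrite oppr_gt0 dtent_lt0.
Qed.

End EdgeBump.
End Tent.

Section EdgeBumpSmooth.
Context {R : realType}.
Local Notation plane := (R * R)%type.
Variables (V : 'I_3 -> plane) (i k : 'I_3) (e : R).

Lemma smooth_edge_bump : smooth (edge_bump V i k e).
Proof.
have h j (a b : R) : smooth (fun x => tent a b (lam V j x)).
  pose c := ((V (nx j)).1 * (V (nx (nx j))).2 - (V (nx j)).2 * (V (nx (nx j))).1) / det3 V.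
  have -> : (fun x => tent a b (lam V j x)) = (fun x =>
      (flat 1 \o affine (gradlam V j).1 (gradlam V j).2 (c - a)) x *
      (flat 1 \o affine (- (gradlam V j).1) (- (gradlam V j).2) (b - c)) x).
    by apply/funext => x; congr (flat 1 _ * flat 1 _); rewrite /lam /affine -/c; ring.
  by apply: smoothM; exact: smooth_flat.
by apply: smoothM; exact: h.
Qed.

Lemma is_derive_edge_bump v x :
  is_derive x v (edge_bump V i k e) (dot (edge_bump_grad V i k e x) v).
Proof.
have h j (a b : R) := is_derive_affine_comp v (is_derive_tent a b (lam V j x)).
have := is_derive_mul (h k 3^-1 (2 / 3)) (h i (- e) e).
set d := (X in is_derive _ _ _ X -> _) => hd.
suff -> : dot (edge_bump_grad V i k e x) v = d by [].
by rewrite /d /dot /edge_bump_grad /= /GRing.scale /=; ring.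
Qed.

Lemma edge_bump_out x :
  ~ (3^-1 < lam V k x < 2 / 3 /\ - e < lam V i x < e) ->
  edge_bump V i k e x = 0 /\ edge_bump_grad V i k e x = 0.
Proof.
move=> h.
have cases (a b t : R) : ~ a < t < b -> t <= a \/ b <= t.
  by move=> /negP; rewrite negb_and -!leNgt => /orP.
rewrite /edge_bump /edge_bump_grad.
have [/cases/tent_out[-> ->]|h1] := pselect (~ 3^-1 < lam V k x < 2 / 3).
  by rewrite !mul0r !scale0r addr0.
have [/cases/tent_out[-> ->]|h2] := pselect (~ - e < lam V i x < e).
  by rewrite !mulr0 !scale0r addr0.
by exfalso; apply: h; split; exact: contrapT.
Qed.

End EdgeBumpSmooth.

(** * Normal fluxes agree across a shared edge *)

Section FluxContinuity.
Context {R : realType}.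
Local Notation plane := (R * R)%type.
Local Notation mplane := (measurableTypeR R * measurableTypeR R)%type.
Local Notation mu := (@lebesgue2 R).
Context {N : nat} (V : 'I_N -> 'I_3 -> plane) (Omega : set plane).
Context (a : 'I_N -> plane) (b : 'I_N -> R).
Implicit Types (m n : 'I_N) (i j : 'I_3) (x y : plane).
Hypothesis hdet : forall n, det3 (V n) != 0.
Hypothesis hreg : regular_mesh V.
Hypothesis oO : open Omega.
Hypothesis hint : (closure Omega)° `<=` Omega.
Hypothesis hcl : forall x, closure Omega x <-> exists n, tri (V n) x.
Hypothesis hweak : forall phi, smooth phi -> test_function Omega phi ->
  \sum_n \int[mu]_x (\1_(tri_int (V n)) x *
     (dot (rt (a n) (b n) x) ('D_e1 phi x, 'D_e2 phi x) + 2 * b n * phi x)) = 0.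

(* Test with a bump supported around the middle of the common edge. *)
Lemma flux_jump m n i j : m <> n -> nbr (V m) i (V n) j ->
  flux (a m) (b m) (V m) i = flux (a n) (b n) (V m) i.
Proof.
move=> mn h; pose k := nx i; pose l := nx (nx i).
have ik : i != k by rewrite eq_sym nx_neq.
have s0 := nbr_opposite hdet hreg mn h.
(* On the common edge the coordinates of its endpoints agree in both triangles, so elsewhere they
   differ by multiples of [lam (V m) i]; [j1] and [j2] absorb the two orientations of the edge. *)
have Wk : exists c d : R, exists j1 j2, [/\ forall q, q != j -> q = j1 \/ q = j2,
    forall x, lam (V n) j1 x = c * lam (V m) i x + lam (V m) k x &
    forall x, lam (V n) j2 x = d * lam (V m) i x + lam (V m) l x].
  have E p x : lam (V n) p x = lam (V m) i x * lam (V n) p (V m i) +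
      lam (V m) k x * lam (V n) p (V m k) + lam (V m) l x * lam (V n) p (V m l).
    rewrite -(sum3_nx (fun q => lam (V m) q x * lam (V n) p (V m q)) i); exact: affine_lam.
  have dj : nx j != nx (nx j) by rewrite eq_sym nx_neq.
  case: h => -[Vk Vl].
    exists (lam (V n) (nx j) (V m i)), (lam (V n) (nx (nx j)) (V m i)), (nx j), (nx (nx j)).
    split; first by move=> q /nx_cases.
      by move=> x; rewrite E /k /l Vk Vl !lam_vertex// eqxx (negPf dj) mulr1 mulr0 addr0 mulrC.
    move=> x; rewrite E /k /l Vk Vl !lam_vertex// eqxx [nx (nx j) == _]eq_sym (negPf dj).
    by rewrite mulr1 mulr0 addr0 mulrC.
  exists (lam (V n) (nx (nx j)) (V m i)), (lam (V n) (nx j) (V m i)), (nx (nx j)), (nx j).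
  split; first by move=> q /nx_cases[]; auto.
    move=> x; rewrite E /k /l Vk Vl !lam_vertex// eqxx [nx (nx j) == _]eq_sym (negPf dj).
    by rewrite mulr1 mulr0 addr0 mulrC.
  by move=> x; rewrite E /k /l Vk Vl !lam_vertex// eqxx (negPf dj) mulr1 mulr0 addr0 mulrC.
have [c [d [j1 [j2 [jj lj1 lj2]]]]] := Wk.
(* On the support the coordinates attached to the endpoints of the edge, in either triangle, fall
   below [1 / 3] by at most [e + |c| * e + |d| * e = 1 / 6], hence stay positive. *)
pose e : R := (6 * (1 + `|c| + `|d|))^-1.
have K0 : 0 < 1 + `|c| + `|d| by rewrite -addrA ltr_wpDr// addr_ge0.
have e0 : 0 < e by rewrite invr_gt0 mulr_gt0.
have eK : e + `|c| * e + `|d| * e = 6^-1.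
  by rewrite /e; field; rewrite gt_eqF.
have c0 : 0 <= `|c| * e by rewrite mulr_ge0// ltW.
have d0 : 0 <= `|d| * e by rewrite mulr_ge0// ltW.
have bnd (q t : R) : - e <= t <= e -> - (`|q| * e) <= q * t.
  by move=> ht; rewrite lerNl (le_trans (ler_norm _))// normrN normrM ler_wpM2l// ler_norml.
pose S := [set x | 3^-1 <= lam (V m) k x <= 2 / 3 /\ - e <= lam (V m) i x <= e].
have Sl x : S x -> 0 < lam (V m) k x /\ 0 < lam (V m) l x.
  move=> [h1 h2]; have := lam_sum x (hdet m); rewrite (sum3_nx (fun q => lam (V m) q x) i) -/k -/l.
  by split; lra.
have Spos x : S x -> 0 < lam (V m) i x -> tri_int (V m) x.
  move=> Sx h1 q; have [->//|] := eqVneq q i.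
  by have [? ?] := Sl x Sx; move=> /nx_cases[->|->].
have Sneg x : S x -> lam (V m) i x < 0 -> tri_int (V n) x.
  move=> [h1 h2] h3 q; have [->|/jj[->|->]] := eqVneq q j.
  - by move: h3; rewrite (lam_nbr x (hdet m) (hdet n) h) nmulr_rlt0.
  - have := bnd c _ h2; rewrite lj1; lra.
  - have := bnd d _ h2; have := lam_sum x (hdet m).
    rewrite (sum3_nx (fun q => lam (V m) q x) i) -/k -/l lj2; lra.
have Szero x : S x -> lam (V m) i x = 0 -> Omega x /\ tri (V m) x.
  move=> Sx x0; have [h1 h2] := Sl x Sx; split.
    apply: (mesh_shared_edge hdet hreg hint hcl mn h x0) => q /nx_cases[]->; [exact: h1|exact: h2].
  apply/triP => // q; have [->|/nx_cases[->|->]] := eqVneq q i; first by rewrite x0.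
    exact: ltW h1.
  exact: ltW h2.
have inO q x : tri_int (V q) x -> Omega x by exact: mesh_interior.
have SO : S `<=` Omega.
  move=> x Sx; have [h1|h1|h1] := ltgtP (lam (V m) i x) 0.
  - by apply: (inO n); exact: Sneg.
  - by apply: (inO m); exact: Spos.
  - by case: (Szero x Sx h1).
have Sc : compact S.
  have [M hM] := lam_box 1 (hdet m) ik.
  apply: (@subclosed_compact _ S (box M)).
  - have -> : S = (lam (V m) k @^-1` `[3^-1, 2 / 3]) `&` (lam (V m) i @^-1` `[- e, e]).
      by apply/seteqP; split => x /=; rewrite !in_itv.
    by apply: closedI; apply: closed_comp => [y _|]; [exact: lam_continuous|exact: interval_closed|
      exact: lam_continuous|exact: interval_closed].
  - exact: box_compact.
  - by move=> x [h1 h2]; apply: hM; rewrite ler_norml; lra.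
pose phi := edge_bump (V m) i k e.
have out x : ~ S x -> phi x = 0 /\ edge_bump_grad (V m) i k e x = 0.
  move=> nS; apply: edge_bump_out => -[h1 h2]; apply: nS; split.
    by case/andP: h1 => /ltW -> /ltW ->.
  by case/andP: h2 => /ltW -> /ltW ->.
have tphi : test_function Omega phi.
  split; first by have [] := smooth_edge_bump (V m) i k e.
  by exists S; split => // x /out[].
have grad x : ('D_e1 phi x, 'D_e2 phi x) = edge_bump_grad (V m) i k e x.
  have -> : 'D_e1 phi x = dot (edge_bump_grad (V m) i k e x) e1.
    exact: (@derive_val _ _ _ _ _ _ _ (is_derive_edge_bump (V m) i k e e1 x)).
  have -> : 'D_e2 phi x = dot (edge_bump_grad (V m) i k e x) e2.
    exact: (@derive_val _ _ _ _ _ _ _ (is_derive_edge_bump (V m) i k e e2 x)).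
  case: (edge_bump_grad _ _ _ _ _) => u v.
  by rewrite /dot /e1 /e2 /= !mulr1 !mulr0 addr0 add0r.
have disj := mesh_interior_disjoint hdet hreg.
pose G p x := dot (rt (a p) (b p) x) (edge_bump_grad (V m) i k e x) + 2 * b p * phi x.
have G0 p x : ~ S x -> G p x = 0.
  by move=> /out[h1 h2]; rewrite /G h1 h2 /dot /= !mulr0 !addr0.
have dot_side (s : R) p x : s != 0 -> (S x -> tri_int (V p) x <-> 0 < s * lam (V m) i x) ->
    \1_(tri_int (V p)) x * G p x = side s (lam (V m) i x) * G p x.
  move=> sn hx; have [Sx|/(G0 p) ->] := pselect (S x); last by rewrite !mulr0.
  congr (_ * _); rewrite /side indicE; congr (nat_of_bool _)%:R.
  by apply/idP/idP => [/set_mem/(hx Sx)//|/(hx Sx) ?]; exact/mem_set.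
have n1 : (-1 : R) != 0 by rewrite oppr_eq0 oner_eq0.
have := hweak (smooth_edge_bump (V m) i k e) tphi.
(* Only the open triangles [m] and [n] meet the support [S]. *)
rewrite (bigD1 m)//= (bigD1 n)/=; last by apply/eqP => e'; exact: mn.
rewrite big1 ?addr0 => [|p /andP[pm pn]]; last first.
  rewrite -[RHS]integral_plane0; apply: eq_Rintegral => x _; rewrite grad -/(G p x).
  have [Sx|/(G0 p) ->] := pselect (S x); last by rewrite mulr0.
  rewrite indicE memNset ?mul0r// => px.
  have [h1|h1|h1] := ltgtP (lam (V m) i x) 0.
  - have := disj _ _ _ px (tri_int_sub (hdet n) (Sneg x Sx h1)).
    by move/eqP; rewrite (negPf pn).
  - have := disj _ _ _ px (tri_int_sub (hdet m) (Spos x Sx h1)).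
    by move/eqP; rewrite (negPf pm).
  - have := disj _ _ _ px (Szero x Sx h1).2.
    by move/eqP; rewrite (negPf pm).
have side_int p (s : R) : s != 0 -> (forall x, S x -> tri_int (V p) x <-> 0 < s * lam (V m) i x) ->
    \int[mu]_x (\1_(tri_int (V p)) x *
     (dot (rt (a p) (b p) x) ('D_e1 phi x, 'D_e2 phi x) + 2 * b p * phi x)) =
    flux (a p) (b p) (V m) i * \int[mu]_x (tent 3^-1 (2 / 3) (lam (V m) k x) *
      (side s (lam (V m) i x) * dtent (- e) e (lam (V m) i x))).
  move=> sn hs; rewrite -(half_flux e (hdet m) ik)//; apply: eq_Rintegral => x _.
  by rewrite grad; apply: dot_side => // Sx; exact: hs.
rewrite (side_int m 1) ?oner_neq0//; last first.
  by move=> x Sx; rewrite mul1r; split => [|]; [exact|exact: Spos].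
rewrite (side_int n (-1))//; last first.
  move=> x Sx; rewrite mulN1r oppr_gt0; split => [|]; last exact: Sneg.
  by move=> /(_ j) h1; rewrite (lam_nbr x (hdet m) (hdet n) h) nmulr_rlt0.
have J0 := half_flux_opp e (hdet m) ik.
have Jn := half_flux_neq0 (hdet m) ik e0.
move: J0 Jn; set J1 := \int[mu]_x _; set J2 := \int[mu]_x _ => J0 Jn E.
(* The two fluxes are multiplied by opposite nonzero numbers, so the vanishing sum forces them to be
   equal. *)
have J2E : J2 = - J1 by apply/eqP; rewrite -addr_eq0 addrC J0.
rewrite J2E mulrN -mulrBl in E; move/eqP: E; rewrite mulf_eq0 (lt_eqF Jn) orbF subr_eq0.
by move/eqP.
Qed.

End FluxContinuity.

(** * Crouzeix-Raviart functions *)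

(** Exchanging partners is an involution of the index set that changes the sign of [f]; indices
    without partner are fixed and contribute [0]. The sum thus equals its opposite. *)
Lemma sum_pairing (R : realDomainType) (I : finType) (f : I -> R) (N : I -> I -> Prop) :
  (forall p q, N p q -> N q p) -> (forall p q q', N p q -> N p q' -> q = q') ->
  (forall p q, N p q -> f p = - f q) -> (forall p, (forall q, ~ N p q) -> f p = 0) ->
  \sum_p f p = 0.
Proof.
move=> Ns Nu Na N0; pose P p := odflt p [pick q | `[< N p q >]].
have PN p q : N p q -> P p = q.
  move=> pq; rewrite /P; case: pickP => [q' /asboolP /(Nu _ _ _ pq)//|/(_ q)].
  by rewrite asboolT.
have PE p : (forall q, ~ N p q) -> P p = p.
  by move=> h; rewrite /P; case: pickP => [q' /asboolP /h|].
have Pinv : involutive P.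
  move=> p; have [[q pq]|/forallNP h] := pselect (exists q, N p q); last by rewrite !PE.
  by rewrite (PN p q)// (PN q p)//; exact: Ns.
have fP p : f (P p) = - f p.
  have [[q pq]|/forallNP h] := pselect (exists q, N p q).
    by rewrite (PN p q)// (Na _ _ (Ns _ _ pq)).
  by rewrite PE// N0// oppr0.
have : \sum_p f p = - \sum_p f p.
  by rewrite {1}(reindex_inj (inv_inj Pinv)) -sumrN; apply: eq_bigr => p _; exact: fP.
by move/eqP; rewrite -addr_eq0 -mulr2n mulrn_eq0 => /eqP.
Qed.

Section CRFunctions.
Context {R : realType}.
Local Notation plane := (R * R)%type.
Local Notation mplane := (measurableTypeR R * measurableTypeR R)%type.
Local Notation mu := (@lebesgue2 R).
Implicit Types (V W : 'I_3 -> plane) (i j : 'I_3) (X : 'I_3 -> R) (a x : plane) (b : R).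

(* The affine function with value [X i] at the midpoint of the edge opposite to [V i] *)
Definition cr V X x : R := \sum_i X i * (1 - 2 * lam V i x).
Definition cr_grad V X : plane := - 2 *: \sum_i X i *: gradlam V i.

(** The integrand is affine and each [lam V i] has mean [1 / 3], which makes [b] cancel. As
    [gradlam] is an inward normal of length edge over twice the area, [- 2 * area V * flux a b V i]
    is the outward flux through the edge [i]. *)
Lemma integral_cr V X a b : det3 V != 0 ->
  \int[mu]_x (\1_(tri_int V) x * (dot (rt a b x) (cr_grad V X) + 2 * b * cr V X x)) =
  - 2 * \sum_i area V * flux a b V i * X i.
Proof.
move=> D0; pose K := \sum_i (2 * b - 2 * flux a b V i) * X i.
have b1 c i : bounded_supp (fun x => c * (lam V i x * \1_(tri_int V) x)).
  apply: bounded_suppMl; first exact: loc_bounded_cst.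
  by apply: bounded_suppMl; [exact: loc_bounded_affine|exact: bounded_supp_tri_int].
have b2 : bounded_supp (fun x => K * \1_(tri_int V) x).
  by apply: bounded_suppMl; [exact: loc_bounded_cst|exact: bounded_supp_tri_int].
transitivity (\int[mu]_x (K * \1_(tri_int V) x +
    \sum_i (- 6 * b * X i) * (lam V i x * \1_(tri_int V) x))).
  apply: eq_Rintegral => x _; rewrite mulrC [K * _]mulrC.
  rewrite (_ : \sum_i _ = \1_(tri_int V) x * \sum_i (- 6 * b * X i * lam V i x)); last first.
    by rewrite mulr_sumr; apply: eq_bigr => i _; ring.
  rewrite -mulrDr mulrC; congr (_ * _).
  have -> : dot (rt a b x) (cr_grad V X) = - 2 * \sum_i X i * (flux a b V i + b * lam V i x).
    rewrite !sum3 -!rt_flux /cr_grad sum3 /dot /= /GRing.scale /=; ring.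
  by rewrite /cr /K !sum3; ring.
rewrite integral_planeD//; last by apply: bounded_supp_sum => i.
rewrite integral_planeZ ?integral_tri_int//; last exact: bounded_supp_tri_int.
rewrite integral_plane_sum//.
have E i : \int[mu]_x (- 6 * b * X i * (lam V i x * \1_(tri_int V) x)) =
    - 6 * b * X i * (area V / 3).
  rewrite integral_planeZ ?integral_lam//.
  by apply: bounded_suppMl; [exact: loc_bounded_affine|exact: bounded_supp_tri_int].
by rewrite (eq_bigr _ (fun i _ => E i)) /K !sum3; field.
Qed.

Lemma lam_det V i y : det3 V != 0 ->
  lam V i y * det3 V = (y - V (nx (nx i))).1 * (V (nx i) - V (nx (nx i))).2 -
    (y - V (nx (nx i))).2 * (V (nx i) - V (nx (nx i))).1.
Proof.
by rewrite /lam /affine /gradlam /det3 => D0; move: i; apply: I3_ind => /=; field.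
Qed.

(** Over a common base, areas are in the ratio of heights, which is the modulus of
    [lam V i (W j)]. *)
Lemma nbr_det V i W j : det3 V != 0 -> det3 W != 0 -> nbr V i W j ->
  `|lam V i (W j)| * `|det3 V| = `|det3 W|.
Proof.
move=> DV DW h; rewrite -normrM lam_det// -(chart_det W j) /=.
case: h => -[-> ->] //; rewrite -[RHS]normrN; congr `|_|.
by move: (W _) (W _) (W _) => [? ?] [? ?] [? ?] /=; ring.
Qed.

(** [flux] is linear in the coefficients of the barycentric coordinate, which are recovered from its
    values at [0], [e1] and [e2] and are rescaled according to [lam_nbr]. *)
Lemma nbr_flux V i W j a b : det3 V != 0 -> det3 W != 0 -> nbr V i W j ->
  flux a b V i = lam V i (W j) * flux a b W j.
Proof.
move=> DV DW h; have E x := lam_nbr x DV DW h.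
have g1 U q : (gradlam U q).1 = lam U q e1 - lam U q (0 : plane).
  by rewrite /lam /affine /e1 /=; ring.
have g2 U q : (gradlam U q).2 = lam U q e2 - lam U q (0 : plane).
  by rewrite /lam /affine /e2 /=; ring.
rewrite /flux /dot !g1 !g2 (E e1) (E e2) (E 0); ring.
Qed.

(** The minus sign records that the triangles lie on opposite sides; with [nbr_flux] it makes their
    area-weighted fluxes opposite. *)
Lemma nbr_area V i W j : det3 V != 0 -> det3 W != 0 -> nbr V i W j -> lam V i (W j) < 0 ->
  area V * lam V i (W j) = - area W.
Proof.
move=> DV DW h l0; rewrite /area -(nbr_det DV DW h) (ltr0_norm l0).
by ring.
Qed.

End CRFunctions.

Section CROrthogonality.
Context {R : realType}.
Local Notation plane := (R * R)%type.
Local Notation mplane := (measurableTypeR R * measurableTypeR R)%type.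
Local Notation mu := (@lebesgue2 R).
Context {N : nat} (V : 'I_N -> 'I_3 -> plane) (Omega : set plane).
Implicit Types (m n : 'I_N) (i j : 'I_3) (x y : plane).
Hypothesis hdet : forall n, det3 (V n) != 0.
Hypothesis hreg : regular_mesh V.
Hypothesis oO : open Omega.
Hypothesis hint : (closure Omega)° `<=` Omega.
Hypothesis hcl : forall x, closure Omega x <-> exists n, tri (V n) x.

Definition adjacent (p q : 'I_N * 'I_3) := p.1 <> q.1 /\ nbr (V p.1) p.2 (V q.1) q.2.

(** Midpoint values of a Crouzeix-Raviart function, indexed by triangle and local edge because edges
    have no index set of their own; an edge without neighbour is a boundary edge. *)
Definition cr_data (X : 'I_N -> 'I_3 -> R) :=
  (forall p q, adjacent p q -> X p.1 p.2 = X q.1 q.2) /\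
  (forall p, (forall q, ~ adjacent p q) -> X p.1 p.2 = 0).

Lemma adjacent_sym p q : adjacent p q -> adjacent q p.
Proof. by move=> [pq h]; split; [exact: nesym|exact: nbr_sym]. Qed.

Lemma adjacent_unique p q q' : adjacent p q -> adjacent p q' -> q = q'.
Proof.
move=> [pq h] [pq' h']; have [] := nbr_unique hdet hreg pq h pq' h'.
by case: q q' {pq h pq' h'} => [? ?] [? ?] /= -> ->.
Qed.

(* By exact quadrature each triangle contributes the fluxes through its edges
   times the midpoint values; on a common edge the two contributions cancel. *)
Lemma cr_orthogonal (a : 'I_N -> plane) (b : 'I_N -> R) X : cr_data X ->
  (forall phi, smooth phi -> test_function Omega phi ->
    \sum_n \int[mu]_x (\1_(tri_int (V n)) x *
       (dot (rt (a n) (b n) x) ('D_e1 phi x, 'D_e2 phi x) + 2 * b n * phi x)) = 0) ->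
  \sum_n \int[mu]_x (\1_(tri_int (V n)) x *
     (dot (rt (a n) (b n) x) (cr_grad (V n) (X n)) + 2 * b n * cr (V n) (X n) x)) = 0.
Proof.
move=> [X1 X0] hweak.
under eq_bigr do rewrite integral_cr//.
rewrite -mulr_sumr pair_big /= (@sum_pairing _ _ _ adjacent) ?mulr0//.
- exact: adjacent_sym.
- exact: adjacent_unique.
- move=> p q pq; have [pq1 h] := pq; rewrite (X1 p q pq) -mulNr; congr (_ * _).
  rewrite (flux_jump hdet hreg hint hcl hweak pq1 h) (nbr_flux _ _ (hdet _) (hdet _) h).
  by rewrite mulrA nbr_area ?mulNr//; exact: nbr_opposite hdet hreg _ _ _ _ pq1 h.
- by move=> p /X0 ->; rewrite mulr0.
Qed.

End CROrthogonality.

(** * Weak partial derivatives of piecewise affine functions *)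

Section WeakPartials.
Context {R : realType}.
Local Notation plane := (R * R)%type.
Local Notation mplane := (measurableTypeR R * measurableTypeR R)%type.
Local Notation mu := (@lebesgue2 R).
Context (Omega : set plane) (M0 : R).
Implicit Types (V : 'I_3 -> plane) (x y e : plane) (u g phi : plane -> R).
Hypothesis oO : open Omega.
Hypothesis hbox : Omega `<=` box M0.

Let mO : measurable (Omega : set mplane) := open_measurable_plane oO.

Lemma integrable_loc_bounded phi : loc_bounded phi ->
  mu.-integrable (Omega : set mplane) (EFin \o phi).
Proof.
move=> hphi.
have bO : bounded_supp (fun x => phi x * \1_Omega x).
  by apply: bounded_suppMl => //; exact: bounded_supp_indic mO hbox.
apply: eq_integrable (bounded_supp_integrable bO mO) => // x.
by rewrite inE => Ox; rewrite /= indicE mem_set// mulr1.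
Qed.

(** On the bounded set [Omega], [|u|] is dominated by [u ^ 2 + 1]. *)
Lemma L2_integrable u : L2 Omega u -> mu.-integrable (Omega : set mplane) (EFin \o u).
Proof.
move=> [mu_ iu].
have i1 := integrable_loc_bounded (loc_bounded_cst 1).
have h := integrableD mO iu i1.
apply: (le_integrable mO _ _ h); first exact/measurable_EFinP.
move=> x Ox; change (`|u x|%:E <= `|u x ^+ 2 + 1|%:E)%E.
rewrite lee_fin [leRHS]ger0_norm ?addr_ge0 ?sqr_ge0//.
rewrite -(real_normK (num_real (u x))); have := sqr_ge0 (`|u x| - 2^-1).
by rewrite !expr2 => ?; nra.
Qed.

Lemma L2_integrableM u phi : L2 Omega u -> loc_bounded phi ->
  mu.-integrable (Omega : set mplane) (EFin \o (fun x => u x * phi x)).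
Proof.
move=> Lu [mphi hphi]; have [C hC] := hphi M0; have iu := L2_integrable Lu.
have iC : mu.-integrable (Omega : set mplane) (fun x => (`|C| * u x)%:E).
  have := integrableZl mO `|C| iu; apply: eq_integrable => // x _.
apply: (le_integrable mO _ _ iC).
  apply/measurable_EFinP; apply: measurable_funM; first by case: Lu.
  exact: measurable_funS mphi.
move=> x Ox /=; rewrite lee_fin !normrM normr_id mulrC ler_wpM2r//.
by apply: le_trans (ler_norm _); apply: hC; exact: hbox.
Qed.

Lemma bump_limit V u : det3 V != 0 -> mu.-integrable (Omega : set mplane) (EFin \o u) ->
  \int[mu]_(x in Omega) (u x * bump k V x) @[k --> \oo] -->
  \int[mu]_(x in Omega) (u x * \1_(tri_int V) x).
Proof.
move=> D0 iu; have /integrableP[/measurable_EFinP mu_ _] := iu.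
have mb k : measurable_fun setT (bump k V : mplane -> R).
  by apply: continuous_measurable_plane; have [h _] := smooth_bump k V; exact: (Ck_cont (h 0%N)).
apply: (@Rintegral_dominated _ _ set0 _ _ (fun x => `|u x|)) => //.
- by move=> k; apply: measurable_funM => //; exact: measurable_funS (mb k).
- apply: measurable_funM => //; apply: measurable_indic; exact: tri_int_measurable.
- exact: integrable_norm iu.
- move=> k x _; rewrite normrM ler_piMr//.
  by have /andP[b0 b1] := bump_itv k V x; rewrite ger0_norm.
- by move=> x _ _; apply: cvgM; [exact: cvg_cst|exact: bump_cvg].
Qed.

Lemma integral_Omega_bump k V phi : tri_int V `<=` Omega ->
  \int[mu]_(x in Omega) (bump k V x * phi x) = \int[mu]_x (bump k V x * phi x).
Proof.
move=> VO; apply: integral_plane_Omega => x nO; rewrite bump_off ?mul0r//.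
by move=> /bump_supp_int/VO.
Qed.

Lemma bump_box k V phi : det3 V != 0 ->
  exists M, forall x, ~ box M x -> bump k V x * phi x = 0.
Proof.
move=> D0; have [M hM] := tri_bounded D0; exists M => x nx_.
by rewrite bump_off ?mul0r// => /bump_supp_int/(tri_int_sub D0)/hM.
Qed.

(** The derivative of the affine function times the compactly supported [bump k V * phi] integrates
    to zero; expand it by the product rule. *)
Lemma integral_affine_derive V (a b c : R) e k phi : det3 V != 0 -> e = e1 \/ e = e2 ->
  (forall j, Ck j phi) ->
  \int[mu]_x (affine a b c x * 'D_e (fun y => bump k V y * phi y) x) =
  - ((a * e.1 + b * e.2) * \int[mu]_x (bump k V x * phi x)).
Proof.
move=> D0 he hphi; pose psi y := bump k V y * phi y.
have cpsi j : Ck j psi by apply: CkM => //; case: (smooth_bump k V).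
have [M hM] := bump_box k phi D0.
have bpsi : bounded_supp psi by split; [exact/loc_bounded_cont/(Ck_cont (cpsi 0%N))|exists M].
have bD : bounded_supp (fun x => 'D_e psi x).
  split; first exact/loc_bounded_cont/(Ck_cont (Ck_derive he (cpsi 1%N))).
  by exists M => x; apply: derive_off_closed; [exact: box_closed|].
have cap : Ck 1 (fun x => affine a b c x * psi x) by apply: CkM => //; exact: Ck_affine.
have := integral_Ck_derivative0 he cap (M := M) _.
have dE : (fun x => 'D_e (fun x => affine a b c x * psi x) x) =
    (fun x => (a * e.1 + b * e.2) * psi x + affine a b c x * 'D_e psi x).
  apply: derive_funext => x; apply: is_derive_mul; first exact: is_derive_affine.
  exact: Ck_is_derive he (cpsi 1%N).
rewrite dE integral_planeD ?integral_planeZ//.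
- have z x : ~ box M x -> affine a b c x * psi x = 0 by move=> /hM h; rewrite /psi h mulr0.
  by move=> /(_ z) h; apply/eqP; rewrite -addr_eq0 addrC h.
- by apply: bounded_suppMl => //; exact: loc_bounded_cst.
- by apply: bounded_suppMl => //; exact: loc_bounded_affine.
Qed.

(* Test with [phi] times bumps increasing to the indicator of the triangle; no
   derivative of the bumps survives since [u] is affine there. *)
Lemma weak_partial_triangle V (a b c : R) e u g phi : det3 V != 0 -> e = e1 \/ e = e2 ->
  tri_int V `<=` Omega -> (forall x, tri_int V x -> u x = affine a b c x) ->
  weak_partials Omega e u g -> (forall j, Ck j phi) ->
  \int[mu]_(x in Omega) (g x * phi x * \1_(tri_int V) x) =
  (a * e.1 + b * e.2) * \int[mu]_x (phi x * \1_(tri_int V) x).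
Proof.
move=> D0 he VO uE [Lg wg] hphi.
have lphi : loc_bounded phi by exact/loc_bounded_cont/(Ck_cont (hphi 0%N)).
have l1 := bump_limit D0 (L2_integrableM Lg lphi).
have := bump_limit D0 (integrable_loc_bounded lphi).
move=> /(cvgM (cvg_cst (a * e.1 + b * e.2))) l2.
have <- : \int[mu]_(x in Omega) (phi x * \1_(tri_int V) x) = \int[mu]_x (phi x * \1_(tri_int V) x).
  by apply: integral_plane_Omega => x nO; rewrite indicE memNset ?mulr0// => /VO.
apply: (cvg_unique _ l1); first exact: norm_hausdorff.
rewrite (_ : (fun k => _) = (fun k =>
    (a * e.1 + b * e.2) * \int[mu]_(x in Omega) (phi x * bump k V x))); first exact: l2.
apply/funext => k.
pose psi y := bump k V y * phi y.
have tpsi : test_function Omega psi by exact: bump_test.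
have := wg _ tpsi.
have -> : inner Omega u (fun x => 'D_e psi x) = \int[mu]_x (affine a b c x * 'D_e psi x).
  have z x : ~ tri_int V x -> 'D_e psi x = 0.
    move=> nV; apply: (derive_off_closed (K := bump_supp k V)); first exact: bump_supp_closed.
      by move=> y /bump_off; rewrite /psi => ->; rewrite mul0r.
    by move=> /bump_supp_int.
  rewrite -(@integral_plane_Omega _ Omega); last by move=> x nO; rewrite z ?mulr0// => /VO.
  apply: eq_Rintegral => x _; have [Vx|/z ->] := pselect (tri_int V x); first by rewrite uE.
  by rewrite !mulr0.
rewrite integral_affine_derive// => /oppr_inj; rewrite /inner.
rewrite -(integral_Omega_bump k phi VO) => E.
transitivity (\int[mu]_(x in Omega) (g x * psi x)).
  by apply: eq_Rintegral => x _; rewrite /psi; ring.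
rewrite -E; congr (_ * _); apply: eq_Rintegral => x _; exact: mulrC.
Qed.

End WeakPartials.

(** * Weak divergence and curl evaluated triangle by triangle *)

Section MeshWeak.
Context {R : realType}.
Local Notation plane := (R * R)%type.
Local Notation mplane := (measurableTypeR R * measurableTypeR R)%type.
Local Notation mu := (@lebesgue2 R).
Context {N : nat} (V : 'I_N -> 'I_3 -> plane) (Omega : set plane).
Implicit Types (m n : 'I_N) (i j : 'I_3) (x y : plane).
Hypothesis hdet : forall n, det3 (V n) != 0.
Hypothesis hreg : regular_mesh V.
Hypothesis oO : open Omega.
Hypothesis hint : (closure Omega)° `<=` Omega.
Hypothesis hcl : forall x, closure Omega x <-> exists n, tri (V n) x.

Context (M0 : R).
Hypothesis hbox : Omega `<=` box M0.

Let disj m n x : tri_int (V m) x -> tri (V n) x -> m = n.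
Proof. exact: mesh_interior_disjoint. Qed.
Let inO n : tri_int (V n) `<=` Omega.
Proof. by move=> x; exact: mesh_interior. Qed.
Let cov x : Omega x -> exists n, tri (V n) x.
Proof. exact: mesh_cover. Qed.
Let mO : measurable (Omega : set mplane) := open_measurable_plane oO.

Lemma integral_indic_Omega n (F : plane -> R) :
  \int[mu]_(x in Omega) (F x * \1_(tri_int (V n)) x) = \int[mu]_x (F x * \1_(tri_int (V n)) x).
Proof. by apply: integral_plane_Omega => x nO; rewrite indicE memNset ?mulr0// => /inO. Qed.

Lemma loc_bounded_rt (a : plane) (b : R) : loc_bounded (fun x => (rt a b x).1) /\
  loc_bounded (fun x => (rt a b x).2).
Proof.
split.
  have -> : (fun x => (rt a b x).1) = affine b 0 a.1.
    by apply/funext => x; rewrite /rt /affine /= /GRing.scale /=; ring.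
  exact: loc_bounded_affine.
have -> : (fun x => (rt a b x).2) = affine 0 b a.2.
  by apply/funext => x; rewrite /rt /affine /= /GRing.scale /=; ring.
exact: loc_bounded_affine.
Qed.

Lemma test_measurable phi e : e = e1 \/ e = e2 -> (forall k, Ck k phi) ->
  loc_bounded phi /\ loc_bounded (fun x => 'D_e phi x).
Proof.
move=> he h; split; first exact/loc_bounded_cont/(Ck_cont (h 0%N)).
exact/loc_bounded_cont/(Ck_cont (Ck_derive he (h 1%N))).
Qed.

(** The values [c] of the weak divergence are still free here; [mesh_divergence] identifies them. *)
Lemma mesh_weak_div (q : plane -> plane) (d : plane -> R) a b c : L2v Omega q ->
  measurable_fun (Omega : set mplane) (d : mplane -> R) ->
  (forall n x, tri_int (V n) x -> q x = rt (a n) (b n) x) ->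
  (forall n x, tri_int (V n) x -> d x = c n) -> is_weak_div Omega q d ->
  forall phi, test_function Omega phi ->
    \sum_n \int[mu]_x ((dot (rt (a n) (b n) x) ('D_e1 phi x, 'D_e2 phi x) + c n * phi x) *
       \1_(tri_int (V n)) x) = 0.
Proof.
move=> [[mq1 _] [mq2 _]] md qE dE wq phi tphi; have := wq _ tphi.
case: tphi => hphi _.
have [lphi l1] := test_measurable (or_introl (erefl e1)) hphi.
have [_ l2] := test_measurable (or_intror (erefl e2)) hphi.
have lg n : loc_bounded (fun x => dot (rt (a n) (b n) x) ('D_e1 phi x, 'D_e2 phi x)).
  by have [r1 r2] := loc_bounded_rt (a n) (b n); apply: loc_boundedD; apply: loc_boundedM.
have lc n : loc_bounded (fun x => c n * phi x).
  by apply: loc_boundedM => //; exact: loc_bounded_cst.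
have [||_] := @integral_mesh_bounded _ _ _ _ hdet disj oO inO cov
  (fun x => dot (q x) ('D_e1 phi x, 'D_e2 phi x)) _ _ _ lg.
- by apply: measurable_funD; apply: measurable_funM => //; exact: loc_bounded_measurable.
- by move=> n x nx_; rewrite (qE n).
have [||_] := @integral_mesh_bounded _ _ _ _ hdet disj oO inO cov
  (fun x => d x * phi x) _ _ _ lc.
- by apply: measurable_funM => //; exact: loc_bounded_measurable.
- by move=> n x nx_; rewrite (dE n).
rewrite /innerv /inner => -> -> /eqP; rewrite -addr_eq0 -big_split /= => /eqP E.
rewrite -[RHS]E; apply: eq_bigr => n _.
rewrite -integral_planeD; first by apply: eq_Rintegral => x _; rewrite mulrDl.
- by apply: bounded_suppMl => //; exact: bounded_supp_tri_int.
- by apply: bounded_suppMl => //; exact: bounded_supp_tri_int.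
Qed.

(** Inside a triangle the weak divergence is the classical one, [2 * b]: a bump supported in [V n]
    isolates that triangle, and its integral tends to the positive area. *)
Lemma mesh_divergence a b c :
  (forall phi, test_function Omega phi ->
    \sum_n \int[mu]_x ((dot (rt (a n) (b n) x) ('D_e1 phi x, 'D_e2 phi x) + c n * phi x) *
       \1_(tri_int (V n)) x) = 0) -> forall n, c n = 2 * b n.
Proof.
move=> hw n.
have hcst : forall q, Ck q (fun _ : plane => 1 : R) by move=> q; exact: Ck_cst.
have key k : (c n - 2 * b n) * \int[mu]_(x in Omega) (1 * bump k (V n) x) = 0.
  pose phi x := bump k (V n) x * 1.
  have tphi : test_function Omega phi by exact: (@bump_test R Omega k (V n) (fun=> 1) (hdet n) (@inO n) hcst).
  have hphi : forall q, Ck q phi by case: tphi.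
  have z x : ~ tri_int (V n) x -> phi x = 0 /\ (forall e, 'D_e phi x = 0).
    move=> nV; have nS : ~ bump_supp k (V n) x by move/bump_supp_int.
    split; first by rewrite /phi bump_off// mul0r.
    move=> e; apply: (derive_off_closed (K := bump_supp k (V n))) => //; first exact: bump_supp_closed.
    by move=> y /bump_off h; rewrite /phi h mul0r.
  have := hw _ tphi; rewrite (bigD1 n)//= big1 ?addr0; last first.
    move=> p pn; rewrite -[RHS]integral_plane0; apply: eq_Rintegral => x _.
    have [px|px] := pselect (tri_int (V p) x); last by rewrite indicE memNset ?mulr0.
    have [|-> h] := z x.
      by move=> nx_; move/eqP: pn; apply; apply: (disj px); exact: tri_int_sub.
    by rewrite !h /dot /= !mulr0 !addr0 mul0r.
  have [lphi l1] := test_measurable (or_introl (erefl e1)) hphi.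
  have [_ l2] := test_measurable (or_intror (erefl e2)) hphi.
  have [M hM] := bump_box k (fun=> 1) (hdet n).
  have bb (F : plane -> R) G : loc_bounded F -> loc_bounded G ->
      (forall x, ~ tri_int (V n) x -> G x = 0) -> bounded_supp (fun x => F x * G x).
    move=> lF lG G0; apply: bounded_suppMl => //; split => //.
    have [B hB] := tri_bounded (hdet n); exists B => x bx; apply: G0.
    by move=> /(tri_int_sub (hdet n))/hB.
  have bA := bb _ _ (loc_bounded_affine (b n) 0 (a n).1) l1 (fun x h => (z x h).2 _).
  have bB := bb _ _ (loc_bounded_affine 0 (b n) (a n).2) l2 (fun x h => (z x h).2 _).
  have bC := bb _ _ (loc_bounded_cst (c n)) lphi (fun x h => (z x h).1).
  rewrite (_ : \int[mu]_x _ = \int[mu]_x (affine (b n) 0 (a n).1 x * 'D_e1 phi x +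
      affine 0 (b n) (a n).2 x * 'D_e2 phi x + c n * phi x)); last first.
    apply: eq_Rintegral => x _; have [px|px] := pselect (tri_int (V n) x).
      rewrite indicE mem_set// mulr1; move: ('D_e1 phi x) ('D_e2 phi x) (phi x) => p q t.
      by rewrite /rt /dot /affine /= /GRing.scale /=; ring.
    by have [-> h] := z x px; rewrite !h /dot /= !mulr0 !addr0 mul0r.
  have gen (I S IA IB IC a' b' c' : R) : I = S + IC -> S = IA + IB -> IA = a' -> IB = b' ->
      IC = c' -> I = 0 -> a' + b' + c' = 0 by move=> -> -> -> -> ->.
  have bphi : bounded_supp phi.
    by have := bb _ _ (loc_bounded_cst 1) lphi (fun x h => (z x h).1);
      congr bounded_supp; apply/funext => x; rewrite mul1r.
  move=> /(gen _ _ _ _ _ _ _ _ (integral_planeD (bounded_suppD bA bB) bC)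
    (integral_planeD bA bB)
    (integral_affine_derive (b n) 0 (a n).1 k (hdet n) (or_introl erefl) hcst)
    (integral_affine_derive 0 (b n) (a n).2 k (hdet n) (or_intror erefl) hcst)
    (integral_planeZ (c n) bphi)).
  rewrite -(integral_Omega_bump k (fun=> 1) (@inO n)) (_ : \int[mu]_(x in Omega) (1 * _) =
    \int[mu]_(x in Omega) (bump k (V n) x * 1)); last by apply: eq_Rintegral => x _; exact: mulrC.
  by move: (\int[mu]_(x in _) _) => I E; rewrite -[RHS]E /e1 /e2 /=; ring.
have := bump_limit oO (hdet n) (integrable_loc_bounded oO hbox (loc_bounded_cst 1)).
move=> /(cvgM (cvg_cst (c n - 2 * b n))) lim.
have : (c n - 2 * b n) * \int[mu]_(x in Omega) (1 * \1_(tri_int (V n)) x) = 0.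
  have E : (fun=> c n - 2 * b n) \* (fun k : nat => \int[mu]_(x in Omega) (1 * bump k (V n) x)) = fun=> 0.
    by apply/funext => k; exact: key.
  by move: lim; rewrite E => /cvg_lim <-//; rewrite lim_cst.
rewrite integral_indic_Omega (_ : \int[mu]_x _ = area (V n)); last first.
  by rewrite -integral_tri_int//; apply: eq_Rintegral => x _; rewrite mul1r.
move=> /eqP; rewrite mulf_eq0 (gt_eqF (area_gt0 (hdet n))) orbF subr_eq0.
by move/eqP.
Qed.

Section Curl.
Context (u g1 g2 : plane -> R) (A B C : 'I_N -> R).
Hypothesis uE : forall n x, tri_int (V n) x -> u x = affine (A n) (B n) (C n) x.
Hypothesis w1 : weak_partials Omega e1 u g1.
Hypothesis w2 : weak_partials Omega e2 u g2.

(** The representatives [g1] and [g2] are unknown pointwise, but against a constant on a triangle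
    only their integrals matter, and [weak_partial_triangle] with [phi = 1] evaluates these. *)
Lemma integral_curl (c : 'I_N -> plane) (W : plane -> R) :
  measurable_fun (Omega : set mplane) (W : mplane -> R) ->
  (forall n x, tri_int (V n) x -> W x = dot (c n) (g2 x, - g1 x)) ->
  \int[mu]_(x in Omega) W x = \sum_n area (V n) * dot (c n) (B n, - A n).
Proof.
move=> mW WE.
have one : forall q, Ck q (fun _ : plane => 1 : R) by move=> q; exact: Ck_cst.
have h1 n := weak_partial_triangle oO hbox (hdet n) (or_introl (erefl e1)) (@inO n) (@uE n) w1 one.
have h2 n := weak_partial_triangle oO hbox (hdet n) (or_intror (erefl e2)) (@inO n) (@uE n) w2 one.
have l1 n k := L2_integrableM oO hbox w1.1 (loc_boundedM (loc_bounded_cst k)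
  (loc_bounded_indic (@tri_int_measurable R (V n)))).
have l2 n k := L2_integrableM oO hbox w2.1 (loc_boundedM (loc_bounded_cst k)
  (loc_bounded_indic (@tri_int_measurable R (V n)))).
have E n x : dot (c n) (g2 x, - g1 x) * \1_(tri_int (V n)) x =
    g2 x * ((c n).1 * \1_(tri_int (V n)) x) + g1 x * (- (c n).2 * \1_(tri_int (V n)) x).
  by rewrite /dot /=; ring.
have [|_ ->] := integral_mesh hdet disj oO cov mW WE.
  move=> n; have := integrableD mO (l2 n (c n).1) (l1 n (- (c n).2)).
  by apply: eq_integrable => // x _; rewrite /= E EFinD.
apply: eq_bigr => n _; under eq_Rintegral do rewrite E.
rewrite RintegralD//.
have R1 (g : plane -> R) k : mu.-integrable (Omega : set mplane)
    (EFin \o (fun x => g x * (1 * \1_(tri_int (V n)) x))) ->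
    \int[mu]_(x in Omega) (g x * (k * \1_(tri_int (V n)) x)) =
    k * \int[mu]_(x in Omega) (g x * 1 * \1_(tri_int (V n)) x).
  move=> ig; rewrite -RintegralZl//.
    by apply: eq_Rintegral => x _; ring.
  by apply: eq_integrable ig => // x _; rewrite /= mulrA.
rewrite (R1 _ _ (l2 n 1)) (R1 _ _ (l1 n 1)) h1 h2.
rewrite (_ : \int[mu]_x _ = area (V n)); last first.
  by rewrite -integral_tri_int//; apply: eq_Rintegral => x _; rewrite mul1r.
by rewrite /e1 /e2 /dot /=; ring.
Qed.

(* The mixed partial derivatives of the test function commute. *)
Lemma curl_weak_div_free phi : smooth phi -> test_function Omega phi ->
  \sum_n \int[mu]_x (\1_(tri_int (V n)) x *
     (dot (rt (B n, - A n) 0 x) ('D_e1 phi x, 'D_e2 phi x) + 2 * 0 * phi x)) = 0.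
Proof.
move=> [hphi sphi] tphi; have [_ [K [cK KO phi0]]] := tphi.
have h1 : @e1 R = e1 \/ @e1 R = e2 by left.
have h2 : @e2 R = e1 \/ @e2 R = e2 by right.
have kK : closed K by apply: compact_closed => //; exact: norm_hausdorff.
have tD e : e = e1 \/ e = e2 -> test_function Omega (fun x => 'D_e phi x).
  move=> he; split; first by move=> k; apply: Ck_derive.
  by exists K; split => // x; exact: derive_off_closed.
have CD e : e = e1 \/ e = e2 -> forall q, Ck q (fun x => 'D_e phi x) by move=> he q; exact: Ck_derive.
have lD e (he : e = e1 \/ e = e2) : loc_bounded (fun x => 'D_e phi x) := (test_measurable he hphi).2.
have T1 n := weak_partial_triangle oO hbox (hdet n) h1 (@inO n) (@uE n) w1 (CD _ h2).
have T2 n := weak_partial_triangle oO hbox (hdet n) h2 (@inO n) (@uE n) w2 (CD _ h1).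
have S (g : plane -> R) e : L2 Omega g -> e = e1 \/ e = e2 ->
    \int[mu]_(x in Omega) (g x * 'D_e phi x) =
    \sum_n \int[mu]_(x in Omega) (g x * 'D_e phi x * \1_(tri_int (V n)) x).
  move=> Lg he; have [||_ ->//] := @integral_mesh _ _ _ _ hdet disj oO cov
     (fun x => g x * 'D_e phi x) (fun _ x => g x * 'D_e phi x) _ (fun _ _ _ => erefl).
    by apply: measurable_funM; [case: Lg|exact: loc_bounded_measurable (lD _ he)].
  move=> n; have := L2_integrableM oO hbox Lg (loc_boundedM (lD _ he)
    (loc_bounded_indic (@tri_int_measurable R (V n)))).
  by apply: eq_integrable => // x _; rewrite /= mulrA.
have E1 := w1.2 _ (tD _ h2); have E2 := w2.2 _ (tD _ h1).
rewrite /inner S// in E1; last exact: w1.1.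
rewrite /inner S// in E2; last exact: w2.1.
have sw : \int[mu]_(x in Omega) (u x * 'D_e2 (fun y => 'D_e1 phi y) x) =
    \int[mu]_(x in Omega) (u x * 'D_e1 (fun y => 'D_e2 phi y) x).
  apply: eq_Rintegral => x _; exact: (congr1 (fun t => u x * t) (sphi e2 e1 x h2 h1)).
rewrite sw E1 in E2; move/oppr_inj/esym/eqP: E2; rewrite -subr_eq0 -sumrB => /eqP E2.
rewrite -[RHS]E2; apply: eq_bigr => n _; rewrite T1 T2.
have bD e (he : e = e1 \/ e = e2) k : bounded_supp (fun x => k * ('D_e phi x * \1_(tri_int (V n)) x)).
  apply: bounded_suppMl; first exact: loc_bounded_cst.
  by apply: bounded_suppMl; [exact: lD|exact: bounded_supp_tri_int].
have bD1 e (he : e = e1 \/ e = e2) : bounded_supp (fun x => 'D_e phi x * \1_(tri_int (V n)) x).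
  by apply: bounded_suppMl; [exact: lD|exact: bounded_supp_tri_int].
transitivity (\int[mu]_x (B n * ('D_e1 phi x * \1_(tri_int (V n)) x) +
    (- A n) * ('D_e2 phi x * \1_(tri_int (V n)) x))).
  apply: eq_Rintegral => x _; rewrite /dot /rt /=.
  by move: ('D_e1 phi x) ('D_e2 phi x) => p q; rewrite /= /GRing.scale /=; ring.
rewrite integral_planeD; [|exact: bD|exact: bD].
rewrite !integral_planeZ; [|exact: bD1|exact: bD1].
have alg (P Q : R) : B n * P + - A n * Q =
    (A n * (@e2 R).1 + B n * (@e2 R).2) * P - (A n * (@e1 R).1 + B n * (@e1 R).2) * Q.
  by rewrite /e1 /e2 /=; ring.
exact: alg.
Qed.

End Curl.
End MeshWeak.

Lemma poly2_affine (R : realType) (a b c : R) : poly2 1 (affine a b c).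
Proof.
exists (fun i j => if i == 1%N then a else if j == 1%N then b else c) => x.
rewrite !big_ord_recl big_ord0 /= big_mkcond /= [in X in _ + (X + _)]big_mkcond /=.
by rewrite !big_ord_recl !big_ord0 /= /fintype.bump /= /affine !expr0 !expr1; ring.
Qed.

Lemma poly2_cst (R : realType) (c : R) : poly2 0 (fun=> c).
Proof.
exists (fun _ _ => c) => x; rewrite big_ord_recl big_ord0 /= big_mkcond /= big_ord_recl big_ord0 /=.
by rewrite !expr0; ring.
Qed.

(** Near each [t] the bounds on its two sides add up, which is what [interval_induction] asks
    for. *)
Lemma pointwise_lipschitz (R : realType) (g : R -> R) (C : R) :
  (forall t : R, \forall s \near t, `|g s - g t| <= C * `|s - t|) ->
  forall s t, `|g s - g t| <= C * `|s - t|.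
Proof.
move=> hg.
have key (a b : R) : a <= b -> `|g b - g a| <= C * (b - a).
  move=> ab; pose P x y := `|g y - g x| <= C * (y - x).
  apply: (@interval_induction R P) => //.
    move=> x y z _ _; rewrite /P => h1 h2.
    rewrite (_ : g z - g x = (g z - g y) + (g y - g x)); last by ring.
    by rewrite (le_trans (ler_normD _ _))// (_ : C * (z - x) = C * (z - y) + C * (y - x)) ?lerD//; ring.
  move=> t _; have /nbhs_ballP[d /= d0 hd] := hg t; exists d => // x y /andP[_ xt] /andP[ty _] dx dy.
  have := hd x; rewrite /ball /= ger0_norm ?subr_ge0// ltrBlDr -ltrBlDl => /(_ dx).
  have := hd y; rewrite /ball /= ler0_norm ?subr_le0// opprB ltrBlDr addrC => /(_ dy).
  have -> : `|y - t| = y - t by rewrite ger0_norm// subr_ge0.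
  have -> : `|x - t| = - (x - t) by rewrite ler0_norm// subr_le0.
  move=> h1 h2; rewrite /P.
  rewrite (_ : g y - g x = (g y - g t) - (g x - g t)); last by ring.
  rewrite (le_trans (ler_normB _ _))// (_ : C * (y - x) = C * (y - t) + C * (- (x - t))) ?lerD//.
  by ring.
move=> s t; have [st|ts] := leP s t.
  by rewrite distrC (distrC s) [X in _ <= _ * X]ger0_norm ?subr_ge0// key.
by rewrite [X in _ <= _ * X]ger0_norm ?subr_ge0 ?key// ltW.
Qed.

(** * The potential as an admissible test function of the mixed problem *)

Section MeshPotential.
Context {R : realType}.
Local Notation plane := (R * R)%type.
Local Notation mplane := (measurableTypeR R * measurableTypeR R)%type.
Local Notation mu := (@lebesgue2 R).
Context {N : nat} (V : 'I_N -> 'I_3 -> plane) (Omega : set plane).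
Implicit Types (m n : 'I_N) (i j : 'I_3) (x y : plane).
Hypothesis hdet : forall n, det3 (V n) != 0.
Hypothesis hreg : regular_mesh V.
Hypothesis oO : open Omega.
Hypothesis hint : (closure Omega)° `<=` Omega.
Hypothesis hcl : forall x, closure Omega x <-> exists n, tri (V n) x.

Context (M0 : R).
Hypothesis hbox : Omega `<=` box M0.

Let disj m n x : tri_int (V m) x -> tri (V n) x -> m = n.
Proof. exact: mesh_interior_disjoint. Qed.
Let inO n : tri_int (V n) `<=` Omega.
Proof. by move=> x; exact: mesh_interior. Qed.
Let cov x : Omega x -> exists n, tri (V n) x.
Proof. exact: mesh_cover. Qed.
Let mO : measurable (Omega : set mplane) := open_measurable_plane oO.

(** Zero on the edges and outside the mesh, hence measurable on the whole plane however the pieces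
    match. *)
Definition mesh_fun (F : 'I_N -> plane -> R) x : R := \sum_n F n x * \1_(tri_int (V n)) x.

Lemma mesh_funE F n x : tri_int (V n) x -> mesh_fun F x = F n x.
Proof. exact: (sum_indic hdet disj). Qed.

Lemma mesh_fun_bounded F : (forall n, loc_bounded (F n)) -> bounded_supp (mesh_fun F).
Proof.
move=> hF; apply: bounded_supp_sum => n.
by apply: bounded_suppMl => //; exact: bounded_supp_tri_int.
Qed.

Lemma mesh_fun_measurable F : (forall n, loc_bounded (F n)) ->
  measurable_fun (Omega : set mplane) (mesh_fun F : mplane -> R).
Proof. by move=> /mesh_fun_bounded [h _]; exact: loc_bounded_measurable. Qed.

Lemma mesh_fun_L2 F : (forall n, loc_bounded (F n)) -> L2 Omega (mesh_fun F).
Proof.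
move=> hF; have mF := mesh_fun_measurable hF; split => //.
have [|||] := @integral_mesh_bounded _ _ _ _ hdet disj oO inO cov
  (fun x => mesh_fun F x ^+ 2) (fun n x => F n x * F n x); last by [].
- exact: measurable_funX.
- by move=> n x nx_; rewrite (mesh_funE F nx_) expr2.
by move=> n; exact: loc_boundedM.
Qed.

Context (w : 'I_N -> plane) (beta : plane -> R).
Hypothesis hw : forall m n x y, tri (V m) x -> tri (V n) x -> tri (V m) y ->
  tri (V n) y -> dot (w m) (y - x) = dot (w n) (y - x).
Hypothesis hbeta : forall x, Omega x -> \forall y \near x, step V w x y (beta y - beta x).

Let cen n : plane := comb (V n) (fun=> 3^-1).

Let cen_int n : tri_int (V n) (cen n).
Proof.
by move=> i; rewrite lam_comb//; field.
Qed.

(** The affine function of gradient [w n] normalised at the barycentre, an interior point, where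
    [potential_affine] links it to [beta]. *)
Definition potential n : plane -> R :=
  affine (w n).1 (w n).2 (beta (cen n) - dot (w n) (cen n)).

Lemma potentialE n x : Omega x -> tri (V n) x -> beta x = potential n x.
Proof.
move=> Ox nx_; have := potential_affine hdet hw _ hbeta Ox nx_ (@cen_int n).
move=> /(_ (fun m x h => @inO m x h)).
rewrite /potential /affine /dot /=; move: (cen n) => [? ?] /=; lra.
Qed.

Lemma loc_bounded_potential n : loc_bounded (potential n).
Proof. exact: loc_bounded_affine. Qed.

Lemma potential_bounded : exists2 B, 0 <= B & forall x, Omega x -> `|beta x| <= B.
Proof.
have h n : exists C : R, forall x, box M0 x -> `|potential n x| <= C.
  by have [_ ] := loc_bounded_potential n; exact.
have /choice[C hC] := h.
exists (\sum_n `|C n|); first exact: sumr_ge0.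
move=> x Ox; have [n nx_] := cov Ox; rewrite (potentialE Ox nx_).
apply: le_trans (hC n x (hbox Ox)) _; rewrite (bigD1 n)//= (le_trans (ler_norm _))//.
by rewrite lerDl sumr_ge0.
Qed.

Lemma step_bounded e : e = e1 \/ e = e2 -> exists2 C, 0 <= C &
  forall n (s : R), `|dot (w n) (s *: e)| <= C * `|s|.
Proof.
move=> he; exists (\sum_n (`|(w n).1| + `|(w n).2|)).
  by apply: sumr_ge0 => n _; exact: addr_ge0.
move=> n s; have -> : dot (w n) (s *: e) = s * dot (w n) e.
  by rewrite /dot /= /GRing.scale /=; ring.
rewrite normrM mulrC ler_wpM2r//.
have h : `|dot (w n) e| <= `|(w n).1| + `|(w n).2|.
  by case: he => ->; rewrite /dot /e1 /e2 /= mulr1 mulr0 ?addr0 ?add0r ?lerDl ?lerDr.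
by apply: le_trans h _; rewrite (bigD1 n)//= lerDl sumr_ge0// => m _; exact: addr_ge0.
Qed.

Section TestFunction.
Variables (phi : plane -> R) (K : set plane).
Hypotheses (hphi : forall k, Ck k phi) (cK : compact K) (KO : K `<=` Omega).
Hypothesis phi0 : forall x, ~ K x -> phi x = 0.

Let kK : closed K.
Proof. by apply: compact_closed => //; exact: norm_hausdorff. Qed.

Let phiO x : ~ Omega x -> nbhs x [set y | phi y = 0].
Proof.
move=> nO; have : nbhs x (~` K).
  by apply: open_nbhs_nbhs; split; [exact: closed_openC|move=> /KO].
by apply: filterS => y; exact: phi0.
Qed.

Let bphi : bounded_supp phi.
Proof.
split; first exact/loc_bounded_cont/(Ck_cont (hphi 0%N)).
by exists M0 => x bx; apply: phi0 => /KO/hbox.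
Qed.

Let bD e : e = e1 \/ e = e2 -> bounded_supp (fun x => 'D_e phi x).
Proof.
move=> he; split; first exact/loc_bounded_cont/(Ck_cont (Ck_derive he (hphi 1%N))).
exists M0 => x bx; have nK : ~ K x by move=> /KO/hbox.
exact: (@derive_off_closed R phi K e x kK phi0 nK).
Qed.

(** A uniform bound near each point suffices. Near a point of [Omega] the local increments of [beta]
    give it; near any other point [phi] vanishes, its support being compact in [Omega], and so the
    values of [beta] outside are irrelevant. *)
Lemma potential_test_lipschitz e : e = e1 \/ e = e2 -> exists C : R, forall x (s t : R),
  `|beta (s *: e + x) * phi (s *: e + x) - beta (t *: e + x) * phi (t *: e + x)| <= C * `|s - t|.
Proof.
move=> he; have [W W0 hW] := step_bounded he; have [B B0 hB] := potential_bounded.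
have [C1 [_ [C10 _ hC1 _]]] := bounded_supp_bound bphi.
have [C2 [_ [C20 _ hC2 _]]] := bounded_supp_bound (bD he).
have hl x (s t : R) : `|phi (s *: e + x) - phi (t *: e + x)| <= C2 * `|s - t|.
  have h (a b : R) : a < b -> `|phi (b *: e + x) - phi (a *: e + x)| <= C2 * `|b - a|.
    move=> ab; rewrite (_ : b *: e + x = (b - a) *: e + (a *: e + x)).
      rewrite [X in _ <= _ * X]gtr0_norm ?subr_gt0//.
      by apply: (Ck_line_bound he (hphi 1%N) hC2); rewrite subr_gt0.
    by rewrite addrA -scalerDl subrK.
  have [st|st|->] := ltgtP s t; last by rewrite !subrr normr0 mulr0.
    by rewrite distrC (distrC s); exact: h.
  exact: h.
(* Product rule: [W] bounds the slopes of [beta], [C1] the test function, [B] the potential on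
   [Omega] and [C2] the derivative of the test function. *)
exists (W * C1 + B * C2) => x.
apply: (@pointwise_lipschitz R (fun s => beta (s *: e + x) * phi (s *: e + x))) => t.
have cg : (s *: e + x) @[s --> t] --> t *: e + x.
  by apply: cvgD; [apply: cvgZr_tmp; exact: cvg_id|exact: cvg_cst].
have [Oz|nO] := pselect (Omega (t *: e + x)); last first.
  have z : phi (t *: e + x) = 0 by exact: nbhs_singleton (phiO nO).
  have : nbhs t [set s : R | phi (s *: e + x) = 0] by exact: cg (phiO nO).
  by apply: filterS => s /= ->; rewrite z !mulr0 subrr normr0 !mulr_ge0 ?addr_ge0 ?mulr_ge0.
have : nbhs t [set s : R | step V w (t *: e + x) (s *: e + x) (beta (s *: e + x) - beta (t *: e + x))].
  by exact: cg (hbeta Oz).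
apply: filterS => s [n [_ _ E]].
rewrite (_ : _ - _ = (beta (s *: e + x) - beta (t *: e + x)) * phi (s *: e + x) +
   beta (t *: e + x) * (phi (s *: e + x) - phi (t *: e + x))); last by ring.
rewrite (le_trans (ler_normD _ _))// [leRHS]mulrDl lerD// normrM.
  rewrite mulrAC ler_pM// E opprD addrACA subrr addr0 -scalerBl; exact: hW.
by rewrite -mulrA ler_pM// hB.
Qed.

(** Any two points are joined by one move along each axis. *)
Lemma potential_test_cont : continuous (fun x => beta x * phi x).
Proof.
have [C hC] := potential_test_lipschitz (or_introl (erefl e1)).
have [C' hC'] := potential_test_lipschitz (or_intror (erefl e2)).
pose psi x := beta x * phi x; rewrite -/psi.
have h x y : `|psi x - psi y| <= `|C| * `|x.1 - y.1| + `|C'| * `|x.2 - y.2|.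
  have h1 : `|psi (x.1, x.2) - psi (y.1, x.2)| <= C * `|x.1 - y.1|.
    have := hC (0, x.2) x.1 y.1.
    have E (t : R) : t *: e1 + (0, x.2) = (t, x.2).
      by rewrite /e1; congr pair; rewrite /= /GRing.scale /= ?mulr1 ?addr0 ?mulr0 ?add0r.
    by rewrite !E.
  have h2 : `|psi (y.1, x.2) - psi (y.1, y.2)| <= C' * `|x.2 - y.2|.
    have := hC' (y.1, 0) x.2 y.2.
    have E (t : R) : t *: e2 + (y.1, 0) = (y.1, t).
      by rewrite /e2; congr pair; rewrite /= /GRing.scale /= ?mulr1 ?addr0 ?mulr0 ?add0r.
    by rewrite !E.
  rewrite (_ : psi x - psi y = (psi (x.1, x.2) - psi (y.1, x.2)) + (psi (y.1, x.2) - psi (y.1, y.2))).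
    rewrite (le_trans (ler_normD _ _))// lerD//.
      by apply: le_trans h1 _; rewrite ler_wpM2r// ler_norm.
    by apply: le_trans h2 _; rewrite ler_wpM2r// ler_norm.
  by case: x y {h1 h2} => [? ?] [? ?] /=; ring.
move=> x; apply/cvgrPdist_le => /= e e0; near=> y.
apply: le_trans (h x y) _.
have K0 : 0 < `|C| + `|C'| + 1 by rewrite ltr_wpDl// addr_ge0.
have : `|x - y| <= e / (`|C| + `|C'| + 1).
  by near: y; apply: cvgr_dist_le; [exact: cvg_id|exact: divr_gt0].
rewrite prod_normE /= ge_max => /andP[a1 a2].
apply: (@le_trans _ _ ((`|C| + `|C'|) * (e / (`|C| + `|C'| + 1)))).
  by rewrite mulrDl lerD// ler_wpM2l.
by rewrite mulrCA ger_pMr// ler_pdivrMr// mul1r lerDl.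
Unshelve. all: by end_near. Qed.

(** Off the skeleton [beta * phi] has the classical derivative [mesh_fun F], and
    [integral_derivative0] tolerates a null set of exceptions. *)
Lemma potential_by_parts e : e = e1 \/ e = e2 ->
  \sum_n \int[mu]_x (potential n x * 'D_e phi x * \1_(tri_int (V n)) x) =
  - \sum_n \int[mu]_x (dot (w n) e * phi x * \1_(tri_int (V n)) x).
Proof.
move=> he; pose psi x := beta x * phi x.
have bpsi : bounded_supp psi.
  split; first exact/loc_bounded_cont/potential_test_cont.
  by exists M0 => x bx; rewrite /psi phi0 ?mulr0// => /KO/hbox.
pose F n x := potential n x * 'D_e phi x + dot (w n) e * phi x.
have [bp _] := bphi; have [bDp _] := bD he.
have lF1 n : loc_bounded (fun x => potential n x * 'D_e phi x).
  by apply: loc_boundedM => //; exact: loc_bounded_potential.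
have lF2 n : loc_bounded (fun x => dot (w n) e * phi x).
  by apply: loc_boundedM => //; exact: loc_bounded_cst.
have lF n : loc_bounded (F n) by exact: loc_boundedD.
have [C hC] := potential_test_lipschitz he.
have I0 : \int[mu]_x mesh_fun F x = 0.
  apply: (@integral_derivative0 _ e psi _ C (skeleton V)) => //.
  - exact: mesh_fun_bounded.
  - exact: skeleton_measurable.
  - exact: skeleton_null.
  - move=> h x /andP[h0 _]; have := hC x h 0.
    by rewrite scale0r add0r subr0 (gtr0_norm h0).
  - move=> x nS; apply: cvg_harmonic_derive.
    have [Ox|nO] := pselect (Omega x).
      have [n nx_] := cover_off_skeleton hdet cov Ox nS.
      rewrite (mesh_funE F nx_).
      have : is_derive x e (fun y => potential n y * phi y) (dot (w n) e * phi x + potential n x * 'D_e phi x).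
        by apply: is_derive_mul; [exact: is_derive_affine|exact: Ck_is_derive he (hphi 1%N)].
      rewrite addrC; apply: near_eq_is_derive.
      have : nbhs x (tri_int (V n)) by apply: open_nbhs_nbhs; split => //; exact: tri_int_open.
      apply: filterS => y ny; rewrite /psi (potentialE (inO ny) (tri_int_sub (hdet n) ny)).
      by [].
    rewrite /mesh_fun (sum_indic_off inO)//.
    apply: (@near_eq_is_derive _ _ _ (cst 0)).
    by have := phiO nO; apply: filterS => y /= h; rewrite /psi h mulr0.
have B n (G : plane -> R) : loc_bounded G -> bounded_supp (fun x => G x * \1_(tri_int (V n)) x).
  by move=> lG; apply: bounded_suppMl => //; exact: bounded_supp_tri_int.
apply/eqP; rewrite -addr_eq0 -big_split /=; apply/eqP; rewrite -[RHS]I0.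
rewrite integral_plane_sum; last by move=> n; exact: B.
apply: eq_bigr => n _; rewrite -integral_planeD; [|exact: B (lF1 n)|exact: B (lF2 n)].
by apply: eq_Rintegral => x _; exact/esym/mulrDl.
Qed.

End TestFunction.

Lemma potential_weak_partial e : e = e1 \/ e = e2 ->
  weak_partials Omega e (mesh_fun potential) (mesh_fun (fun n _ => dot (w n) e)).
Proof.
move=> he; have lc n : loc_bounded (fun _ : plane => dot (w n) e) by exact: loc_bounded_cst.
split; first exact: mesh_fun_L2.
move=> phi [hphi [K [cK KO phi0]]].
have lp : loc_bounded phi by exact/loc_bounded_cont/(Ck_cont (hphi 0%N)).
have lD : loc_bounded (fun x => 'D_e phi x) by exact/loc_bounded_cont/(Ck_cont (Ck_derive he (hphi 1%N))).
have [|||_] := @integral_mesh_bounded _ _ _ _ hdet disj oO inO cov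
  (fun x => mesh_fun potential x * 'D_e phi x) (fun n x => potential n x * 'D_e phi x).
- apply: measurable_funM; last exact: loc_bounded_measurable.
  by apply: mesh_fun_measurable => n; exact: loc_bounded_potential.
- by move=> n x nx_; rewrite (mesh_funE potential nx_).
- by move=> n; apply: loc_boundedM => //; exact: loc_bounded_potential.
have [|||_] := @integral_mesh_bounded _ _ _ _ hdet disj oO inO cov
  (fun x => mesh_fun (fun n _ => dot (w n) e) x * phi x) (fun n x => dot (w n) e * phi x).
- by apply: measurable_funM; [exact: mesh_fun_measurable|exact: loc_bounded_measurable].
- by move=> n x nx_; rewrite (mesh_funE (fun n _ => dot (w n) e) nx_).
- by move=> n; apply: loc_boundedM.
rewrite /inner => -> ->; exact: (potential_by_parts hphi cK KO phi0 he).
Qed.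

Lemma potential_Y : \sum_n \int[mu]_x (potential n x * \1_(tri_int (V n)) x) = 0 ->
  Y Omega (mesh_fun potential).
Proof.
move=> mean0; have L : L2 Omega (mesh_fun potential).
  by apply: mesh_fun_L2 => n; exact: loc_bounded_potential.
split; first split => //.
- by eexists; apply: potential_weak_partial; left.
- by eexists; apply: potential_weak_partial; right.
split => //; have [|||_ ->//] := @integral_mesh_bounded _ _ _ _ hdet disj oO inO cov
  (mesh_fun potential) potential.
- by apply: mesh_fun_measurable => n; exact: loc_bounded_potential.
- by move=> n x; exact: mesh_funE.
- exact: loc_bounded_potential.
Qed.

End MeshPotential.

(** * Traces at midpoints *)

Section CRTraces.
Context {R : realType}.
Local Notation plane := (R * R)%type.
Implicit Types (V : 'I_3 -> plane) (i j : 'I_3) (X : 'I_3 -> R) (x : plane).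

Lemma poly2_1P (p : plane -> R) : poly2 1 p -> exists a b c, forall x, p x = affine a b c x.
Proof.
move=> [c hc]; exists (c 1 0)%N, (c 0 1)%N, (c 0 0)%N => x; rewrite hc.
rewrite !big_ord_recl big_ord0 /= big_mkcond /= [in X in _ + (X + _)]big_mkcond /=.
by rewrite !big_ord_recl !big_ord0 /= /fintype.bump /= /affine !expr0 !expr1; ring.
Qed.

Lemma poly2_0P (p : plane -> R) : poly2 0 p -> exists c, forall x, p x = c.
Proof.
move=> [c hc]; exists (c 0 0)%N => x; rewrite hc.
rewrite big_ord_recl big_ord0 /= big_mkcond /= big_ord_recl big_ord0 /=.
by rewrite !expr0; ring.
Qed.

Lemma cr_affine V X x : cr V X x = affine (cr_grad V X).1 (cr_grad V X).2 (cr V X 0) x.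
Proof. by rewrite /cr /cr_grad /lam /affine !sum3 /= /GRing.scale /=; ring. Qed.

Definition mid V i : plane := midpoint (V (nx i)) (V (nx (nx i))).

Lemma mid_edge V i : edge_of V i (V (nx i)) (V (nx (nx i))). Proof. by left. Qed.

Lemma edge_of_mid V i a b : edge_of V i a b -> midpoint a b = mid V i.
Proof. by case=> -[-> ->] //; rewrite /midpoint addrC. Qed.

Lemma lam_mid V i l : det3 V != 0 -> lam V l (mid V i) = if l == i then 0 else 2^-1.
Proof. by move=> D0; exact: edge_of_lam D0 (mid_edge V i). Qed.

Lemma cr_mid V X i : det3 V != 0 -> cr V X (mid V i) = X i.
Proof.
move=> D0; rewrite /cr (bigD1 i)//= lam_mid// eqxx mulr0 subr0 mulr1 big1 ?addr0// => l li.
by rewrite lam_mid// (negPf li) divff ?subrr ?mulr0// pnatr_eq0.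
Qed.

Lemma affine_cr V (a b c : R) x : det3 V != 0 ->
  affine a b c x = cr V (fun i => affine a b c (mid V i)) x.
Proof.
move=> D0; rewrite /cr sum3 (affine_lam a b c x D0); have := lam_sum x D0.
have E i : affine a b c (mid V i) = 2^-1 * (affine a b c (V (nx i)) + affine a b c (V (nx (nx i)))).
  by rewrite /mid /midpoint /affine /= /GRing.scale /=; field.
rewrite !E /nx /=; move: (lam V i0 x) (lam V i1 x) (lam V i2 x) => p q r pqr.
rewrite (_ : p = 1 - q - r); first by field.
by rewrite -pqr; ring.
Qed.

Lemma closure_tri_int V x : det3 V != 0 -> tri V x -> closure (tri_int V) x.
Proof.
move=> D0 Tx B xB; pose c := comb V (fun=> 3^-1).
have hc i : lam V i c = 3^-1 by rewrite lam_comb//; field.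
have := nbhs_line (c - x) xB => /nbhs_ballP[e /= e0 /(_ (Num.min (e / 2) 1))].
set t := Num.min _ _; have t0 : 0 < t by rewrite lt_min ltr01 divr_gt0.
have t1 : t <= 1 by rewrite ge_min lexx orbT.
rewrite /ball /= sub0r normrN gtr0_norm// gt_min ltr_pdivrMr// ltr_pMr// ltr1n /= => /(_ isT) Bt.
exists (x + t *: (c - x)); split => // i; rewrite lamD hc.
by move/triP : Tx => /(_ D0 i); move: (lam V i x) => u ?; nra.
Qed.

(** A point of the closed triangle is a limit of interior points, so the filter is proper and the
    limit unique; the continuous extension [p] provides it. *)
Lemma trace_tri V (u p : plane -> R) x l : det3 V != 0 -> tri V x -> continuous p ->
  (forall y, tri_int V y -> u y = p y) -> trace_at (tri V) u x l <-> l = p x.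
Proof.
move=> D0 Tx cp up; rewrite /trace_at interior_tri// -/(tri_int V).
have PF := within_nbhs_proper (closure_tri_int D0 Tx).
have lim : u @ within (tri_int V) (nbhs x) --> p x.
  have : p @ within (tri_int V) (nbhs x) --> p x by apply: cvg_within_filter; exact: cp.
  apply: cvg_trans; apply: near_eq_cvg.
  have : nbhs x [set y | tri_int V y -> p y = u y] by apply: filterE => y /up ->.
  by [].
split => [h|-> //].
by apply: (cvg_unique _ h lim); exact: norm_hausdorff.
Qed.

End CRTraces.

(** * The Crouzeix-Raviart space described by midpoint values *)

Section MeshCR.
Context {R : realType}.
Local Notation plane := (R * R)%type.
Local Notation mplane := (measurableTypeR R * measurableTypeR R)%type.
Local Notation mu := (@lebesgue2 R).
Context {N : nat} (V : 'I_N -> 'I_3 -> plane) (Omega : set plane).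
Implicit Types (m n : 'I_N) (i j : 'I_3) (x y : plane).
Hypothesis hdet : forall n, det3 (V n) != 0.
Hypothesis hreg : regular_mesh V.
Hypothesis oO : open Omega.
Hypothesis hint : (closure Omega)° `<=` Omega.
Hypothesis hcl : forall x, closure Omega x <-> exists n, tri (V n) x.

Context (M0 : R).
Hypothesis hbox : Omega `<=` box M0.

Let disj m n x : tri_int (V m) x -> tri (V n) x -> m = n.
Proof. exact: mesh_interior_disjoint. Qed.
Let inO n : tri_int (V n) `<=` Omega.
Proof. by move=> x; exact: mesh_interior. Qed.
Let cov x : Omega x -> exists n, tri (V n) x.
Proof. exact: mesh_cover. Qed.
Let mO : measurable (Omega : set mplane) := open_measurable_plane oO.

Context (Tr : set (set plane)).
Hypothesis hTr : forall T, Tr T <-> exists n, T = tri (V n).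

Lemma adjacent_not_boundary p q a b : adjacent V p q -> edge_of (V p.1) p.2 a b ->
  ~ (segment a b `<=` boundary Omega).
Proof.
move=> [pq h] e; have Om : Omega (midpoint a b).
  rewrite (edge_of_mid e); apply: (mesh_shared_edge hdet hreg hint hcl pq h).
    by rewrite lam_mid// eqxx.
  by move=> l li; rewrite lam_mid// (negPf li).
have sm : segment a b (midpoint a b).
  exists 2^-1; split; first by apply/andP; split; lra.
  by rewrite /midpoint scalerDr; congr (_ *: _ + _); field.
by move=> /(_ _ sm) [_]; move/interior_id : oO => ->.
Qed.

Lemma tri_mid m i : tri (V m) (mid (V m) i).
Proof. by apply/triP => // l; rewrite lam_mid//; case: ifP. Qed.

Lemma CR10_data v : CR10 Omega Tr v -> exists2 X, cr_data V X &
  forall n x, tri_int (V n) x -> v x = cr (V n) (X n) x.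
Proof.
move=> [[_ hv] h1 h2].
have /choice[p hp] n : exists p : R * R * R, forall x, tri_int (V n) x -> v x = affine p.1.1 p.1.2 p.2 x.
  have [|q /poly2_1P[a [b [c hq]]] vq] := hv (tri (V n)); first by apply/hTr; exists n.
  exists (a, b, c) => x nx_; rewrite -hq; apply: vq; by rewrite interior_tri.
pose A n := affine (p n).1.1 (p n).1.2 (p n).2.
have cA n : continuous (A n) by exact: continuous_affine.
exists (fun n i => A n (mid (V n) i)); last first.
  by move=> n x nx_; rewrite (hp n)//; exact: affine_cr.
have T n : Tr (tri (V n)) by apply/hTr; exists n.
split=> [[m i] [n j] /= [/= mn h]|[m i] /= h].
  have ei := mid_edge (V m) i; have ej := nbr_edge_of h ei.
  have [l []] := h1 _ _ _ _ (T m) (T n) (edge_of_is_edge (hdet m) ei) (edge_of_is_edge (hdet n) ej)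
    (@adjacent_not_boundary (m, i) (n, j) _ _ (conj mn h) ei).
  move=> /(trace_tri _ (hdet m) (tri_mid m i) (cA m) (hp m)) <-.
  rewrite (edge_of_mid ej) => /(trace_tri _ (hdet n) (tri_mid n j) (cA n) (hp n)) -> //.
have ei := mid_edge (V m) i.
have /contrapT sb : ~ ~ (segment (V m (nx i)) (V m (nx (nx i))) `<=` boundary Omega).
  by move=> /(edge_not_boundary hdet hreg oO hcl ei) [n [j ?]]; exact: (h (n, j)).
have := h2 _ _ _ (T m) (edge_of_is_edge (hdet m) ei) sb.
by move=> /(trace_tri _ (hdet m) (tri_mid m i) (cA m) (hp m)) <-.
Qed.

Lemma cr_CR10 X : cr_data V X -> CR10 Omega Tr (mesh_fun V (fun n => cr (V n) (X n))).
Proof.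
move=> [X1 X0]; pose v := mesh_fun V (fun n => cr (V n) (X n)); rewrite -/v.
have vE n x : tri_int (V n) x -> v x = cr (V n) (X n) x.
  by move=> nx_; rewrite /v (mesh_funE hdet hreg _ nx_).
have crE n : cr (V n) (X n) = affine (cr_grad (V n) (X n)).1 (cr_grad (V n) (X n)).2 (cr (V n) (X n) 0).
  by apply/funext => x; exact: cr_affine.
have cc n : continuous (cr (V n) (X n)) by rewrite crE; exact: continuous_affine.
have tr n i : trace_at (tri (V n)) v (mid (V n) i) (X n i).
  by apply/(trace_tri _ (hdet n) (tri_mid n i) (cc n) (vE n)); rewrite cr_mid.
split.
- split; first by apply: mesh_fun_measurable => // n; exact: loc_bounded_cont.
  move=> T /hTr[n ->]; exists (cr (V n) (X n)); first by rewrite crE; exact: poly2_affine.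
  by move=> x; rewrite interior_tri// => /vE.
- move=> T1 T2 a b /hTr[m ->] /hTr[n ->] /(is_edge_tri (hdet m))[i ei] /(is_edge_tri (hdet n))[j ej] _.
  (* [T1] and [T2] may be the same triangle, and then both traces coincide. *)
  have [mn|mn] := pselect (m = n).
    by subst n; exists (X m i); rewrite (edge_of_mid ei).
  have adj : adjacent V (m, i) (n, j) by split => //=; exact: edge_of_nbr ei ej.
  exists (X m i); split; first by rewrite (edge_of_mid ei).
  by rewrite (X1 _ _ adj) /= (edge_of_mid ej).
- move=> T a b /hTr[m ->] /(is_edge_tri (hdet m))[i ei] sb.
  rewrite (edge_of_mid ei) (_ : 0 = X m i)//.
  by apply/esym/(X0 (m, i)) => q adj; exact: (adjacent_not_boundary adj ei).
Qed.

Definition mesh_vec (c : 'I_N -> plane) x : plane :=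
  (mesh_fun V (fun n _ => (c n).1) x, mesh_fun V (fun n _ => (c n).2) x).

Lemma mesh_vecE c n x : tri_int (V n) x -> mesh_vec c x = c n.
Proof.
move=> nx_; rewrite /mesh_vec (mesh_funE hdet hreg (fun n _ => (c n).1) nx_).
by rewrite (mesh_funE hdet hreg (fun n _ => (c n).2) nx_); case: (c n).
Qed.

(** The equality holds at every point, both sides being [0] off the open triangles. *)
Lemma gradNC_mesh v X : (forall n x, tri_int (V n) x -> v x = cr (V n) (X n) x) ->
  gradNC Tr v = mesh_vec (fun n => cr_grad (V n) (X n)).
Proof.
move=> vE; apply/funext => x; rewrite /gradNC; case: asboolP => [[T /hTr[n ->]]|h].
  rewrite interior_tri// => nx_; rewrite (mesh_vecE _ nx_).
  have D e : is_derive x e v ((cr_grad (V n) (X n)).1 * e.1 + (cr_grad (V n) (X n)).2 * e.2).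
    have := is_derive_affine (cr_grad (V n) (X n)).1 (cr_grad (V n) (X n)).2 (cr (V n) (X n) 0) x e.
    apply: near_eq_is_derive.
    have : nbhs x (tri_int (V n)) by apply: open_nbhs_nbhs; split => //; exact: tri_int_open.
    by apply: filterS => y ny; rewrite (vE n)//; exact/esym/cr_affine.
  rewrite (@derive_val _ _ _ _ _ _ _ (D e1)) (@derive_val _ _ _ _ _ _ _ (D e2)).
  by case: (cr_grad _ _) => a b; rewrite /e1 /e2 /= !mulr1 !mulr0 addr0 add0r.
have z F : mesh_fun V F x = 0.
  rewrite /mesh_fun big1// => n _; rewrite indicE memNset ?mulr0// => nx_; apply: h.
  by exists (tri (V n)); [apply/hTr; exists n|rewrite interior_tri].
by rewrite /mesh_vec !z.
Qed.

Lemma mesh_vec_measurable c : measurable_fun (Omega : set mplane) (fst \o mesh_vec c : mplane -> R) /\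
  measurable_fun (Omega : set mplane) (snd \o mesh_vec c : mplane -> R).
Proof. by split; apply: mesh_fun_measurable => // n; exact: loc_bounded_cst. Qed.

Lemma mesh_vec_Pkv c : Pkv Omega Tr 0 (mesh_vec c).
Proof.
have [m1 m2] := mesh_vec_measurable c.
split; split => // T /hTr[n ->].
  by exists (fun=> (c n).1) => [|x]; [exact: poly2_cst|
    rewrite interior_tri// => nx_; exact: (congr1 fst (mesh_vecE c nx_))].
by exists (fun=> (c n).2) => [|x]; [exact: poly2_cst|
    rewrite interior_tri// => nx_; exact: (congr1 snd (mesh_vecE c nx_))].
Qed.

Lemma innerv_const (p q : plane -> plane) (P Q : 'I_N -> plane) :
  measurable_fun (Omega : set mplane) (fst \o p : mplane -> R) ->
  measurable_fun (Omega : set mplane) (snd \o p : mplane -> R) ->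
  measurable_fun (Omega : set mplane) (fst \o q : mplane -> R) ->
  measurable_fun (Omega : set mplane) (snd \o q : mplane -> R) ->
  (forall n x, tri_int (V n) x -> p x = P n) -> (forall n x, tri_int (V n) x -> q x = Q n) ->
  innerv Omega p q = \sum_n area (V n) * dot (P n) (Q n).
Proof.
move=> mp1 mp2 mq1 mq2 pE qE.
have [|||_ E] := @integral_mesh_bounded _ _ _ _ hdet disj oO inO cov
  (fun x => dot (p x) (q x)) (fun n _ => dot (P n) (Q n)).
- by apply: measurable_funD; apply: measurable_funM.
- by move=> n x nx_; rewrite (pE n)// (qE n).
- by move=> n; exact: loc_bounded_cst.
rewrite /innerv E; apply: eq_bigr => n _.
transitivity (dot (P n) (Q n) * area (V n)); last exact: mulrC.
by rewrite -integral_tri_int//; apply: integral_planeZ; exact: bounded_supp_tri_int.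
Qed.

End MeshCR.

(** * The discrete Helmholtz decomposition *)

Section MeshMain.
Context {R : realType}.
Local Notation plane := (R * R)%type.
Local Notation mplane := (measurableTypeR R * measurableTypeR R)%type.
Local Notation mu := (@lebesgue2 R).
Context {N : nat} (V : 'I_N -> 'I_3 -> plane) (Omega : set plane).
Implicit Types (m n : 'I_N) (i j : 'I_3) (x y : plane).
Hypothesis hdet : forall n, det3 (V n) != 0.
Hypothesis hreg : regular_mesh V.
Hypothesis oO : open Omega.
Hypothesis hint : (closure Omega)° `<=` Omega.
Hypothesis hcl : forall x, closure Omega x <-> exists n, tri (V n) x.

Context (M0 : R).
Hypothesis hbox : Omega `<=` box M0.

Let disj m n x : tri_int (V m) x -> tri (V n) x -> m = n.
Proof. exact: mesh_interior_disjoint. Qed.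
Let inO n : tri_int (V n) `<=` Omega.
Proof. by move=> x; exact: mesh_interior. Qed.
Let cov x : Omega x -> exists n, tri (V n) x.
Proof. exact: mesh_cover. Qed.
Let mO : measurable (Omega : set mplane) := open_measurable_plane oO.

Context (Tr : set (set plane)).
Hypothesis hTr : forall T, Tr T <-> exists n, T = tri (V n).

(* Test with the Crouzeix-Raviart function whose only nonzero midpoint value is on
   the common edge. *)
Lemma edge_orthogonal (r : 'I_N -> plane) :
  (forall X, cr_data V X -> \sum_n area (V n) * dot (r n) (cr_grad (V n) (X n)) = 0) ->
  forall m n i j, m <> n -> nbr (V m) i (V n) j ->
    dot (r m) (gradlam (V m) i) = dot (r n) (gradlam (V m) i).
Proof.
move=> hr m n i j mn h.
pose p : 'I_N * 'I_3 := (m, i); pose q : 'I_N * 'I_3 := (n, j).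
have pq : adjacent V p q by [].
pose X n i : R := ((n, i) == p)%:R + ((n, i) == q)%:R.
have hX : cr_data V X.
  have swap s t u v : adjacent V u v -> adjacent V s t -> (s == u) = (t == v).
    move=> uv st; apply/eqP/eqP => e.
      by subst u; exact: (adjacent_unique hdet hreg st uv).
    by subst v; exact: (adjacent_unique hdet hreg (adjacent_sym st) (adjacent_sym uv)).
  split=> [s t st|s hs]; rewrite /X -!surjective_pairing.
    by rewrite (swap _ _ _ _ pq st) (swap _ _ _ _ (adjacent_sym pq) st) addrC.
  have [e|_] := eqVneq s p; first by exfalso; apply: (hs q); rewrite e.
  have [e|_] := eqVneq s q; first by exfalso; apply: (hs p); rewrite e; exact: adjacent_sym.
  by rewrite addr0.
pose D (s : 'I_N * 'I_3) : R := area (V s.1) * dot (r s.1) (gradlam (V s.1) s.2).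
have E : D p + D q = 0.
  have := hr X hX; rewrite (eq_bigr (fun n => - 2 * \sum_i X n i * D (n, i))); last first.
    by move=> k _; rewrite /cr_grad !sum3 /D /dot /= /GRing.scale /=; ring.
  rewrite -mulr_sumr pair_big /= => /eqP; rewrite mulf_eq0 oppr_eq0 pnatr_eq0 /= => /eqP.
  rewrite (eq_bigr (fun s : 'I_N * 'I_3 => (s == p)%:R * D s + (s == q)%:R * D s)); last first.
    by move=> [k l] _; rewrite /X mulrDl.
  have one s : \sum_(t : 'I_N * 'I_3) (t == s)%:R * D t = D s.
    by rewrite (bigD1 s)//= eqxx mul1r big1 ?addr0// => t /negPf ->; rewrite mul0r.
  by rewrite big_split /= !one.
have fl (a : plane) U l : flux a 0 U l = dot a (gradlam U l) by rewrite /flux mul0r subr0.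
have := nbr_flux (r n) 0 (hdet m) (hdet n) h; rewrite !fl => E2; rewrite E2.
have A := nbr_area (hdet m) (hdet n) h (nbr_opposite hdet hreg mn h).
apply: (mulfI (lt0r_neq0 (area_gt0 (hdet m)))).
by rewrite mulrA A mulNr; move/eqP: E; rewrite addr_eq0 => /eqP.
Qed.

(** [r - s] is orthogonal to [g], so in the plane its rotation by a right angle is parallel to [g]
    and thus orthogonal to [y - x]. *)
Lemma rot_tangential (r g x y : plane) : dot g (y - x) = 0 -> g.1 != 0 \/ g.2 != 0 ->
  forall s, dot r g = dot s g -> dot (- r.2, r.1) (y - x) = dot (- s.2, s.1) (y - x).
Proof.
rewrite /dot; move: (y - x) => v /= gv gn s rs.
apply/eqP; rewrite -subr_eq0; apply/eqP.
set d := (X in X = 0).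
have h1 : g.1 * d = 0.
  rewrite (_ : g.1 * d = (r.1 * g.1 + r.2 * g.2 - (s.1 * g.1 + s.2 * g.2)) * v.2 -
    (r.2 - s.2) * (g.1 * v.1 + g.2 * v.2)); last by rewrite /d; ring.
  by rewrite gv rs; ring.
have h2 : g.2 * d = 0.
  rewrite (_ : g.2 * d = (r.1 - s.1) * (g.1 * v.1 + g.2 * v.2) -
    (r.1 * g.1 + r.2 * g.2 - (s.1 * g.1 + s.2 * g.2)) * v.1); last by rewrite /d; ring.
  by rewrite gv rs; ring.
by case: gn => gn; [move/eqP: h1|move/eqP: h2]; rewrite mulf_eq0 (negPf gn) => /eqP.
Qed.

Lemma gradlam_neq0 n i : (gradlam (V n) i).1 != 0 \/ (gradlam (V n) i).2 != 0.
Proof.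
apply: contrapT => /not_orP[/negP h1 /negP h2]; rewrite !negbK in h1 h2.
have l x : lam (V n) i x = lam (V n) i 0.
  by rewrite /lam /affine (eqP h1) (eqP h2); ring.
have := lam_vertex i i (hdet n); rewrite eqxx l -(l (V n (nx i))) lam_vertex// eq_sym.
by rewrite (negPf (nx_neq i)) => /eqP; rewrite eq_sym oner_eq0.
Qed.

(** The compatibility [hw] that the potential requires. Distinct common points lie on a common edge,
    where [edge_orthogonal] controls the normal component. *)
Lemma orthogonal_tangential (r : 'I_N -> plane) :
  (forall X, cr_data V X -> \sum_n area (V n) * dot (r n) (cr_grad (V n) (X n)) = 0) ->
  forall m n x y, tri (V m) x -> tri (V n) x -> tri (V m) y -> tri (V n) y ->
    dot (- (r m).2, (r m).1) (y - x) = dot (- (r n).2, (r n).1) (y - x).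
Proof.
move=> hr m n x y mx nx_ my ny.
have [->//|mn] := pselect (m = n).
have [->|xy] := pselect (x = y); first by rewrite subrr /dot /= !mulr0.
have [i [j [h xi yi]]] := mesh_common_points hdet hreg mn xy mx nx_ my ny.
apply: (rot_tangential (g := gradlam (V m) i)).
- have : dot (gradlam (V m) i) (y - x) = lam (V m) i y - lam (V m) i x.
    by rewrite /dot /lam /affine /=; ring.
  by rewrite xi yi subrr.
- exact: gradlam_neq0.
- exact: edge_orthogonal h.
Qed.

Lemma potential_shift (w : 'I_N -> plane) beta (c : R) n x :
  potential V w (fun y => beta y - c) n x = potential V w beta n x - c.
Proof. by rewrite /potential /affine; ring. Qed.

(** Subtracting the mean [S / A] places the potential in [L20] without changing its gradient. *)
Lemma mesh_mean_zero (w : 'I_N -> plane) beta : Omega !=set0 ->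
  exists c : R, \sum_n \int[mu]_x (potential V w (fun y => beta y - c) n x * \1_(tri_int (V n)) x) = 0.
Proof.
move=> [x0 Ox0]; have [n0 _] := cov Ox0.
pose S := \sum_n \int[mu]_x (potential V w beta n x * \1_(tri_int (V n)) x).
pose A := \sum_n area (V n).
have A0 : 0 < A.
  rewrite /A (bigD1 n0)//= ltr_pwDl ?area_gt0// sumr_ge0// => n _.
  exact/ltW/area_gt0.
exists (S / A).
rewrite (eq_bigr (fun n => \int[mu]_x (potential V w beta n x * \1_(tri_int (V n)) x) +
    (- (S / A)) * area (V n))).
  by rewrite big_split /= -mulr_sumr -/S -/A; field; rewrite gt_eqF.
move=> n _; rewrite -integral_tri_int//.
have b1 : bounded_supp (fun x => potential V w beta n x * \1_(tri_int (V n)) x).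
  by apply: bounded_suppMl; [exact: loc_bounded_potential|exact: bounded_supp_tri_int].
have b2 : bounded_supp (\1_(tri_int (V n)) : plane -> R) by exact: bounded_supp_tri_int.
have b3 : bounded_supp (fun x => - (S / A) * \1_(tri_int (V n)) x).
  by apply: bounded_suppMl => //; exact: loc_bounded_cst.
rewrite -(integral_planeZ (- (S / A)) b2) -(integral_planeD b1 b3).
by apply: eq_Rintegral => x _; rewrite potential_shift; ring.
Qed.

Section Solutions.
Context (f alpha u : plane -> R) (q p : plane -> plane).
Hypothesis hsc : simply_connected Omega.
Hypothesis hne : Omega !=set0.
Hypothesis hf : Pk Omega Tr 0 f.
Hypothesis hq : RT0 Omega Tr q.
Hypothesis hdiv : is_weak_div Omega q (fun x => - f x).
Hypothesis hp : Pkv Omega Tr 0 p.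
Hypothesis halpha : Pk Omega Tr 1 alpha /\ Y Omega alpha.
Hypothesis hmix1 : forall v, Pkv Omega Tr 0 v ->
  innerv Omega p v + innerv Omega v (Curl Omega alpha) = innerv Omega q v.
Hypothesis hmix2 : forall b, Pk Omega Tr 1 b -> Y Omega b -> innerv Omega p (Curl Omega b) = 0.
Hypothesis hu : CR10 Omega Tr u.
Hypothesis hCR : forall v, CR10 Omega Tr v ->
  innerv Omega (gradNC Tr u) (gradNC Tr v) = inner Omega f v.

Let TrV n : Tr (tri (V n)). Proof. by apply/hTr; exists n. Qed.

Lemma Pk0_mesh g : Pk Omega Tr 0 g -> exists c : 'I_N -> R, forall n x, tri_int (V n) x -> g x = c n.
Proof.
move=> [_ hg]; suff h n : exists c : R, forall x, tri_int (V n) x -> g x = c.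
  by have [c hc] := choice h; exists c.
have [d /poly2_0P[c hc] gd] := hg _ (TrV n).
by exists c => x nx_; rewrite -(hc x); apply: gd; rewrite interior_tri.
Qed.

Lemma Pk1_mesh g : Pk Omega Tr 1 g -> exists c : 'I_N -> R * R * R,
  forall n x, tri_int (V n) x -> g x = affine (c n).1.1 (c n).1.2 (c n).2 x.
Proof.
move=> [_ hg]; suff h n : exists c : R * R * R, forall x, tri_int (V n) x -> g x = affine c.1.1 c.1.2 c.2 x.
  by have [c hc] := choice h; exists c.
have [d /poly2_1P[a [b [c hc]]] gd] := hg _ (TrV n).
by exists (a, b, c) => x nx_; rewrite -hc; apply: gd; rewrite interior_tri.
Qed.

Lemma RT_mesh : exists ab : 'I_N -> plane * R,
  forall n x, tri_int (V n) x -> q x = rt (ab n).1 (ab n).2 x.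
Proof.
have [_ h] := hq; suff h' n : exists ab : plane * R, forall x, tri_int (V n) x -> q x = rt ab.1 ab.2 x.
  by have [ab hab] := choice h'; exists ab.
have [a [b qE]] := h _ (TrV n).
by exists (a, b) => x nx_; apply: qE; rewrite interior_tri.
Qed.

Lemma weak_partialP b e : Y Omega b -> e = e1 \/ e = e2 ->
  weak_partials Omega e b (weak_partial Omega e b).
Proof. by move=> [[_ h1 h2] _] [] ->; apply: xgetPex; [case: h1|case: h2] => g ?; exists g. Qed.

Lemma curl_measurable b (v : plane -> plane) : Y Omega b ->
  measurable_fun (Omega : set mplane) (fst \o v : mplane -> R) ->
  measurable_fun (Omega : set mplane) (snd \o v : mplane -> R) ->
  measurable_fun (Omega : set mplane) (fun x => dot (v x) (Curl Omega b x) : R).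
Proof.
move=> Yb m1 m2.
have [[c1 _] _] := weak_partialP Yb (or_introl erefl).
have [[c2 _] _] := weak_partialP Yb (or_intror erefl).
have c1' : measurable_fun (Omega : set mplane) (fun x => - weak_partial Omega e1 b x : R).
  exact: (measurable_funN c1).
by apply: measurable_funD; apply: measurable_funM.
Qed.

(** [mesh_divergence] identifies [- f] with [2 * b] on each triangle, and [cr_orthogonal] applied to
    the Raviart-Thomas field is then the claim. *)
Lemma cr_load (ab : 'I_N -> plane * R) X : cr_data V X ->
  (forall n x, tri_int (V n) x -> q x = rt (ab n).1 (ab n).2 x) ->
  innerv Omega q (mesh_vec V (fun n => cr_grad (V n) (X n))) =
  inner Omega f (mesh_fun V (fun n => cr (V n) (X n))).
Proof.
move=> hX qE; pose g n := cr_grad (V n) (X n); pose v := mesh_fun V (fun n => cr (V n) (X n)).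
have [c fE] := Pk0_mesh hf; have [[[mq1 _] [mq2 _]] _] := hq.1; have [mf _] := hf.
have lcr n : loc_bounded (cr (V n) (X n)).
  by apply: loc_bounded_cont => x; rewrite (funext (cr_affine (V n) (X n))); exact: continuous_affine.
have weak := mesh_weak_div hdet hreg oO hint hcl (b := fun n => (ab n).2) hq.1.1
  (measurable_funN mf) qE (c := fun n => - c n) (fun n x h => congr1 -%R (fE n x h)) hdiv.
have cb := mesh_divergence hdet hreg oO hint hcl hbox weak.
have weak2 phi : smooth phi -> test_function Omega phi ->
    \sum_n \int[mu]_x (\1_(tri_int (V n)) x * (dot (rt (ab n).1 (ab n).2 x) ('D_e1 phi x, 'D_e2 phi x) +
      2 * (ab n).2 * phi x)) = 0.
  move=> _ tphi; rewrite -[RHS](weak _ tphi); apply: eq_bigr => n _; apply: eq_Rintegral => x _.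
  by rewrite -cb; exact: mulrC.
have [mv1 mv2] := mesh_vec_measurable Omega hdet g.
have lF n : loc_bounded (fun x => dot (rt (ab n).1 (ab n).2 x) (g n)).
  have [r1 r2] := loc_bounded_rt (ab n).1 (ab n).2.
  by apply: loc_boundedD; apply: loc_boundedM => //; exact: loc_bounded_cst.
have lG n : loc_bounded (fun x => c n * cr (V n) (X n) x).
  by apply: loc_boundedM => //; exact: loc_bounded_cst.
have [||_ E1] := @integral_mesh_bounded _ _ _ _ hdet disj oO inO cov
  (fun x => dot (q x) (mesh_vec V g x)) _ _ _ lF.
- by apply: measurable_funD; apply: measurable_funM.
- by move=> n x nx_; rewrite (qE n)// (mesh_vecE hdet hreg g nx_).
have [||_ E2] := @integral_mesh_bounded _ _ _ _ hdet disj oO inO cov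
  (fun x => f x * v x) _ _ _ lG.
- by apply: measurable_funM => //; apply: mesh_fun_measurable.
- by move=> n x nx_; rewrite (fE n)// /v (mesh_funE hdet hreg _ nx_).
rewrite /innerv /inner E1 E2; apply/eqP; rewrite -subr_eq0 -sumrB; apply/eqP.
rewrite -[RHS](cr_orthogonal hdet hreg hint hcl hX weak2); apply: eq_bigr => n _.
have bs G : loc_bounded G -> bounded_supp (fun x => G x * \1_(tri_int (V n)) x).
  by move=> lG'; apply: bounded_suppMl => //; exact: bounded_supp_tri_int.
rewrite -integral_planeN; last exact: bs.
rewrite -integral_planeD; [|exact: bs|exact/bounded_suppN/bs].
apply: eq_Rintegral => x _; rewrite -/(g n) -cb; ring.
Qed.

(** The instance of [cr_orthogonal] with [b = 0]: the curl of a piecewise affine function is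
    piecewise constant and weakly divergence free. *)
Lemma cr_curl X : cr_data V X ->
  innerv Omega (mesh_vec V (fun n => cr_grad (V n) (X n))) (Curl Omega alpha) = 0.
Proof.
move=> hX; have [A aE] := Pk1_mesh halpha.1.
have w1 := weak_partialP halpha.2 (or_introl erefl).
have w2 := weak_partialP halpha.2 (or_intror erefl).
pose g n := cr_grad (V n) (X n).
have [m1 m2] := mesh_vec_measurable Omega hdet g.
rewrite /innerv (integral_curl hdet hreg oO hint hcl hbox aE w1 w2 (c := g)); last 2 first.
- exact: curl_measurable halpha.2 m1 m2.
- by move=> n x nx_; rewrite (mesh_vecE hdet hreg g nx_).
have weak := curl_weak_div_free hdet hreg oO hint hcl hbox aE w1 w2.
rewrite -[RHS](cr_orthogonal hdet hreg hint hcl hX weak); apply: eq_bigr => n _.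
transitivity (\int[mu]_x (dot ((A n).1.2, - (A n).1.1) (g n) * \1_(tri_int (V n)) x)).
  rewrite integral_planeZ ?integral_tri_int//; last exact: bounded_supp_tri_int.
  by rewrite mulrC /dot; congr (_ * _); ring.
apply: eq_Rintegral => x _; rewrite -/(g n) /rt /dot /= /GRing.scale /=; ring.
Qed.

Lemma mesh_solution n x : tri_int (V n) x -> p x = gradNC Tr u x.
Proof.
have [U hU uE] := CR10_data hdet hreg oO hint hcl hTr hu.
have gu := gradNC_mesh hdet hreg hTr uE.
have [[mp1 _] [mp2 _]] := hp.
have [P1 p1E] := Pk0_mesh hp.1; have [P2 p2E] := Pk0_mesh hp.2.
pose P n : plane := (P1 n, P2 n).
have pE k y : tri_int (V k) y -> p y = P k.
  by move=> ky; rewrite /P -(p1E k y ky) -(p2E k y ky) -surjective_pairing.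
pose gU n := cr_grad (V n) (U n).
pose r n : plane := P n - gU n.
have [ab qE] := RT_mesh.
have orth X : cr_data V X -> \sum_n area (V n) * dot (r n) (cr_grad (V n) (X n)) = 0.
  move=> hX; pose v := mesh_fun V (fun n => cr (V n) (X n)).
  pose g n := cr_grad (V n) (X n).
  have gv : gradNC Tr v = mesh_vec V g.
    by apply: gradNC_mesh => // m y my; rewrite /v (mesh_funE hdet hreg _ my).
  have [mg1 mg2] := mesh_vec_measurable Omega hdet g.
  have [mu1 mu2] := mesh_vec_measurable Omega hdet gU.
  have gE := mesh_vecE hdet hreg g; have gUE := mesh_vecE hdet hreg gU.
  have := hCR (cr_CR10 hdet hreg oO hint hcl hTr hX).
  have := hmix1 (mesh_vec_Pkv Omega hdet hreg hTr g).
  rewrite (cr_curl hX) addr0 (cr_load hX qE) -/v => <-; rewrite gv gu.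
  rewrite (innerv_const hdet hreg oO hint hcl mp1 mp2 mg1 mg2 pE gE).
  rewrite (innerv_const hdet hreg oO hint hcl mu1 mu2 mg1 mg2 gUE gE) => /esym/eqP.
  rewrite -subr_eq0 -sumrB => /eqP E; rewrite -[RHS]E; apply: eq_bigr => m _.
  by rewrite /r /dot /=; ring.
(* A potential with gradient [(- r.2, r.1)] has [Curl] equal to [(r.1, r.2)]. *)
pose w n : plane := (- (r n).2, (r n).1).
have hw := orthogonal_tangential orth; rewrite -/w in hw.
have [beta hbeta] := global_potential hdet cov (fun x Ox => mesh_local hdet oO Ox) hw hsc hne.
have [c mean0] := mesh_mean_zero w beta hne.
pose beta' y := beta y - c.
have hbeta' y : Omega y -> \forall z \near y, step V w y z (beta' z - beta' y).
  move=> /hbeta; apply: filterS => z; rewrite /beta' (_ : beta z - c - (beta y - c) = beta z - beta y)//.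
  by ring.
pose b := mesh_fun V (potential V w beta').
have Yb := potential_Y hdet hreg oO hint hcl hbox hw hbeta' mean0.
have Pb : Pk Omega Tr 1 b.
  split; first by apply: mesh_fun_measurable => // m; exact: loc_bounded_potential.
  move=> T /hTr[m ->]; exists (potential V w beta' m); first exact: poly2_affine.
  by move=> y; rewrite interior_tri// => my; exact: mesh_funE.
have w1 := weak_partialP Yb (or_introl erefl).
have w2 := weak_partialP Yb (or_intror erefl).
have := hmix2 Pb Yb; rewrite /innerv.
rewrite (integral_curl hdet hreg oO hint hcl hbox (fun m y my => mesh_funE hdet hreg _ my)
  w1 w2 (c := P)); last 2 first.
- exact: curl_measurable.
- by move=> m y my; rewrite (pE m).
move=> E1; have E2 := orth _ hU.
have : \sum_m area (V m) * dot (r m) (r m) = 0.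
  move: E1; rewrite -[X in _ = X -> _]E2 => /eqP; rewrite -subr_eq0 -sumrB => /eqP E.
  rewrite -[RHS]E; apply: eq_bigr => m _; rewrite -/(gU m) /w /=.
  rewrite (_ : P m = r m + gU m); last by rewrite /r subrK.
  by rewrite /dot /=; ring.
have rr m : 0 <= area (V m) * dot (r m) (r m).
  by rewrite mulr_ge0 ?(ltW (area_gt0 _))// /dot -!expr2 addr_ge0 ?sqr_ge0.
move=> /(psumr_eq0P (fun m _ => rr m))/(_ n isT)/eqP.
rewrite mulf_eq0 (gt_eqF (area_gt0 (hdet n))) /= /dot -!expr2 paddr_eq0 ?sqr_ge0//.
rewrite !sqrf_eq0 => /andP[/eqP r1 /eqP r2] nx_.
rewrite gu (mesh_vecE hdet hreg gU nx_) (pE n)//; apply/eqP; rewrite -subr_eq0 -/(r n).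
by rewrite [r n]surjective_pairing r1 r2.
Qed.

End Solutions.
End MeshMain.

(** * Indexing a triangulation, and the conclusion *)

Lemma bounded_set_box (R : realType) (A : set (R * R)%type) : bounded_set A ->
  exists M, A `<=` box M.
Proof.
move=> [M [_ hM]]; exists (M + 1) => x Ax.
have : `|x| <= M + 1 by apply: hM => //; rewrite ltrDl.
by rewrite prod_normE ge_max => /andP[].
Qed.

Lemma triangulation_mesh (R : realType) (Omega : set (R * R)%type) Tr :
  regular_triangulation Omega Tr ->
  exists (N : nat) (V : 'I_N -> 'I_3 -> (R * R)%type),
  [/\ forall n, det3 (V n) != 0, regular_mesh V,
      forall x, closure Omega x <-> exists n, tri (V n) x
    & forall T, Tr T <-> exists n, T = tri (V n)].
Proof.
move=> [/finite_seqP[s0 sE] hT hcl hreg].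
(* Without repetitions distinct indices carry distinct triangles, as the regularity condition
   presupposes. *)
pose s := undup s0.
have TrE T : Tr T <-> T \in s by rewrite mem_undup sE.
have hV (n : 'I_(size s)) : exists W, det3 W != 0 /\ nth set0 s n = tri W.
  by apply: is_triangle_vfun; apply: hT; apply/TrE; exact: mem_nth.
have [V VE] := choice hV.
have TrV T : Tr T <-> exists n, T = tri (V n).
  split=> [/TrE Ts|[n ->]]; last by rewrite -(VE n).2; apply/TrE; exact: mem_nth.
  have h : (index T s < size s)%N by rewrite index_mem.
  by exists (Ordinal h); rewrite -(VE (Ordinal h)).2 /= nth_index.
exists (size s), V; split.
- by move=> n; case: (VE n).
- move=> m n mn; apply: hreg; [by apply/TrV; exists m|by apply/TrV; exists n|].
  rewrite -(VE m).2 -(VE n).2 => /eqP; rewrite nth_uniq ?undup_uniq// => /eqP h.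
  by apply: mn; exact: val_inj.
- move=> x; rewrite hcl; split=> [[T /TrV[n ->] nx_]|[n nx_]]; first by exists n.
  by exists (tri (V n)) => //; apply/TrV; exists n.
- exact: TrV.
Qed.

Theorem proposition3p14 (R : realType) (Omega : set (R * R)%type)
    (Tr : set (set (R * R)%type))
    (f alpha_h u_CR : (R * R)%type -> R)
    (phi_RT p_h : (R * R)%type -> (R * R)%type)
    (hO : polygonal_lipschitz_domain Omega) (hsc : simply_connected Omega)
    (hTr : regular_triangulation Omega Tr)
    (hf : Pk Omega Tr 0 f)
    (hRT : RT0 Omega Tr phi_RT)
    (hdiv : is_weak_div Omega phi_RT (fun x => - f x))
    (hp : Pkv Omega Tr 0 p_h) (halpha : Pk Omega Tr 1 alpha_h /\ Y Omega alpha_h)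
    (hmix1 : forall q_h, Pkv Omega Tr 0 q_h ->
       innerv Omega p_h q_h + innerv Omega q_h (Curl Omega alpha_h) = innerv Omega phi_RT q_h)
    (hmix2 : forall beta_h, Pk Omega Tr 1 beta_h -> Y Omega beta_h ->
       innerv Omega p_h (Curl Omega beta_h) = 0)
    (hu : CR10 Omega Tr u_CR)
    (hCR : forall v_CR, CR10 Omega Tr v_CR ->
       innerv Omega (gradNC Tr u_CR) (gradNC Tr v_CR) = inner Omega f v_CR) :
  forall T, Tr T -> forall x, T° x -> p_h x = gradNC Tr u_CR x.
Proof.
have [oO _ hne hb [_ hlip]] := hO.
have hint := lipschitz_interior_closure oO hlip.
have [M0 hbox] := bounded_set_box hb.
have [N [V [hdet hreg hcl hTrV]]] := triangulation_mesh hTr.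
move=> T /hTrV[n ->] x; rewrite interior_tri// => nx_.
exact: (mesh_solution hdet hreg oO hint hcl hbox hTrV hsc hne hf hRT hdiv hp halpha hmix1 hmix2 hu hCR nx_).
Qed.
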